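(* Let $m_1\ge1$, $n\ge2$, $m=2m_1$ and $T=\overline{1,n}$. Consider the $osp(2m_1,2n)$-module $\mathcal A'_{m_1}$, the operator $\eta$ and the sets $B_{t,q}$ ($t,q\in\mathbb N$) defined in the context. The set $$\bigcup_{t,q\in\mathbb N;\ m_1-q\text{ even}}\eta^tB_{t,q}$$ forms a basis for the submodule $\langle\theta_1\cdots\theta_{m_1}\rangle$, and the set $$\bigcup_{t,q\in\mathbb N;\ m_1-q\text{ odd}}\eta^tB_{t,q}$$ forms a basis for the submodule $\langle(x_{n-1}x_{2n}-x_nx_{2n-1})\theta_1\cdots\theta_{m_1}\rangle$.
   Context: $\mathbb N$ is the set of nonnegative integers, $\overline{i,j}=\{i,\dots,j\}$. $E_{i,j}$ is the square matrix with $(i,j)$-entry $1$ and others zero. The Lie superalgebra $gl(m,2n)$ of $(m+2n)\times(m+2n)$ complex matrices has even part spanned by $E_{i,j}$ ($i,j\in\overline{1,m}$) and $E_{m+s,m+t}$ ($s,t\in\overline{1,2n}$), odd part spanned by $E_{i,m+s},E_{m+s,i}$, and bracket $[u,v]=uv-(-1)^{\iota_1\iota_2}vu$ for $u,v$ of parities $\iota_1,\iota_2$. For $m=2m_1$, $osp(m,2n)$ is the subalgebra of matrices $$\begin{pmatrix}A&B&H&H_1\\ C&-A^T&K&K_1\\ K_1^T&H_1^T&D&E\\ -K^T&-H^T&F&-D^T\end{pmatrix}$$ with $A,B,C$ of size $m_1\times m_1$, $B=-B^T$, $C=-C^T$; $D,E,F$ of size $n\times n$, $E=E^T$, $F=F^T$;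 $H,H_1,K,K_1$ of size $m_1\times n$. $\mathcal A'=\mathbb C[x_1,\dots,x_{2n};\theta_1,\dots,\theta_m]$ with commuting $x_i$, anticommuting $\theta_p$, $x_i\theta_p=\theta_px_i$; $\partial_{\theta_p}$ is the odd (left) derivation with $\partial_{\theta_p}(\theta_q)=\delta_{p,q}$. With $T=\overline{1,n}$ and $\bar T=\overline{n+1,2n}$, $osp(m,2n)$ acts on $\mathcal A'$ via: - $E_{p,q}\mapsto\theta_p\partial_{\theta_q}$ for $p,q\in\overline{1,m}$; - $E_{m+i,m+j}\mapsto -x_j\partial_{x_i}-\delta_{i,j}$ if $i,j\in T$; $\partial_{x_i}\partial_{x_j}$ if $i\in T,j\in\bar T$; $-x_ix_j$ if $i\in\bar T,j\in T$; $x_i\partial_{x_j}$ if $i,j\in\bar T$; - for $p\in\overline{1,m}$: $E_{m+i,p}\mapsto\partial_{x_i}\partial_{\theta_p}$ if $i\in T$, and $x_i\partial_{\theta_p}$ if $i\in\bar T$; $E_{p,m+j}\mapsto-\theta_px_j$ if $j\in T$, and $\theta_p\partial_{x_j}$ if $j\in\bar T$. $\mathcal A'_{m_1}$ is the span of all $x^\alpha\theta_{i_1}\cdots\theta_{i_t}$ with $t\in\overline{0,m}$, $i_1,\dots,i_t\in\overline{1,m}$, $\alpha\in\mathbb N^{2n}$, $\sum_{i\in\bar T}\alpha_i-\sum_{i\in T}\alpha_i=m_1-t$; it is an $osp(m,2n)$-submodule. $\langle F\rangle$ denotes the $osp(m,2n)$-submodule generated by $F$. Put $$\eta=\sum_{i=1}^nx_{n+i}\partial_{x_i}+\sum_{j=1}^{m_1}\theta_j\theta_{m_1+j}.$$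 Index data: $\vec k$ consists of $k_t\in\mathbb N$ ($1\le t\le n$) and $k_{i,j}\in\mathbb N$ ($1\le i<j\le n$); $\vec l$ consists of $l_t\in\{0,1\}$ ($1\le t\le2m_1$) and $l_{i,j}\in\{0,1\}$ ($1\le i<j\le m_1$); $\vec s$ consists of $s_{p,q}\in\{0,1\}$ ($1\le p\le n$, $1\le q\le m_1$). Define $$h(\vec k,\vec l,\vec s)=\prod_{t=1}^{n}x_t^{k_t}\prod_{1\le i<j\le n}(x_ix_{n+j}-x_jx_{n+i})^{k_{i,j}}\prod_{j=1}^{m_1}\theta_j^{l_j}\theta_{m_1+j}^{l_{m_1+j}}\prod_{1\le i<j\le m_1}(\theta_i\theta_{m_1+i}-\theta_j\theta_{m_1+j})^{l_{i,j}}\prod_{1\le p\le n,1\le q\le m_1}(x_{n+p}-x_p\theta_q\theta_{m_1+q})^{s_{p,q}}.$$ $I$ is the set of $(\vec k,\vec l,\vec s)$ satisfying all of: - $l_t+l_{m_1+t}+\sum_{1\le i<t}l_{i,t}+\sum_{t<j\le m_1}l_{t,j}+\sum_{p=1}^ns_{p,t}\le1$ for $t\in\overline{1,m_1}$; - $k_{i,j}k_t=0$ for $i<j<t$; $k_{i,j}k_{i',j'}=0$ for $i>i'$ and $j<j'$; - $k_tl_{i,j}=0$ for $t\in\overline{1,n}$, $1\le i<j\le m_1$; $k_ts_{p,q}=0$ for $t<p$; - $k_{i,j}s_{p,q}=0$ for $i<j<p$; $s_{p,q}s_{p',q'}=0$ for $p>p'$ and $q<q'$; - $l_{i,j}=0$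 if $l_t=l_{m_1+t}=\sum_{p=1}^ns_{p,t}=\sum_{i'<t}l_{i',t}+\sum_{j'>t}l_{t,j'}=0$ for some $i<t<j$; - $l_{i,j}l_{i',j'}=0$ if $i<i'<j<j'$; $l_{i,j}s_{p,q}=0$ if $i<j<q$. For $t,q\in\mathbb N$, $B_{t,q}$ is the set of all $h(\vec k,\vec l,\vec s)$ with $(\vec k,\vec l,\vec s)\in I$, $$\sum_{j=1}^{m_1}l_{m_1+j}+\sum_{1\le i<j\le m_1}l_{i,j}-\sum_{i=1}^nk_i-\sum_{1\le i<j\le n}k_{i,j}=m_1-2t-q$$ and $$\sum_{j=1}^{m_1}l_j+\sum_{1\le i<j\le m_1}l_{i,j}+\sum_{p=1}^n\sum_{j=1}^{m_1}s_{p,j}+\sum_{1\le i<j\le n}k_{i,j}=q.$$ *)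

(* Defs.v *)
From HB Require Import structures.
From mathcomp Require Import all_boot all_order all_algebra.
From mathcomp Require Import reals complex.
From mathcomp Require Import mpoly.

Set Implicit Arguments.
Unset Strict Implicit.
Unset Printing Implicit Defensive.

Import GRing.Theory.
Local Open Scope ring_scope.

(* Linear algebra in a possibly infinite-dimensional module; subsets are
   predicates. *)
Section LinearAlgebra.
Variables (R : nzRingType) (V : lmodType R).
Implicit Types (S W : V -> Prop).

Definition lspan S (v : V) : Prop :=
  exists2 s : seq (R * V), (forall x, x \in s -> S x.2)
                         & v = \sum_(x <- s) x.1 *: x.2.

Definition lin_indep S : Prop :=
  forall (s : seq V) (c : V -> R),
    uniq s -> (forall u, u \in s -> S u) ->
    \sum_(u <- s) c u *: u = 0 -> forall u, u \in s -> c u = 0.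

Definition is_basis S W : Prop :=
  lin_indep S /\ (forall v, W v <-> lspan S v).

End LinearAlgebra.

(* The superalgebra R[x_0, ..., x_(N-1); theta_0, ..., theta_(m-1)]: the
   element f stands for the sum over S = {p_1 < ... < p_t} of
   (f S) theta_(p_1) ... theta_(p_t). *)
Definition superpoly (R : comNzRingType) (N m : nat) :=
  {ffun {set 'I_m} -> {mpoly R[N]}}.

HB.instance Definition _ (R : comNzRingType) (N m : nat) :=
  GRing.Lmodule.copy (superpoly R N m) {ffun {set 'I_m} -> {mpoly R[N]}}.

Section SuperPoly.
Variables (R : comNzRingType) (N m : nat).
Local Notation A := (superpoly R N m).
Implicit Types (f g h : A) (S T U : {set 'I_m}).

(* theta_S theta_T = (-1)^(ninv S T) theta_(S u T) for disjoint S and T *)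
Definition ninv S T : nat := (\sum_(a in S) \sum_(b in T) (b < a))%N.

Definition sp_one : A := [ffun S => (S == set0)%:R].

Definition sp_mul f g : A :=
  [ffun U => \sum_(S : {set 'I_m})
     \sum_(T : {set 'I_m} | [disjoint S & T] && (S :|: T == U))
       (-1) ^+ ninv S T * (f S * g T)].

Lemma ninvUl S T U : [disjoint S & T] -> ninv (S :|: T) U = (ninv S U + ninv T U)%N.
Proof.
by move=> d; rewrite -bigU //; apply: eq_bigl => a; rewrite !inE.
Qed.

Lemma ninvUr S T U : [disjoint T & U] -> ninv S (T :|: U) = (ninv S T + ninv S U)%N.
Proof.
move=> d; rewrite -big_split; apply: eq_bigr => a _ /=.
by rewrite -bigU //; apply: eq_bigl => b; rewrite !inE.
Qed.

Lemma ninv0s T : ninv set0 T = 0%N.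
Proof. by rewrite /ninv big_set0. Qed.

Lemma ninvs0 S : ninv S set0 = 0%N.
Proof. by rewrite /ninv big1 // => a _; rewrite big_set0. Qed.

Lemma sum_collapse (P : pred {set 'I_m}) (F : {set 'I_m} -> {set 'I_m} -> {mpoly R[N]}) :
  \sum_(X | P X) \sum_(S : {set 'I_m})
     \sum_(T : {set 'I_m} | [disjoint S & T] && (S :|: T == X)) F S T =
  \sum_(S : {set 'I_m})
     \sum_(T : {set 'I_m} | [disjoint S & T] && P (S :|: T)) F S T.
Proof.
rewrite exchange_big /=; apply: eq_bigr => S _.
rewrite (exchange_big_dep (fun T => [disjoint S & T] && P (S :|: T))) /=.
  apply: eq_bigr => T /andP[dST PST].
  rewrite (big_pred1 (S :|: T)) // => X; rewrite dST eq_sym /=.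
  by case: eqP => [->|]; rewrite ?PST ?andbF.
by move=> X T PX /andP[-> /eqP ->].
Qed.

Lemma sp_mulA : associative sp_mul.
Proof.
pose F f g h S T U := 
  (-1) ^+ (ninv S T + ninv S U + ninv T U) * (f S * g T * h U) : {mpoly R[N]}.
move=> f g h; apply/ffunP => W; rewrite !ffunE.
transitivity (\sum_(S : {set 'I_m}) \sum_(T : {set 'I_m})
   \sum_(U : {set 'I_m} |
     [disjoint T & U] && ([disjoint S & T :|: U] && (S :|: (T :|: U) == W)))
   F f g h S T U).
  apply: eq_bigr => S _.
  rewrite -(sum_collapse (fun X => [disjoint S & X] && (S :|: X == W))).
  apply: eq_bigr => X _; rewrite ffunE 2!mulr_sumr; apply: eq_bigr => T _.
  rewrite 2!mulr_sumr; apply: eq_bigr => U /andP[dTU /eqP <-].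
  rewrite ninvUr // /F [in RHS]exprD -!mulrA; congr (_ * _).
  by rewrite mulrCA.
transitivity (\sum_(U : {set 'I_m}) \sum_(S : {set 'I_m})
   \sum_(T : {set 'I_m} |
     [disjoint S & T] && ([disjoint S :|: T & U] && (S :|: T :|: U == W)))
   F f g h S T U).
  rewrite [RHS]exchange_big; apply: eq_bigr => S _ /=.
  under [RHS]eq_bigr => U _ do rewrite big_mkcond.
  rewrite [RHS]exchange_big; apply: eq_bigr => T _ /=.
  rewrite big_mkcond; apply: eq_bigr => U _ /=.
  rewrite setUA -!setI_eq0 setIUr setIUl !setU_eq0.
  by do 3![case: (_ :&: _ == _) => //=].
rewrite [RHS](eq_bigr (fun X : {set 'I_m} => \sum_(U : {set 'I_m})
   if [disjoint X & U] && (X :|: U == W) then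
     (-1) ^+ ninv X U * (sp_mul f g X * h U) else 0)); last first.
  by move=> X _; rewrite big_mkcond.
rewrite [RHS]exchange_big /=; apply: eq_bigr => U _.
rewrite -big_mkcond -(sum_collapse (fun X => [disjoint X & U] && (X :|: U == W))).
apply: eq_bigr => X _; rewrite ffunE mulr_suml mulr_sumr; apply: eq_bigr => S _.
rewrite mulr_suml mulr_sumr; apply: eq_bigr => T /andP[dST /eqP <-].
by rewrite ninvUl // /F -addnA exprD -!mulrA mulrCA.
Qed.

Lemma sp_mul1l : left_id sp_one sp_mul.
Proof.
move=> f; apply/ffunP => W; rewrite ffunE (bigD1 set0) //= [X in _ + X]big1 ?addr0.
  rewrite (big_pred1 W) => [|T]; last by rewrite set0U -setI_eq0 set0I eqxx.
  by rewrite ninv0s ffunE eqxx expr0 !mul1r.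
move=> S /negbTE nS; apply: big1 => T _.
by rewrite ffunE nS mul0r mulr0.
Qed.

Lemma sp_mul1r : right_id sp_one sp_mul.
Proof.
move=> f; apply/ffunP => W; rewrite ffunE (bigD1 W) //= [X in _ + X]big1 ?addr0.
  rewrite (bigD1 set0) /= -?setI_eq0 ?setI0 ?setU0 ?eqxx //.
  rewrite big1 => [|T /andP[_ /negbTE nT]]; last by rewrite ffunE nT !mulr0.
  by rewrite ninvs0 ffunE eqxx expr0 mul1r mulr1 addr0.
move=> S /negbTE nS; apply: big1 => T; rewrite [sp_one _]ffunE.
by case: (altP (T =P set0)) => [->|]; rewrite ?setU0 ?nS ?andbF // !mulr0.
Qed.

Lemma sp_mulDl : left_distributive sp_mul +%R.
Proof.
move=> f g h; apply/ffunP => W; rewrite !ffunE -big_split; apply: eq_bigr => S _.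
rewrite -big_split; apply: eq_bigr => T _.
by rewrite ffunE mulrDl mulrDr.
Qed.

Lemma sp_mulDr : right_distributive sp_mul +%R.
Proof.
move=> f g h; apply/ffunP => W; rewrite !ffunE -big_split; apply: eq_bigr => S _.
rewrite -big_split; apply: eq_bigr => T _.
by rewrite ffunE mulrDr mulrDr.
Qed.

Lemma sp_one_neq0 : sp_one != 0.
Proof.
by apply/eqP => /ffunP/(_ set0)/eqP; rewrite !ffunE eqxx oner_eq0.
Qed.

HB.instance Definition _ := GRing.Zmodule_isNzRing.Build (superpoly R N m)
  sp_mulA sp_mul1l sp_mul1r sp_mulDl sp_mulDr sp_one_neq0.

Lemma sp_scaleAl (c : R) f g : c *: (f * g) = (c *: f) * g.
Proof.
apply/ffunP => W; rewrite !ffunE scaler_sumr; apply: eq_bigr => S _.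
rewrite scaler_sumr; apply: eq_bigr => T _.
by rewrite ffunE -scalerAl -scalerAr.
Qed.

HB.instance Definition _ :=
  GRing.Lmodule_isLalgebra.Build R (superpoly R N m) sp_scaleAl.

Lemma sp_scaleAr (c : R) f g : c *: (f * g) = f * (c *: g).
Proof.
apply/ffunP => W; rewrite !ffunE scaler_sumr; apply: eq_bigr => S _.
rewrite scaler_sumr; apply: eq_bigr => T _.
by rewrite ffunE -!scalerAr.
Qed.

HB.instance Definition _ :=
  GRing.Lalgebra_isAlgebra.Build R (superpoly R N m) sp_scaleAr.

End SuperPoly.

Section Generators.
Variables (R : comNzRingType) (N m : nat).
Local Notation A := (superpoly R N m).
Implicit Types (f g : A) (i : 'I_N) (p q : 'I_m) (S : {set 'I_m}).

Definition spX i : A := [ffun S => if S == set0 then 'X_i else 0].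
Definition theta p : A := [ffun S => (S == [set p])%:R].

Definition dX i f : A := [ffun S => mderiv i (f S)].

(* d/d theta_p sends theta_p theta_S to theta_S and theta_S to 0 when p is not
   in S; see [dtheta_theta] and [dthetaM] for the odd Leibniz rule. *)
Definition dtheta p f : A :=
  [ffun S : {set _} => if p \in S then 0 else (-1) ^+ ninv [set p] S * f (p |: S)].

Lemma spXME i f : spX i * f = [ffun S => 'X_i * f S].
Proof.
apply/ffunP => W; rewrite !ffunE (bigD1 set0) //= [X in _ + X]big1 ?addr0.
  rewrite (big_pred1 W) => [|T]; last by rewrite set0U -setI_eq0 set0I eqxx.
  by rewrite ninv0s ffunE eqxx expr0 mul1r.
move=> S /negbTE nS; apply: big1 => T _.
by rewrite ffunE nS mul0r mulr0.
Qed.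

Lemma spXMr i f : f * spX i = [ffun S => 'X_i * f S].
Proof.
apply/ffunP => W; rewrite !ffunE (bigD1 W) //= [X in _ + X]big1 ?addr0.
  rewrite (bigD1 set0) /= -?setI_eq0 ?setI0 ?setU0 ?eqxx //.
  rewrite big1 => [|T /andP[_ /negbTE nT]]; last by rewrite ffunE nT !mulr0.
  by rewrite ninvs0 ffunE eqxx expr0 mul1r addr0 mulrC.
move=> S /negbTE nS; apply: big1 => T; rewrite [spX _ _]ffunE.
by case: (altP (T =P set0)) => [->|]; rewrite ?setU0 ?nS ?andbF // !mulr0.
Qed.

Lemma spX_comm i f : spX i * f = f * spX i.
Proof. by rewrite spXME spXMr. Qed.

Lemma thetaME p f : theta p * f =
  [ffun S : {set _} => if p \in S then (-1) ^+ ninv [set p] (S :\ p) * f (S :\ p) else 0].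
Proof.
apply/ffunP => W; rewrite !ffunE (bigD1 [set p]) //= [X in _ + X]big1 ?addr0.
  case: ifP => pW; last first.
    rewrite big1 // => T /andP[_ /eqP eW].
    by rewrite -eW !inE eqxx in pW.
  rewrite (big_pred1 (W :\ p)) => [|T].
    by rewrite ffunE eqxx mul1r.
  rewrite disjoints1; apply/andP/eqP => [[pT /eqP <-]|->].
    by rewrite setU1K.
  by rewrite !inE eqxx setD1K.
move=> S /negbTE nS; apply: big1 => T _.
by rewrite ffunE nS mul0r mulr0.
Qed.

Lemma ninv1s p S : ninv [set p] S = (\sum_(b in S) (b < p))%N.
Proof. by rewrite /ninv big_set1. Qed.

Lemma ninvU1 p q S : q \notin S -> ninv [set p] (q |: S) = ((q < p) + ninv [set p] S)%N.
Proof. by move=> qS; rewrite !ninv1s big_setU1. Qed.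

Lemma sign_swap p q : p != q -> (-1) ^+ (p < q)%N = - (-1) ^+ (q < p)%N :> {mpoly R[N]}.
Proof.
by rewrite -val_eqE /=; case: ltngtP; rewrite ?expr0 ?expr1 ?opprK.
Qed.

Lemma thetaC p q : theta p * theta q = - (theta q * theta p).
Proof.
suff H f : theta p * (theta q * f) = - (theta q * (theta p * f)).
  by rewrite -[theta q in LHS]mulr1 -[theta p in RHS]mulr1 H.
apply/ffunP => S; rewrite !thetaME !ffunE !inE.
have [<-|npq] := eqVneq p q.
  by rewrite /= mulr0 if_same oppr0.
rewrite /=.
case: (boolP (p \in S)) => pS; case: (boolP (q \in S)) => qS;
  rewrite ?mulr0 ?oppr0 //.
set T := S :\ p :\ q.
have eT : S :\ q :\ p = T by rewrite /T !setDDl setUC.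
rewrite eT.
have -> : S :\ p = q |: T by rewrite setD1K // in_setD1 eq_sym npq.
have -> : S :\ q = p |: T by rewrite -eT setD1K // in_setD1 npq.
have pT : p \notin T by rewrite -eT !inE eqxx.
have qT : q \notin T by rewrite !inE eqxx.
rewrite !ninvU1 //.
rewrite !exprD (sign_swap npq) !mulNr opprK -!mulrA; congr (_ * _).
by rewrite mulrCA.
Qed.

Lemma dthetaX p i f : dtheta p (spX i * f) = spX i * dtheta p f.
Proof.
apply/ffunP => S; rewrite !spXME !ffunE; case: ifP; rewrite ?mulr0 //.
by rewrite mulrCA.
Qed.

Lemma dtheta1 p : dtheta p 1 = 0.
Proof.
apply/ffunP => S; rewrite !ffunE; case: ifP => // _.
have /negbTE -> : p |: S != set0 by apply/set0Pn; exists p; rewrite setU11.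
by rewrite mulr0.
Qed.

Lemma dthetaM p q f :
  dtheta p (theta q * f) = (p == q)%:R * f - theta q * dtheta p f.
Proof.
have eqM : (p == q)%:R * f = if p == q then f else 0.
  by case: eqP; rewrite ?mul1r ?mul0r.
rewrite eqM; apply/ffunP => S; rewrite !thetaME !ffunE !inE.
have [<-|npq] := eqVneq p q; rewrite /=.
  case: (boolP (p \in S)) => pS; rewrite ?eqxx /=.
    by rewrite setD1K // mulrA -expr2 sqrr_sign mul1r subrr.
  by rewrite setU1K // mulrA -expr2 sqrr_sign mul1r subr0.
rewrite ffunE sub0r /=; case: (boolP (p \in S)) => pS.
  by rewrite mulr0 if_same oppr0.
case: (boolP (q \in S)) => qS; last by rewrite mulr0 oppr0.
set T := S :\ q; have -> : S = q |: T by rewrite setD1K.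
have qT : q \notin T by rewrite !inE eqxx.
have pT : p \notin T by rewrite !inE (negbTE pS) andbF.
have -> : (p |: (q |: T)) :\ q = p |: T.
  by rewrite setUCA setU1K // in_setU1 negb_or qT eq_sym npq.
rewrite !ninvU1 // !exprD (sign_swap npq) !mulNr mulrN; congr (- _).
rewrite !mulrA [_ * _ * (_ ^+ (q < p)%N)]mulrAC -expr2 sqrr_sign mul1r.
by congr (_ * _); rewrite mulrC.
Qed.

Lemma dtheta_theta p q : dtheta p (theta q) = (p == q)%:R.
Proof. by rewrite -[theta q]mulr1 dthetaM dtheta1 mulr0 subr0 mulr1. Qed.

End Generators.

Section OspModule.
Variables (R : comNzRingType) (m1 n : nat).
Local Notation A := (superpoly R (n + n) (m1 + m1)).
Local Notation M := 'M[R]_((m1 + m1) + (n + n)).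
Implicit Types (f g v F : A) (V : A -> Prop).

Definition in_osp (X : M) : Prop :=
  exists (A B C : 'M[R]_m1) (D E F : 'M[R]_n) (H H1 K K1 : 'M[R]_(m1, n)),
    [/\ B = - B^T, C = - C^T, E = E^T, F = F^T &
        X = block_mx (block_mx A B C (- A^T))
                     (block_mx H H1 K K1)
                     (block_mx K1^T H1^T (- K^T) (- H^T))
                     (block_mx D E F (- D^T))].

(* The operator by which E_(a,b) acts. The outer [split] separates the theta
   indices from the x indices, the inner ones T from its complement. *)
Definition Eact (a b : 'I_((m1 + m1) + (n + n))) f : A :=
  match split a, split b with
  | inl p, inl q => theta R _ p * dtheta q f
  | inr i, inr j =>
      match split i, split j with
      | inl _, inl _ => - (spX R _ j * dX i f) - (i == j)%:R *: f
      | inl _, inr _ => dX i (dX j f)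
      | inr _, inl _ => - (spX R _ i * spX R _ j * f)
      | inr _, inr _ => spX R _ i * dX j f
      end
  | inr i, inl p =>
      if split i is inl _ then dX i (dtheta p f) else spX R _ i * dtheta p f
  | inl p, inr j =>
      if split j is inl _ then - (theta R _ p * spX R _ j * f)
      else theta R _ p * dX j f
  end.

Definition act (X : M) f : A := \sum_a \sum_b X a b *: Eact a b f.

Definition osp_submodule V : Prop :=
  [/\ V 0, forall f g, V f -> V g -> V (f + g),
      forall (c : R) f, V f -> V (c *: f)
    & forall X f, in_osp X -> V f -> V (act X f)].

(* A'_(m1) *)
Definition Am1 : A -> Prop :=
  lspan (fun v => exists (al : 'I_(n + n) -> nat) (s : seq 'I_(m1 + m1)),
    [/\ (size s <= m1 + m1)%N,
        (\sum_(i < n) al (rshift n i))%N%:Z - (\sum_(i < n) al (lshift n i))%N%:Z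
          = m1%:Z - (size s)%:Z
      & v = \prod_i spX R _ i ^+ al i * \prod_(p <- s) theta R _ p]).

(* The submodule of A'_(m1) generated by F. *)
Definition generated F v : Prop :=
  forall V, osp_submodule V -> (forall f, V f -> Am1 f) -> V F -> V v.

End OspModule.

Section Basis.
Variables (R : comNzRingType) (m1 n : nat).
Local Notation A := (superpoly R (n + n) (m1 + m1)).

(* x_i, x_(n+i), theta_j and theta_(m1+j) *)
Definition xl (i : 'I_n) : A := spX R _ (lshift n i).
Definition xr (i : 'I_n) : A := spX R _ (rshift n i).
Definition thl (j : 'I_m1) : A := theta R _ (lshift m1 j).
Definition thr (j : 'I_m1) : A := theta R _ (rshift m1 j).

Definition eta (f : A) : A :=
  \sum_(i < n) xr i * dX (lshift n i) f + \sum_(j < m1) thl j * thr j * f.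

(* The values of [kks] and [lls] at (i, j) matter only for i < j. *)
Record index_data := IndexData {
  ks : 'I_n -> nat;
  kks : 'I_n -> 'I_n -> nat;
  ls : 'I_(m1 + m1) -> bool;
  lls : 'I_m1 -> 'I_m1 -> bool;
  ss : 'I_n -> 'I_m1 -> bool
}.
Implicit Types d : index_data.

Definition hvec d : A :=
  \prod_(t < n) xl t ^+ ks d t *
  \prod_(i < n) \prod_(j < n | (i < j)%N)
    (xl i * xr j - xl j * xr i) ^+ kks d i j *
  \prod_(j < m1) (thl j ^+ ls d (lshift m1 j) * thr j ^+ ls d (rshift m1 j)) *
  \prod_(i < m1) \prod_(j < m1 | (i < j)%N)
    (thl i * thr i - thl j * thr j) ^+ lls d i j *
  \prod_(p < n) \prod_(q < m1) (xr p - xl p * thl q * thr q) ^+ ss d p q.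

Local Open Scope nat_scope.

Definition ll_deg d (t : 'I_m1) : nat :=
  \sum_(i < m1 | i < t) lls d i t + \sum_(j < m1 | t < j) lls d t j.
Definition s_deg d (t : 'I_m1) : nat := \sum_(p < n) ss d p t.

Record in_I d : Prop := InI {
  I_deg : forall t : 'I_m1,
    ls d (lshift m1 t) + ls d (rshift m1 t) + ll_deg d t + s_deg d t <= 1;
  I_kk_k : forall i j t : 'I_n, i < j -> j < t -> kks d i j * ks d t = 0;
  I_kk_kk : forall i j i' j' : 'I_n, i < j -> i' < j' -> i' < i -> j < j' ->
    kks d i j * kks d i' j' = 0;
  I_k_ll : forall (t : 'I_n) (i j : 'I_m1), i < j -> ks d t * lls d i j = 0;
  I_k_s : forall (t p : 'I_n) (q : 'I_m1), t < p -> ks d t * ss d p q = 0;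
  I_kk_s : forall (i j p : 'I_n) (q : 'I_m1), i < j -> j < p ->
    kks d i j * ss d p q = 0;
  I_s_s : forall (p p' : 'I_n) (q q' : 'I_m1), p' < p -> q < q' ->
    ss d p q * ss d p' q' = 0;
  I_ll_gap : forall i t j : 'I_m1, i < t -> t < j ->
    ls d (lshift m1 t) = 0 :> nat -> ls d (rshift m1 t) = 0 :> nat ->
    s_deg d t = 0 -> ll_deg d t = 0 -> lls d i j = 0 :> nat;
  I_ll_ll : forall i j i' j' : 'I_m1, i < i' -> i' < j -> j < j' ->
    lls d i j * lls d i' j' = 0;
  I_ll_s : forall (i j q : 'I_m1) (p : 'I_n), i < j -> j < q ->
    lls d i j * ss d p q = 0
}.

Definition sum_k d := \sum_(i < n) ks d i.
Definition sum_kk d := \sum_(i < n) \sum_(j < n | i < j) kks d i j.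
Definition sum_ll d := \sum_(i < m1) \sum_(j < m1 | i < j) lls d i j.
Definition sum_s d := \sum_(p < n) \sum_(j < m1) ss d p j.

Definition B_set (t q : nat) (v : A) : Prop :=
  exists d, [/\ in_I d,
    ((\sum_(j < m1) ls d (rshift m1 j))%N%:Z + (sum_ll d)%:Z - (sum_k d)%:Z
       - (sum_kk d)%:Z = m1%:Z - 2 * t%:Z - q%:Z)%R,
    \sum_(j < m1) ls d (lshift m1 j) + sum_ll d + sum_s d + sum_kk d = q
    & v = hvec d].

(* The union of the eta^t B_(t,q) over the t and q with P q. *)
Definition eta_B (P : nat -> Prop) (v : A) : Prop :=
  exists t q w, [/\ P q, B_set t q w & v = iter t eta w].

Definition even_gen : A := (\prod_(j < m1) thl j)%R.

Lemma ord_last_subproof : 1 < n -> n.-1 < n.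
Proof. by case: n. Qed.

Lemma ord_penult_subproof : 1 < n -> n.-2 < n.
Proof. by case: n => [|[|n']] // _; rewrite ltnW. Qed.

(* (x_(n-1) x_(2n) - x_n x_(2n-1)) theta_1 ... theta_(m1) *)
Definition odd_gen (n_gt1 : 1 < n) : A :=
  let u := Ordinal (ord_penult_subproof n_gt1) in
  let w := Ordinal (ord_last_subproof n_gt1) in
  ((xl u * xr w - xl w * xr u) * even_gen)%R.

End Basis.

(* Submission.v *)
From HB Require Import structures.
Require Import Defs.
From mathcomp Require Import all_boot all_order all_algebra perm.
From mathcomp Require Import reals complex.
From mathcomp Require Import mpoly ssrAC ring zify.

(* Attach a bosonic letter to every pair (x_i, x_(n+i)) and a fermionic letter
   to every pair (theta_j, theta_(m1+j)). In terms of the operators P, N, Pd, Nd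
   of these letters osp acts by the quadratic elements P_a N_b, P_a Pd_b + N_a Nd_b
   and Pd_a Nd_b. The involution sigma, which swaps x_i with x_(n+i) and performs
   a particle-hole exchange on every fermionic letter, conjugates P to N and Pd to
   Nd, hence commutes with osp. It acts on the two generators with opposite signs,
   and the two submodules together fill A'_(m1): they are the two eigenspaces of
   sigma on A'_(m1).

   Up to sign, eta^t h(k,l,s) is t! e_t(s) prod_C [a b] Theta_w, where s is a list
   of 2t letters, e_t(s) is the coefficient of X^t in prod_(a in s) (z_a + zb_a X),
   the columns [a b] = z_a zb_b - z_b zb_a come from a list C of pairs of letters
   and w lists the unpaired thetas. Since sigma multiplies it by (-1)^q, it is
   enough to show that the union of all the eta^t B_(t,q) is a basis of A'_(m1).

   Spanning: polarization reduces monomials to such products, and the Pluecker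
   relations rewrite a product violating a condition of I into products of smaller
   weight. Independence: apply eta^T for the largest t = T occurring; what survives
   is a combination of products with e_(2T)(s) = prod zb_a, whose leading monomials
   determine the index data. *)

Set Implicit Arguments.
Unset Strict Implicit.
Unset Printing Implicit Defensive.

Import Order.TTheory GRing.Theory Num.Theory.
Local Open Scope ring_scope.

(** Why filling A'_(m1) suffices: the eigenspaces of [sigma] for opposite signs meet only in 0
    because 2 is invertible. Two submodules, one inside each eigenspace, whose sum is everything
    must therefore be the eigenspaces themselves; spanning sets made of eigenvectors split in the
    same way.

    The particle-hole exchange makes the two kinds of letters uniform. At a fermionic site z = 1 and
    zb = theta_j theta_(m1+j), so for every letter [eta] acts as z -> zb -> 0 and [sigma] exchanges
    z and zb. Hence [eta] raises e_k to (k+1) e_(k+1), while [sigma] reverses e_k(s) into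
    e_(|s|-k)(s). Charge 0 forces |s| = 2t, so e_t is the middle coefficient, which the reversal
    fixes. The remaining sign has two sources, one factor -1 per column and one per lone theta_j
    with j <= m1, and q counts exactly these.

    Thetas can only be lowered in pairs, so the parity of m1 enters the generation argument.
    Division is needed by 2, by the binomials of the polarization and by factorials; this is why the
    ground ring is any commutative ring satisfying [natinv]. *)

Section Operators.
Variables (R : comNzRingType) (N m : nat).
Local Notation A := (superpoly R N m).
Implicit Types (f g : A) (i j : 'I_N) (p q : 'I_m) (S : {set 'I_m}).

Lemma dX_is_linear i : linear (@dX R N m i).
Proof. by move=> c f g; apply/ffunP => S; rewrite !ffunE mderivD mderivZ. Qed.
HB.instance Definition _ i :=
  GRing.isLinear.Build R A A _ (@dX R N m i) (@dX_is_linear i).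

Lemma dtheta_is_linear p : linear (@dtheta R N m p).
Proof.
move=> c f g; apply/ffunP => S; rewrite !ffunE.
case: ifP => _; first by rewrite scaler0 addr0.
by rewrite mulrDr scalerAr.
Qed.
HB.instance Definition _ p :=
  GRing.isLinear.Build R A A _ (@dtheta R N m p) (@dtheta_is_linear p).

Lemma spX_central i f : GRing.comm f (spX R m i).
Proof. by rewrite /GRing.comm spX_comm. Qed.

Lemma spX_mulCA i f g : f * (spX R m i * g) = spX R m i * (f * g).
Proof. by rewrite !mulrA spX_comm. Qed.

Lemma thetaCA p q f : theta R N p * (theta R N q * f) = - (theta R N q * (theta R N p * f)).
Proof. by rewrite !mulrA thetaC mulNr. Qed.

Lemma theta_sqr0 p : theta R N p * theta R N p = 0.
Proof.
rewrite thetaME; apply/ffunP => S; rewrite !ffunE; case: ifP => // pS.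
case: eqP => [/setP/(_ p)|_]; first by rewrite !inE eqxx.
by rewrite mulr0.
Qed.

Lemma thetathetaA p f : theta R N p * (theta R N p * f) = 0.
Proof. by rewrite mulrA theta_sqr0 mul0r. Qed.

Lemma dX1 i : dX i (1 : A) = 0.
Proof. by apply/ffunP => S; rewrite !ffunE; case: eqP => _; rewrite ?mderiv1 ?mderiv0 // -[1]mpolyC1 mderivC. Qed.

Lemma dX_spX i j f : dX i (spX R m j * f) = (i == j)%:R *: f + spX R m j * dX i f.
Proof.
apply/ffunP => S; rewrite !spXME !ffunE mderivM mderivX mnm1E eq_sym.
case: eqP => [->|_]; last by rewrite !scale0r mul0r.
have -> : (U_(j) - U_(j) = 0 :> 'X_{1..N})%MM by rewrite -{1}[U_(j)%MM]add0m addmK.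
by rewrite mpolyX0 !scale1r mul1r.
Qed.

Lemma dX_theta i p f : dX i (theta R N p * f) = theta R N p * dX i f.
Proof.
apply/ffunP => S; rewrite !thetaME !ffunE; case: ifP => _; last by rewrite mderiv0.
by rewrite -signr_odd; case: (odd _); rewrite ?expr1 ?expr0 ?mulN1r ?mul1r ?mderivN.
Qed.

Lemma dX_comm i j f : dX i (dX j f) = dX j (dX i f).
Proof. by apply/ffunP => S; rewrite !ffunE mderiv_comm. Qed.

Lemma dX_dtheta i p f : dX i (dtheta p f) = dtheta p (dX i f).
Proof.
apply/ffunP => S; rewrite !ffunE; case: ifP => _; first by rewrite mderiv0.
by rewrite -signr_odd; case: (odd _); rewrite ?expr1 ?expr0 ?mulN1r ?mul1r ?mderivN.
Qed.

Lemma dthetaC p q f : dtheta p (dtheta q f) = - dtheta q (dtheta p f).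
Proof.
apply/ffunP => S; rewrite !ffunE !inE.
have [<-|npq] := eqVneq p q; first by rewrite !mulr0 !if_same oppr0.
rewrite /=; case: (boolP (p \in S)) => pS; case: (boolP (q \in S)) => qS;
  rewrite ?mulr0 ?oppr0 //=.
rewrite ?(negbTE pS) ?(negbTE qS) ?(negbTE npq) /= ?[q == p]eq_sym ?(negbTE npq) /=.
rewrite !ninvU1 // !exprD (sign_swap _ _ npq) setUCA.
by rewrite !mulNr mulrN mulrCA -!mulrA; congr (- _); rewrite mulrCA; congr (_ * _); rewrite mulrCA.
Qed.

End Operators.

(** * Bosonic and fermionic letters, and the osp action through them *)

Section Letters.
Variables (R : comNzRingType) (m1 n : nat).
Local Notation A := (superpoly R (n + n) (m1 + m1)).
Local Notation L := ('I_n + 'I_m1)%type.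
Implicit Types (f g : A) (a b c d : L).

(* The letter [inl i] stands for the pair (x_i, x_(n+i)) and [inr j] for the pair
   (theta_j, theta_(m1+j)); Pd and Nd are dual to P and N, see PdP and NdN. *)
Definition Pop a f : A :=
  match a with inl i => xr R m1 i * f | inr j => thl R n j * f end.
Definition Nop a f : A :=
  match a with inl i => xl R m1 i * f | inr j => dtheta (rshift m1 j) f end.
Definition Pd a f : A :=
  match a with inl i => dX (rshift n i) f | inr j => dtheta (lshift m1 j) f end.
Definition Nd a f : A :=
  match a with inl i => dX (lshift n i) f | inr j => thr R n j * f end.

Lemma Pop_is_linear a : linear (Pop a).
Proof. by case: a => i c f g /=; rewrite mulrDr scalerAr. Qed.
HB.instance Definition _ a := GRing.isLinear.Build R A A _ (Pop a) (@Pop_is_linear a).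
Lemma Nop_is_linear a : linear (Nop a).
Proof. by case: a => i c f g /=; rewrite ?linearP // mulrDr scalerAr. Qed.
HB.instance Definition _ a := GRing.isLinear.Build R A A _ (Nop a) (@Nop_is_linear a).
Lemma Pd_is_linear a : linear (Pd a).
Proof. by case: a => i c f g /=; rewrite linearP. Qed.
HB.instance Definition _ a := GRing.isLinear.Build R A A _ (Pd a) (@Pd_is_linear a).
Lemma Nd_is_linear a : linear (Nd a).
Proof. by case: a => i c f g /=; rewrite ?linearP // mulrDr scalerAr. Qed.
HB.instance Definition _ a := GRing.isLinear.Build R A A _ (Nd a) (@Nd_is_linear a).

Definition isf a : bool := if a is inr _ then true else false.
Definition sg a b : R := (-1) ^+ (isf a && isf b).

Lemma sgC a b : sg a b = sg b a. Proof. by rewrite /sg andbC. Qed.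
Lemma sgK a b : sg a b * sg a b = 1.
Proof. by rewrite -expr2 sqrr_sign. Qed.

Lemma eq_inl (i j : 'I_n) : ((inl i : L) == inl j) = (i == j).
Proof. by []. Qed.
Lemma eq_inr (i j : 'I_m1) : ((inr i : L) == inr j) = (i == j).
Proof. by []. Qed.

Lemma PPC a b f : Pop a (Pop b f) = sg a b *: Pop b (Pop a f).
Proof.
case: a b => [i|i] [j|j]; rewrite /sg /= ?scale1r.
- exact: spX_mulCA.
- by rewrite -spX_mulCA.
- exact: spX_mulCA.
- by rewrite scaleN1r; exact: thetaCA.
Qed.
Lemma NNC a b f : Nop a (Nop b f) = sg a b *: Nop b (Nop a f).
Proof.
case: a b => [i|i] [j|j]; rewrite /sg /= ?scale1r.
- exact: spX_mulCA.
- by rewrite -dthetaX.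
- exact: dthetaX.
- by rewrite scaleN1r; exact: dthetaC.
Qed.
Lemma PNC a b f : Pop a (Nop b f) = sg a b *: Nop b (Pop a f).
Proof.
case: a b => [i|i] [j|j]; rewrite /sg /= ?scale1r.
- exact: spX_mulCA.
- by rewrite -dthetaX.
- exact: spX_mulCA.
- by rewrite scaleN1r dthetaM eq_rlshift mul0r sub0r opprK.
Qed.
Lemma PdPdC a b f : Pd a (Pd b f) = sg a b *: Pd b (Pd a f).
Proof.
case: a b => [i|i] [j|j]; rewrite /sg /= ?scale1r.
- exact: dX_comm.
- exact: dX_dtheta.
- by rewrite dX_dtheta.
- by rewrite scaleN1r; exact: dthetaC.
Qed.
Lemma NdNdC a b f : Nd a (Nd b f) = sg a b *: Nd b (Nd a f).
Proof.
case: a b => [i|i] [j|j]; rewrite /sg /= ?scale1r.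
- exact: dX_comm.
- exact: dX_theta.
- by rewrite dX_theta.
- by rewrite scaleN1r; exact: thetaCA.
Qed.
Lemma PdNdC a b f : Pd a (Nd b f) = sg a b *: Nd b (Pd a f).
Proof.
case: a b => [i|i] [j|j]; rewrite /sg /= ?scale1r.
- exact: dX_comm.
- exact: dX_theta.
- by rewrite dX_dtheta.
- by rewrite scaleN1r dthetaM eq_lrshift mul0r sub0r.
Qed.
Lemma PdN a b f : Pd a (Nop b f) = sg a b *: Nop b (Pd a f).
Proof.
case: a b => [i|i] [j|j]; rewrite /sg /= ?scale1r.
- by rewrite dX_spX eq_rlshift scale0r add0r.
- exact: dX_dtheta.
- exact: dthetaX.
- by rewrite scaleN1r; exact: dthetaC.
Qed.
Lemma NdP a b f : Nd a (Pop b f) = sg a b *: Pop b (Nd a f).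
Proof.
case: a b => [i|i] [j|j]; rewrite /sg /= ?scale1r.
- by rewrite dX_spX eq_lrshift scale0r add0r.
- exact: dX_theta.
- exact: spX_mulCA.
- by rewrite scaleN1r; exact: thetaCA.
Qed.
Lemma PdP a b f : Pd a (Pop b f) = (a == b)%:R *: f + sg a b *: Pop b (Pd a f).
Proof.
case: a b => [i|i] [j|j]; rewrite /sg /= ?scale1r.
- by rewrite dX_spX eq_rshift.
- by rewrite scale0r add0r; exact: dX_theta.
- by rewrite scale0r add0r; exact: dthetaX.
- by rewrite scaleN1r dthetaM eq_lshift scaler_nat mulr_natl.
Qed.
Lemma NdN a b f : Nd a (Nop b f) = (a == b)%:R *: f + sg a b *: Nop b (Nd a f).
Proof.
case: a b => [i|i] [j|j]; rewrite /sg /= ?scale1r.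
- by rewrite dX_spX eq_lshift.
- by rewrite scale0r add0r; exact: dX_dtheta.
- by rewrite scale0r add0r; exact: spX_mulCA.
- by rewrite scaleN1r dthetaM eq_rshift scaler_nat mulr_natl opprB eq_inr eq_sym addrC subrK.
Qed.

Lemma split_lshift p q (i : 'I_p) : split (lshift q i) = inl i.
Proof. exact: (unsplitK (inl i)). Qed.
Lemma split_rshift p q (i : 'I_q) : split (rshift p i) = inr i.
Proof. exact: (unsplitK (inr i)). Qed.

Definition Sop a b f : A := Pop a (Nop b f) + sg a b *: Pop b (Nop a f).
Definition Gop a b f : A := Pop a (Pd b f) + Nop a (Nd b f).
Definition Smop a b f : A := Pd a (Nd b f) + sg a b *: Pd b (Nd a f).

Definition osp_mx (A B C : 'M[R]_m1) (D E F : 'M[R]_n) (H H1 K K1 : 'M[R]_(m1, n)) :=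
   block_mx (block_mx A B C (- A^T))
                     (block_mx H H1 K K1)
                     (block_mx K1^T H1^T (- K^T) (- H^T))
                     (block_mx D E F (- D^T)).

(** The sixteen index blocks are grouped by the parameter matrix of [osp_mx] that fills them: ten
    matrices, six of which occupy two blocks. *)
Lemma sum_osp_index (V : zmodType) (F : 'I_((m1 + m1) + (n + n)) -> 'I_((m1 + m1) + (n + n)) -> V) :
  let l i := lshift (n + n) (lshift m1 i) in let r i := lshift (n + n) (rshift m1 i) in
  let x i := rshift (m1 + m1) (lshift n i) in let y i := rshift (m1 + m1) (rshift n i) in
  \sum_a \sum_b F a b =
     (\sum_i \sum_j F (l i) (l j) + \sum_i \sum_j F (r i) (r j))
   + \sum_i \sum_j F (l i) (r j) + \sum_i \sum_j F (r i) (l j)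
   + (\sum_i \sum_j F (x i) (x j) + \sum_i \sum_j F (y i) (y j))
   + \sum_i \sum_j F (x i) (y j) + \sum_i \sum_j F (y i) (x j)
   + (\sum_i \sum_j F (l i) (x j) + \sum_i \sum_j F (y i) (r j))
   + (\sum_i \sum_j F (l i) (y j) + \sum_i \sum_j F (x i) (r j))
   + (\sum_i \sum_j F (r i) (x j) + \sum_i \sum_j F (y i) (l j))
   + (\sum_i \sum_j F (r i) (y j) + \sum_i \sum_j F (x i) (l j)).
Proof.
move=> l r x y.
have E (G : 'I_((m1 + m1) + (n + n)) -> V) : \sum_a G a =
   \sum_i G (l i) + \sum_i G (r i) + (\sum_i G (x i) + \sum_i G (y i)).
  by rewrite !big_split_ord.
rewrite E (eq_bigr _ (fun i _ => E (F (l i)))) (eq_bigr _ (fun i _ => E (F (r i)))).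
rewrite (eq_bigr _ (fun i _ => E (F (x i)))) (eq_bigr _ (fun i _ => E (F (y i)))).
rewrite !big_split /=.
by rewrite !addrA [LHS](ACl (1*6*2*5*11*16*12*15*3*14*4*10*7*13*8*9)).
Qed.

Definition mxs p q (M : 'M[R]_(p, q)) (F : 'I_p -> 'I_q -> A) : A :=
  \sum_i \sum_j M i j *: F i j.

Lemma mxs0 p q F : mxs (0 : 'M_(p, q)) F = 0.
Proof. by apply: big1 => i _; apply: big1 => j _; rewrite mxE scale0r. Qed.

Lemma mxsN p q (M : 'M_(p, q)) F : mxs (- M) F = - mxs M F.
Proof.
by rewrite -sumrN; apply: eq_bigr => i _; rewrite -sumrN; apply: eq_bigr => j _; rewrite mxE scaleNr.
Qed.

Lemma mxsD p q (M M' : 'M_(p, q)) F : mxs (M + M') F = mxs M F + mxs M' F.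
Proof.
rewrite -big_split; apply: eq_bigr => i _.
by rewrite -big_split; apply: eq_bigr => j _; rewrite mxE scalerDl.
Qed.

Lemma mxs_delta p q i j F : mxs (delta_mx i j : 'M_(p, q)) F = F i j.
Proof.
rewrite /mxs (bigD1 i) //= (bigD1 j) //= mxE !eqxx scale1r.
rewrite big1 ?addr0 => [|k /negbTE nk]; last by rewrite mxE nk andbF scale0r.
by rewrite big1 ?addr0 // => k /negbTE nk; apply: big1 => k' _; rewrite mxE nk scale0r.
Qed.

Lemma mxs_tr p q (M : 'M_(p, q)) F : mxs M^T (fun i j => F j i) = mxs M F.
Proof.
rewrite /mxs exchange_big; apply: eq_bigr => i _; apply: eq_bigr => j _.
by rewrite mxE.
Qed.

(** A parameter entry that occupies two blocks acts by two elementary operators, and these add up to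
    one [Gop], [Sop] or [Smop]. The Kronecker terms have two origins: the constant in the action of
    the D block, and moving theta_(m1+j) across a derivative in the A block. *)
Lemma act_osp_mx A0 B C D E F H H1 K K1 f :
  act (osp_mx A0 B C D E F H H1 K K1) f =
    mxs A0 (fun i j => Gop (inr i) (inr j) f - (i == j)%:R *: f)
  + mxs B (fun i j => Pop (inr i) (Nop (inr j) f))
  + mxs C (fun i j => Nd (inr i) (Pd (inr j) f))
  - mxs D (fun i j => Gop (inl j) (inl i) f + (i == j)%:R *: f)
  + mxs E (fun i j => Nd (inl i) (Pd (inl j) f))
  - mxs F (fun i j => Pop (inl i) (Nop (inl j) f))
  - mxs H (fun i j => Sop (inr i) (inl j) f)
  + mxs H1 (fun i j => Gop (inr i) (inl j) f)
  - mxs K (fun i j => Gop (inl j) (inr i) f)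
  + mxs K1 (fun i j => Smop (inr i) (inl j) f).
Proof.
rewrite /mxs /act sum_osp_index /=.
have exch p q (G : 'I_p -> 'I_q -> A) : \sum_i \sum_j G i j = \sum_j \sum_i G i j.
  exact: exchange_big.
set T := osp_mx _ _ _ _ _ _ _ _ _ _.
pose l (i : 'I_m1) := lshift (n + n) (lshift m1 i).
pose r (i : 'I_m1) := lshift (n + n) (rshift m1 i).
pose x (i : 'I_n) := rshift (m1 + m1) (lshift n i).
pose y (i : 'I_n) := rshift (m1 + m1) (rshift n i).
have Tll i j : T (l i) (l j) = A0 i j by rewrite /T /osp_mx /l !block_mxEul.
have Trr i j : T (r i) (r j) = - A0 j i by rewrite /T /osp_mx /r block_mxEul block_mxEdr !mxE.
have Tlr i j : T (l i) (r j) = B i j by rewrite /T /osp_mx /l /r block_mxEul block_mxEur.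
have Trl i j : T (r i) (l j) = C i j by rewrite /T /osp_mx /l /r block_mxEul block_mxEdl.
have Txx i j : T (x i) (x j) = D i j by rewrite /T /osp_mx /x block_mxEdr block_mxEul.
have Tyy i j : T (y i) (y j) = - D j i by rewrite /T /osp_mx /y !block_mxEdr !mxE.
have Txy i j : T (x i) (y j) = E i j by rewrite /T /osp_mx /x /y block_mxEdr block_mxEur.
have Tyx i j : T (y i) (x j) = F i j by rewrite /T /osp_mx /x /y block_mxEdr block_mxEdl.
have Tlx i j : T (l i) (x j) = H i j by rewrite /T /osp_mx /x /l block_mxEur block_mxEul.
have Tly i j : T (l i) (y j) = H1 i j by rewrite /T /osp_mx /y /l !block_mxEur.
have Trx i j : T (r i) (x j) = K i j by rewrite /T /osp_mx /x /r block_mxEur block_mxEdl.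
have Try i j : T (r i) (y j) = K1 i j by rewrite /T /osp_mx /y /r block_mxEur block_mxEdr.
have Txl i j : T (x i) (l j) = K1 j i by rewrite /T /osp_mx /x /l block_mxEdl block_mxEul mxE.
have Txr i j : T (x i) (r j) = H1 j i by rewrite /T /osp_mx /x /r block_mxEdl block_mxEur mxE.
have Tyl i j : T (y i) (l j) = - K j i by rewrite /T /osp_mx /y /l !block_mxEdl !mxE.
have Tyr i j : T (y i) (r j) = - H j i by rewrite /T /osp_mx /y /r block_mxEdl block_mxEdr !mxE.
have sE := (split_lshift, split_rshift).
clearbody T.
apply: (f_equal2 +%R); last first.
  rewrite [X in _ + X = _]exch -big_split; apply: eq_bigr => i _; rewrite -big_split; apply: eq_bigr => j _.
  by rewrite Try Txl /Eact /r /y /x /l !sE /= -scalerDr addrC /Smop /sg /= expr0 scale1r dX_dtheta /thr dX_theta.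
apply: (f_equal2 +%R); last first.
  rewrite [X in _ + X = _]exch -big_split -sumrN; apply: eq_bigr => i _.
  rewrite -big_split -sumrN; apply: eq_bigr => j _.
  rewrite Trx Tyl /Eact /r /y /x /l !sE /= scaleNr -scalerBr -scalerN; congr (_ *: _).
  by rewrite /Gop /= opprD addrC -mulrA spX_mulCA.
apply: (f_equal2 +%R); last first.
  rewrite [X in _ + X = _]exch -big_split; apply: eq_bigr => i _; rewrite -big_split; apply: eq_bigr => j _.
  by rewrite Tly Txr /Eact /r /y /x /l !sE /= -scalerDr /Gop /= dX_dtheta.
apply: (f_equal2 +%R); last first.
  rewrite [X in _ + X = _]exch -big_split -sumrN; apply: eq_bigr => i _.
  rewrite -big_split -sumrN; apply: eq_bigr => j _.
  rewrite Tlx Tyr /Eact /r /y /x /l !sE /= scaleNr -scalerBr -scalerN; congr (_ *: _).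
  by rewrite /Sop /sg /= expr0 scale1r opprD -mulrA.
apply: (f_equal2 +%R); last first.
  rewrite -sumrN; apply: eq_bigr => i _; rewrite -sumrN; apply: eq_bigr => j _.
  by rewrite Tyx /Eact /x /y !sE /= scalerN -mulrA.
apply: (f_equal2 +%R); last first.
  apply: eq_bigr => i _; apply: eq_bigr => j _.
  by rewrite Txy /Eact /x /y !sE.
apply: (f_equal2 +%R); last first.
  rewrite [X in _ + X = _]exch -big_split -sumrN; apply: eq_bigr => i _.
  rewrite -big_split -sumrN; apply: eq_bigr => j _.
  rewrite Txx Tyy /Eact /y /x !sE /= scaleNr -scalerBr -[RHS]scalerN eq_lshift; congr (_ *: _).
  by rewrite /Gop /= !opprD addrAC [X in X - _ = _]addrC.
apply: (f_equal2 +%R); last first.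
  by apply: eq_bigr => i _; apply: eq_bigr => j _; rewrite Trl /Eact /l /r !sE.
apply: (f_equal2 +%R); last first.
  by apply: eq_bigr => i _; apply: eq_bigr => j _; rewrite Tlr /Eact /l /r !sE.
rewrite [X in _ + X = _]exch -big_split; apply: eq_bigr => i _; rewrite -big_split; apply: eq_bigr => j _.
rewrite Tll Trr /Eact /l /r !sE /= scaleNr -scalerBr; congr (_ *: _).
by rewrite /Gop /= dthetaM eq_rshift mulr_natl scaler_nat -[RHS]addrA [X in _ = _ + X]addrAC subrr sub0r.
Qed.
End Letters.

(** * Submodules are stable under the quadratic operators *)

Section Submodules.
Variables (R : comNzRingType) (m1 n : nat).
Local Notation A := (superpoly R (n + n) (m1 + m1)).
Local Notation L := ('I_n + 'I_m1)%type.
Implicit Types (f g : A) (a b c d : L).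

Record subspace (V : A -> Prop) : Prop := Subspace {
  sub0 : V 0;
  subD : forall f g, V f -> V g -> V (f + g);
  subZ : forall (c : R) f, V f -> V (c *: f) }.

Section Subspace.
Variables (V : A -> Prop) (sV : subspace V).

Lemma subN f : V f -> V (- f).
Proof. by move=> Vf; rewrite -scaleN1r; apply: (subZ sV). Qed.

Lemma subB f g : V f -> V g -> V (f - g).
Proof. by move=> Vf Vg; apply: (subD sV) => //; apply: subN. Qed.

Lemma sub_sum (I : Type) (r : seq I) (P : pred I) (F : I -> A) :
  (forall i, P i -> V (F i)) -> V (\sum_(i <- r | P i) F i).
Proof. by move=> VF; elim/big_ind: _ => //; [apply: (sub0 sV) | apply: (subD sV)]. Qed.

Lemma sub_mxs p q (M : 'M_(p, q)) F : (forall i j, V (F i j)) -> V (mxs M F).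
Proof. by move=> VF; apply: sub_sum => i _; apply: sub_sum => j _; apply: (subZ sV). Qed.

End Subspace.

Lemma osp_subspace (V : A -> Prop) : osp_submodule V -> subspace V.
Proof. by case. Qed.

Lemma in_osp_mx B C E F A0 D H H1 K K1 :
  B = - B^T -> C = - C^T -> E = E^T -> F = F^T ->
  in_osp (osp_mx A0 B C D E F H H1 K K1 : 'M[R]_((m1 + m1) + (n + n))).
Proof. by move=> eB eC eE eF; exists A0, B, C, D, E, F, H, H1, K, K1. Qed.

Lemma asym_delta p (i j : 'I_p) (M := delta_mx i j - delta_mx j i : 'M[R]_p) : M = - M^T.
Proof. by rewrite /M linearB /= !trmx_delta opprB. Qed.
Lemma sym_delta p (i j : 'I_p) (M := delta_mx i j + delta_mx j i : 'M[R]_p) : M = M^T.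
Proof. by rewrite /M linearD /= !trmx_delta addrC. Qed.
Lemma asym0 p : (0 : 'M[R]_p) = - 0^T. Proof. by rewrite trmx0 oppr0. Qed.
Lemma sym0 p : (0 : 'M[R]_p) = 0^T. Proof. by rewrite trmx0. Qed.

Section Closure.
Variables (V : A -> Prop) (mV : osp_submodule V).
Let sV := osp_subspace mV.
Let actV X f : in_osp X -> V f -> V (act X f). Proof. by case: mV => _ _ _; apply. Qed.

(** Each case is an osp matrix with one free entry: H for a mixed pair, the symmetric F for two
    bosons, the antisymmetric B for two fermions. The factor [sg] in [Sop] is the symmetry type of
    these blocks. *)
Lemma Sop_sub a b f : V f -> V (Sop a b f).
Proof.
have bf (i : 'I_m1) (j : 'I_n) : V f -> V (Sop (inr i) (inl j) f).
  move=> /(actV (in_osp_mx 0 0 (delta_mx i j) 0 0 0 (asym0 _) (asym0 _) (sym0 _) (sym0 _)))/(subN sV).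
  by rewrite act_osp_mx !mxs0 mxs_delta !(subr0, addr0, add0r, sub0r) opprK.
case: a b => [i|i] [j|j] Vf.
- have := actV (in_osp_mx 0 0 0 0 0 0 (asym0 _) (asym0 _) (sym0 _) (sym_delta i j)) Vf.
  move=> /(subN sV).
  by rewrite act_osp_mx !mxs0 mxsD !mxs_delta !(subr0, addr0, add0r, sub0r) opprK /Sop /sg expr0 scale1r.
- rewrite /Sop sgC addrC -[Nop (inr j) _]scale1r.
  have := bf j i Vf; rewrite /Sop /sg /= expr0 !scale1r.
  have -> : xr R m1 i * dtheta (rshift m1 j) f = dtheta (rshift m1 j) (xr R m1 i * f).
    by rewrite [RHS]dthetaX.
  by rewrite /thl /xl spX_mulCA.
- exact: bf.
- have := actV (in_osp_mx 0 0 0 0 0 0 (asym_delta i j) (asym0 _) (sym0 _) (sym0 _)) Vf.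
  rewrite act_osp_mx !mxs0 mxsD mxsN !mxs_delta !(subr0, addr0, add0r, sub0r).
  by rewrite /Sop /sg scaleN1r.
Qed.

Lemma Gop_sub a b f : V f -> V (Gop a b f).
Proof.
move=> Vf; have dV k : V (k *: f) by apply: (subZ sV).
case: a b => [i|i] [j|j].
- have := actV (in_osp_mx 0 (delta_mx j i) 0 0 0 0 (asym0 _) (asym0 _) (sym0 _) (sym0 _)) Vf.
  rewrite act_osp_mx !mxs0 !mxs_delta !(subr0, addr0, add0r, sub0r) => /(subN sV).
  by rewrite opprK => /(subB sV)/(_ (dV (j == i)%:R)); rewrite addrK.
- have := actV (in_osp_mx 0 0 0 0 (delta_mx j i) 0 (asym0 _) (asym0 _) (sym0 _) (sym0 _)) Vf.
  by rewrite act_osp_mx !mxs0 !mxs_delta !(subr0, addr0, add0r, sub0r) => /(subN sV); rewrite opprK.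
- have := actV (in_osp_mx 0 0 0 (delta_mx i j) 0 0 (asym0 _) (asym0 _) (sym0 _) (sym0 _)) Vf.
  by rewrite act_osp_mx !mxs0 !mxs_delta !(subr0, addr0, add0r, sub0r).
- have := actV (in_osp_mx (delta_mx i j) 0 0 0 0 0 (asym0 _) (asym0 _) (sym0 _) (sym0 _)) Vf.
  rewrite act_osp_mx !mxs0 !mxs_delta !(subr0, addr0, add0r, sub0r).
  by move=> /(subD sV)/(_ (dV (i == j)%:R)); rewrite subrK.
Qed.

Lemma Smop_sub (i : 'I_m1) (j : 'I_n) f : V f -> V (Smop (inr i) (inl j) f).
Proof.
move=> Vf.
have := actV (in_osp_mx 0 0 0 0 0 (delta_mx i j) (asym0 _) (asym0 _) (sym0 _) (sym0 _)) Vf.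
by rewrite act_osp_mx !mxs0 !mxs_delta !(subr0, addr0, add0r, sub0r).
Qed.

Lemma Cop_sub (i j : 'I_m1) f : V f ->
  V (Nd (inr i) (Pd (inr j) f) - Nd (inr j) (Pd (inr i) f)).
Proof.
move=> Vf.
have := actV (in_osp_mx 0 0 0 0 0 0 (asym0 _) (asym_delta i j) (sym0 _) (sym0 _)) Vf.
by rewrite act_osp_mx !mxs0 mxsD mxsN !mxs_delta !(subr0, addr0, add0r, sub0r).
Qed.

End Closure.
End Submodules.

Section LSpan.
Variables (R : comNzRingType) (V : lmodType R).
Implicit Types (S W : V -> Prop) (v w : V).

Lemma lspan0 S : lspan S 0.
Proof. by exists [::]; rewrite ?big_nil. Qed.

Lemma lspanD S v w : lspan S v -> lspan S w -> lspan S (v + w).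
Proof.
move=> [s Ss ->] [t St ->]; exists (s ++ t); last by rewrite big_cat.
by move=> x; rewrite mem_cat => /orP[/Ss|/St].
Qed.

Lemma lspanZ S c v : lspan S v -> lspan S (c *: v).
Proof.
move=> [s Ss ->]; exists [seq (c * x.1, x.2) | x <- s].
  by move=> x /mapP[y /Ss Sy ->].
by rewrite big_map scaler_sumr; apply: eq_bigr => x _; rewrite scalerA.
Qed.

Lemma lspan_mem S v : S v -> lspan S v.
Proof.
move=> Sv; exists [:: (1, v)]; last by rewrite big_seq1 scale1r.
by move=> x; rewrite inE => /eqP ->.
Qed.

Lemma lspan_min S W : W 0 -> (forall v w, W v -> W w -> W (v + w)) ->
  (forall c v, W v -> W (c *: v)) -> (forall v, S v -> W v) ->
  forall v, lspan S v -> W v.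
Proof.
move=> W0 WD WZ SW v [s Ss ->]; rewrite big_seq.
by elim/big_ind: _ => // x /Ss /SW; apply: WZ.
Qed.

End LSpan.

(** * The charge grading and A'_(m1) as its part of charge 0 *)

Section Charge.
Variables (R : comNzRingType) (m1 n : nat).
Local Notation A := (superpoly R (n + n) (m1 + m1)).
Local Notation L := ('I_n + 'I_m1)%type.
Implicit Types (f g : A) (a b : L) (c : int).

Lemma lspan_subspace (S : A -> Prop) : subspace (lspan S).
Proof. by split; [apply: lspan0 | apply: lspanD | apply: lspanZ]. Qed.

Lemma lspan_sub (S W : A -> Prop) : subspace W -> (forall v, S v -> W v) ->
  forall v, lspan S v -> W v.
Proof. by case=> W0 WD WZ SW; apply: lspan_min. Qed.

(* The charge defining A'_(m1), shifted so that A'_(m1) is the part of charge 0. *)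
Definition chg (i : 'I_(n + n)) : int := if split i is inl _ then -1 else 1.

(** Being inductive, it turns each statement about charge, for derivatives as well as for spanning
    sets, into an induction on how an element is built. *)
Inductive Ch : int -> A -> Prop :=
| Ch_one : Ch (- m1%:Z) 1
| Ch_zero c : Ch c 0
| Ch_add c f g : Ch c f -> Ch c g -> Ch c (f + g)
| Ch_scale c k f : Ch c f -> Ch c (k *: f)
| Ch_X c i f : Ch c f -> Ch (c + chg i) (spX R _ i * f)
| Ch_theta c p f : Ch c f -> Ch (c + 1) (theta R _ p * f).

Lemma Ch_subspace c : subspace (Ch c).
Proof. by split; [apply: Ch_zero | move=> f g; apply: Ch_add | move=> k f; apply: Ch_scale]. Qed.

Lemma Ch_eq c c' f : Ch c f -> c = c' -> Ch c' f. Proof. by move=> ? <-. Qed.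

Lemma Ch_dX c i f : Ch c f -> Ch (c - chg i) (dX i f).
Proof.
elim=> {c f} [|c|c f g _ IHf _ IHg|c k f _ IH|c j f Cf IH|c p f _ IH].
- by rewrite dX1; apply: Ch_zero.
- by rewrite linear0; apply: Ch_zero.
- by rewrite linearD; apply: Ch_add.
- by rewrite linearZ; apply: Ch_scale.
- rewrite dX_spX; apply: Ch_add; last by apply: (Ch_eq (Ch_X j IH)); lia.
  case: eqP => [->|_]; last by rewrite scale0r; apply: Ch_zero.
  by rewrite scale1r; apply: (Ch_eq Cf); lia.
- by rewrite dX_theta; apply: (Ch_eq (Ch_theta p IH)); lia.
Qed.

Lemma Ch_dtheta c p f : Ch c f -> Ch (c - 1) (dtheta p f).
Proof.
elim=> {c f} [|c|c f g _ IHf _ IHg|c k f _ IH|c j f _ IH|c q f Cf IH].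
- by rewrite dtheta1; apply: Ch_zero.
- by rewrite linear0; apply: Ch_zero.
- by rewrite linearD; apply: Ch_add.
- by rewrite linearZ; apply: Ch_scale.
- by rewrite dthetaX; apply: (Ch_eq (Ch_X j IH)); lia.
- rewrite dthetaM; apply: Ch_add; last first.
    by apply: (subN (Ch_subspace _)); apply: (Ch_eq (Ch_theta q IH)); lia.
  case: eqP => [_|_]; last by rewrite mul0r; apply: Ch_zero.
  by rewrite mul1r; apply: (Ch_eq Cf); lia.
Qed.

Lemma Ch_P c a f : Ch c f -> Ch (c + 1) (Pop a f).
Proof.
case: a => i Cf /=; last exact: Ch_theta.
by apply: (Ch_eq (Ch_X _ Cf)); rewrite /chg split_rshift.
Qed.
Lemma Ch_N c a f : Ch c f -> Ch (c - 1) (Nop a f).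
Proof.
case: a => i Cf /=; last exact: Ch_dtheta.
by apply: (Ch_eq (Ch_X _ Cf)); rewrite /chg split_lshift.
Qed.
Lemma Ch_Pd c a f : Ch c f -> Ch (c - 1) (Pd a f).
Proof.
case: a => i Cf /=; last exact: Ch_dtheta.
by apply: (Ch_eq (Ch_dX (rshift n i) Cf)); rewrite /chg split_rshift.
Qed.
Lemma Ch_Nd c a f : Ch c f -> Ch (c + 1) (Nd a f).
Proof.
case: a => i Cf /=; last exact: Ch_theta.
by apply: (Ch_eq (Ch_dX (lshift n i) Cf)); rewrite /chg split_lshift; lia.
Qed.

Lemma Ch_act c X f : in_osp X -> Ch c f -> Ch c (act X f).
Proof.
move=> [A0 [B [C [D [E [F [H [H1 [K [K1 [_ _ _ _ ->]]]]]]]]]]] Cf.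
have sC := Ch_subspace c.
have PN a b : Ch c (Pop a (Nop b f)) by apply: (Ch_eq (Ch_P a (Ch_N b Cf))); lia.
have NdPd a b : Ch c (Nd a (Pd b f)) by apply: (Ch_eq (Ch_Nd a (Ch_Pd b Cf))); lia.
have PdNd a b : Ch c (Pd a (Nd b f)) by apply: (Ch_eq (Ch_Pd a (Ch_Nd b Cf))); lia.
have G a b : Ch c (Gop a b f).
  apply: Ch_add; first by apply: (Ch_eq (Ch_P a (Ch_Pd b Cf))); lia.
  by apply: (Ch_eq (Ch_N a (Ch_Nd b Cf))); lia.
have S a b : Ch c (Sop a b f) by apply: Ch_add; rewrite // ; apply: Ch_scale.
have Sm a b : Ch c (Smop a b f) by apply: Ch_add; rewrite // ; apply: Ch_scale.
have kf (k : R) : Ch c (k *: f) by apply: Ch_scale.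
have -> := act_osp_mx A0 B C D E F H H1 K K1 f.
do 9!(apply: Ch_add; last by
  do ?apply: (subN sC); apply: (sub_mxs sC) => i j //; apply: Ch_add).
by apply: (sub_mxs sC) => i j; apply: (subB sC).
Qed.

Definition mon (al : 'I_(n + n) -> nat) (s : seq 'I_(m1 + m1)) : A :=
  \prod_i spX R _ i ^+ al i * \prod_(p <- s) theta R _ p.

Lemma mon_spX i al s : spX R _ i * mon al s = mon (fun j => al j + (j == i))%N s.
Proof.
rewrite /mon mulrA; congr (_ * _).
have : i \in index_enum 'I_(n + n) by rewrite mem_index_enum.
have := index_enum_uniq 'I_(n + n).
have eqr r : i \notin r ->
    \prod_(j <- r) spX R _ j ^+ (al j + (j == i))%N = \prod_(j <- r) spX R _ j ^+ al j :> A.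
  move=> ir; rewrite big_seq [RHS]big_seq; apply: eq_bigr => j jr.
  by rewrite (_ : (j == i) = false) ?addn0 //; apply: contraNF ir => /eqP <-.
elim: (index_enum _) => // j r IH /= /andP[jr ur]; rewrite !big_cons inE.
have [eij _|nij /= ir] := eqVneq i j.
  by subst j; rewrite eqr // /= addn1 exprS mulrA.
by rewrite addn0 -IH // spX_mulCA.
Qed.

Lemma theta_mon p al s : theta R _ p * mon al s = mon al (p :: s).
Proof.
rewrite /mon big_cons !mulrA; congr (_ * _); apply/commr_prod => i _.
exact/commrX/spX_central.
Qed.

Lemma theta_prod_mem p s : p \in s -> theta R (n + n) p * \prod_(q <- s) theta R (n + n) (q : 'I_(m1 + m1)) = 0.
Proof.
elim: s => // q s IH; rewrite inE big_cons => /orP[/eqP ->|/IH e]; first exact: thetathetaA.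
by rewrite thetaCA e mulr0 oppr0.
Qed.

Lemma Ch_span c f : Ch c f -> lspan (fun v => exists al s,
   [/\ uniq s, \sum_i chg i * (al i)%:Z + (size s)%:Z = c + m1%:Z & v = mon al s]) f.
Proof.
elim=> {c f} [|c|c f g _ IHf _ IHg|c k f _ IH|c j f _ IH|c q f _ IH].
- apply: lspan_mem; exists (fun => 0%N), [::]; split => //.
    by rewrite big1 => [|i _]; rewrite ?mulr0 //=; lia.
  by rewrite /mon big1 ?big_nil ?mulr1.
- exact: lspan0.
- exact: lspanD.
- exact: lspanZ.
- elim/lspan_sub: IH => {f} [|_ [al [s [us e ->]]]].
    split=> [|f g|k f]; rewrite ?mulr0 ?mulrDr -?scalerAr; first exact: lspan0.
      exact: lspanD.
    exact: lspanZ.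
  rewrite mon_spX; apply: lspan_mem; eexists _, s; split; [by [] | | reflexivity].
  rewrite -[c + _ + _]addrAC -e addrAC; congr (_ + _).
  under eq_bigr => i _ do rewrite PoszD mulrDr.
  rewrite big_split /=; congr (_ + _).
  by rewrite (bigD1 j) //= eqxx mulr1 big1 ?addr0 // => i /negbTE ->; rewrite mulr0.
- elim/lspan_sub: IH => {f} [|_ [al [s [us e ->]]]].
    split=> [|f g|k f]; rewrite ?mulr0 ?mulrDr -?scalerAr; first exact: lspan0.
      exact: lspanD.
    exact: lspanZ.
  have [qs|qs] := boolP (q \in s).
    rewrite theta_mon /mon big_cons theta_prod_mem // mulr0; exact: lspan0.
  rewrite theta_mon; apply: lspan_mem; exists al, (q :: s); split=> //=.
    by rewrite qs.
  by rewrite -addn1 PoszD addrA e addrAC.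
Qed.

Lemma sum_chg (al : 'I_(n + n) -> nat) : \sum_i chg i * (al i)%:Z =
  (\sum_(i < n) al (rshift n i))%N%:Z - (\sum_(i < n) al (lshift n i))%N%:Z.
Proof.
have sumZ p (F : 'I_p -> nat) : (\sum_(i < p) F i)%N%:Z = \sum_(i < p) (F i)%:Z.
  by elim/big_rec2: _ => // i x y _ <-; rewrite PoszD.
rewrite big_split_ord /= addrC !sumZ -sumrN; congr (_ + _); apply: eq_bigr => i _.
  by rewrite /chg split_rshift mul1r.
by rewrite /chg split_lshift mulN1r.
Qed.

Lemma Am1_Ch f : @Am1 R m1 n f <-> Ch 0 f.
Proof.
split.
  elim/lspan_sub => {f} [|_ [al [s [_ e ->]]]]; first exact: Ch_subspace.
  have Cs : Ch ((size s)%:Z - m1%:Z) (\prod_(p <- s) theta R (n + n) p).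
    elim: s {e} => [|p s IH]; first by rewrite big_nil sub0r; apply: Ch_one.
    by rewrite big_cons; apply: (Ch_eq (Ch_theta p IH)) => /=; lia.
  suff H (r : seq 'I_(n + n)) c g : Ch c g -> Ch (c + \sum_(i <- r) chg i * (al i)%:Z)
      (\prod_(i <- r) spX R _ i ^+ al i * g).
    by apply: (Ch_eq (H _ _ _ Cs)); rewrite sum_chg e; lia.
  elim: r => [|i r IH] Cg; first by rewrite !big_nil addr0 mul1r.
  rewrite !big_cons -mulrA; move: (IH Cg); set h := _ * g; set S := \sum_(_ <- _) _.
  move=> Chh; suff K k : Ch (c + S + chg i * k%:Z) (spX R _ i ^+ k * h).
    by apply: (Ch_eq (K (al i))); lia.
  elim: k => [|k IHk]; first by rewrite mulr0 addr0 mul1r.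
  by rewrite exprS -mulrA; apply: (Ch_eq (Ch_X i IHk)); lia.
move=> /Ch_span; elim/lspan_sub => {f} [|_ [al [s [us e ->]]]]; first exact: lspan_subspace.
apply: lspan_mem; exists al, s; split => //.
  (* The bound on the number of thetas holds because [Ch_span] only produces lists without
     repetition. *)
  by have := max_card (mem s); rewrite card_ord; congr leq; apply/card_uniqP.
by move: e; rewrite sum_chg add0r => <-; rewrite addrK.
Qed.

End Charge.

(** * A' as a Fock space *)

Section Words.
Variables (R : comNzRingType) (m1 n : nat).
Local Notation A := (superpoly R (n + n) (m1 + m1)).
Local Notation L := ('I_n + 'I_m1)%type.
Implicit Types (f g : A) (a b d : L) (c : int) (w : seq (bool * L)).

(** The Fock vacuum for the letters. It is not 1: multiplication by theta_(m1+j) counts as an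
    annihilator here, so the common kernel of all [Pd] and [Nd] contains the product of all
    theta_(m1+j). *)
Definition vac : A := \prod_(j < m1) thr R n j.

Definition xop (x : bool * L) f : A := if x.1 then Pop x.2 f else Nop x.2 f.
Definition wapp w f : A := foldr xop f w.
Definition wchg w : int := \sum_(x <- w) if x.1 then 1 else -1.

Lemma NPC a b f : Nop a (Pop b f) = sg R a b *: Pop b (Nop a f).
Proof. by rewrite PNC sgC scalerA sgK scale1r. Qed.

Lemma xop_is_linear x : linear (xop x).
Proof. by case: x => -[] a k f g; rewrite /xop /= linearP. Qed.
HB.instance Definition _ x := GRing.isLinear.Build R A A _ (xop x) (@xop_is_linear x).

Lemma xopC x y f : xop x (xop y f) = sg R x.2 y.2 *: xop y (xop x f).
Proof.
case: x y => -[] a [[] b]; rewrite /xop /=; [exact: PPC|exact: PNC|exact: NPC|exact: NNC].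
Qed.

Lemma wapp_rem x w f : x \in w -> exists k : R, wapp w f = k *: xop x (wapp (rem x w) f).
Proof.
elim: w => // y w IH; rewrite inE /=; case: eqVneq => [-> _|_ /= /IH[k ->]].
  by exists 1; rewrite scale1r.
by rewrite linearZ /= xopC scalerA; eexists.
Qed.

Lemma wchg_rem x w : x \in w -> wchg (rem x w) = wchg w - (if x.1 then 1 else -1).
Proof. by move=> xw; rewrite /wchg (perm_big _ (perm_to_rem xw)) big_cons addrAC subrr add0r. Qed.

Lemma wchgE w : wchg w = (count (fun x => x.1) w)%:Z - (count (fun x => ~~ x.1) w)%:Z.
Proof.
rewrite /wchg; elim: w => [|[b a] w IH]; first by rewrite big_nil.
by rewrite big_cons IH /=; case: b => /=; lia.
Qed.

Lemma wchg0_mem (b : bool) w : wchg w = 0 -> w != [::] -> exists a : L, (b, a) \in w.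
Proof.
rewrite wchgE => e wn0.
have h : (count (fun x : bool * L => x.1) w + count (fun x => ~~ x.1) w = size w)%N.
  exact: count_predC.
have s0 : (0 < size w)%N by case: (w) wn0.
have : has (fun x : bool * L => x.1 == b) w.
  rewrite has_count; case: b; first by rewrite (eq_count (a2 := fun x => x.1)) => [|[[] ?]] //; lia.
  by rewrite (eq_count (a2 := fun x => ~~ x.1)) => [|[[] ?]] //; lia.
by move=> /hasP[[b' a] xw /= /eqP <-]; exists a.
Qed.

Lemma dtheta_prod_thr p r : p \notin map (@rshift m1 m1) r ->
  dtheta p (\prod_(j <- r) thr R n j) = 0.
Proof.
elim: r => [|j r IH] /=; first by rewrite big_nil dtheta1.
by rewrite big_cons inE negb_or dthetaM => /andP[/negbTE -> /IH ->]; rewrite mul0r mulr0 subr0.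
Qed.

Lemma rshift_notin (j : 'I_m1) r : j \notin r -> rshift m1 j \notin map (@rshift m1 m1) r.
Proof. by rewrite mem_map //; apply: rshift_inj. Qed.

Lemma lshift_notin (j : 'I_m1) r : lshift m1 j \notin map (@rshift m1 m1) r.
Proof. by apply/mapP => -[k _ /eqP]; rewrite eq_lrshift. Qed.

(** Stripping the factors theta_(m1+j) off the vacuum from the left, one [Nop] each, produces no
    sign. *)
Lemma one_word : exists w, wchg w = - m1%:Z /\ wapp w vac = 1.
Proof.
pose r := enum 'I_m1.
exists [seq (false, inr j) | j <- rev r]; split.
  rewrite /wchg big_map big_const_seq count_predT size_rev size_enum_ord.
  by rewrite iter_addr_0 mulNrn natz.
have -> : vac = \prod_(j <- r) thr R n j by rewrite /vac [index_enum _]unlock -enumT.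
have : uniq r by apply: enum_uniq.
elim: r => [_|j r IH /= /andP[jr ur]]; first by rewrite big_nil.
rewrite rev_cons map_rcons big_cons /wapp foldr_rcons /= {2}/xop /=.
rewrite dthetaM eqxx mul1r dtheta_prod_thr ?rshift_notin // mulr0 subr0.
exact: IH.
Qed.

Lemma Nd_vac a : Nd a vac = 0.
Proof.
case: a => j /=.
  rewrite /vac; elim: (index_enum _) => [|k r IH]; first by rewrite big_nil dX1.
  by rewrite big_cons dX_theta IH mulr0.
rewrite /vac; have : j \in index_enum 'I_m1 by rewrite mem_index_enum.
elim: (index_enum _) => // k r IH; rewrite inE big_cons => /orP[/eqP ->|/IH e].
  exact: thetathetaA.
by rewrite thetaCA e mulr0 oppr0.
Qed.

Lemma Pd_vac a : Pd a vac = 0.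
Proof.
case: a => j /=; last by rewrite dtheta_prod_thr // lshift_notin.
rewrite /vac; elim: (index_enum _) => [|k r IH]; first by rewrite big_nil dX1.
by rewrite big_cons dX_theta IH mulr0.
Qed.

(** Multiplication by x_i, x_(n+i) or theta_j is itself a letter [Pop] or [Nop]. Multiplication by
    theta_(m1+j) is the annihilator [Nd]: it is moved through the word, leaving shorter words
    behind, until it kills the vacuum. *)
Lemma Ch_words c f : Ch c f ->
  lspan (fun v : A => exists w, wchg w = c /\ v = wapp w vac) f.
Proof.
have xw c' x (g : A) : lspan (fun v => exists w, wchg w = c' /\ v = wapp w vac) g ->
   lspan (fun v => exists w, wchg w = c' + (if x.1 then 1 else -1) /\ v = wapp w vac) (xop x g).
  elim/lspan_sub => {g} [|_ [w [e ->]]].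
    split=> [|f1 g1|k f1]; rewrite ?linear0 ?linearD ?linearZ; first exact: lspan0.
      exact: lspanD.
    exact: lspanZ.
  by apply: lspan_mem; exists (x :: w); rewrite /wchg big_cons -/(wchg w) e addrC.
have Ndw a w : lspan (fun v => exists w', wchg w' = wchg w + 1 /\ v = wapp w' vac) (Nd a (wapp w vac)).
  elim: w => [|x w IH]; first by rewrite Nd_vac; apply: lspan0.
  have -> : wchg (x :: w) + 1 = wchg w + 1 + (if x.1 then 1 else -1).
    by rewrite /wchg big_cons -addrA addrC.
  have IH' := xw _ x _ IH; case: x IH' => -[] b /=; rewrite /xop /= => IH'.
    by rewrite NdP; apply: lspanZ.
  rewrite NdN; apply: lspanD; last exact: lspanZ.
  by apply: lspanZ; apply: lspan_mem; exists w; split=> //; lia.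
elim=> {c f} [|c|c f g _ IHf _ IHg|c k f _ IH|c j f _ IH|c q f _ IH].
- by have [w [e1 e2]] := one_word; apply: lspan_mem; exists w.
- exact: lspan0.
- exact: lspanD.
- exact: lspanZ.
- rewrite /chg; case: (split_ordP j) => k ->.
    by apply: (xw c (false, inl k)).
  by apply: (xw c (true, inl k)).
- case: (split_ordP q) => k ->; first by apply: (xw c (true, inr k)).
  elim/lspan_sub: IH => {f} [|_ [w [<- ->]]]; last exact: (Ndw (inr k)).
  split=> [|f g|k' f]; rewrite ?mulr0 ?mulrDr -?scalerAr; first exact: lspan0.
    exact: lspanD.
  exact: lspanZ.
Qed.

End Words.

(** * From the vacuum to all of charge 0 *)

Section Generation.
Variables (R : comNzRingType) (m1 n : nat).
Hypothesis natinv : forall k : nat, exists h : R, h * k.+1%:R = 1.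
Local Notation A := (superpoly R (n + n) (m1 + m1)).
Local Notation L := ('I_n + 'I_m1)%type.
Implicit Types (f g : A) (a b d : L) (c : int) (w : seq (bool * L)).
Variables (V : A -> Prop) (mV : osp_submodule V).
Let sV := osp_subspace mV.

Lemma sub_half f : V (2 *: f) -> V f.
Proof.
by have [h h2] := natinv 1; move=> /(subZ sV h); rewrite scalerA h2 scale1r.
Qed.

(* Exchanging the two letters of an antisymmetric pair costs a sign modulo V,
   and three such exchanges among three letters bring a monomial back. *)
Lemma sub_triangle a b d f : V (Nop d f) -> V (Nop a f) -> V (Nop b f) ->
  V (Pop a (Nop b (Nop d f))).
Proof.
move=> /(Sop_sub mV a b) V1 /(Sop_sub mV b d) V2 /(Sop_sub mV a d) V3; apply: sub_half.
move: V1 V2 V3; rewrite /Sop.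
rewrite (NNC d a) (NNC d b) (NNC b a) !linearZ /= (sgC _ d a) (sgC _ d b) (sgC _ b a).
set X := Pop a _; set Y := Pop b _; set Z := Pop d _ => V1 V2 V3.
have := subD sV (subB sV V1 (subZ sV (sg R a b * sg R a d) V2)) (subZ sV (sg R b d) V3).
rewrite !scalerDr !scalerA.
rewrite -[sg R a b * _ * sg R a d]mulrA !sgK mulr1 scale1r.
have -> : sg R a b * sg R a d * (sg R a b * sg R b d) = sg R b d * sg R a d.
  by rewrite mulrACA sgK mul1r mulrC.
by rewrite opprD [X + _ + _]addrA addrK addrCA addrNK -mulr2n scaler_nat.
Qed.

(** Induction on the length of the word. A word of charge 0 with more than two letters contains one
    [Pop] and two [Nop]; [sub_triangle] then needs only words that are two letters shorter. *)
Lemma sub_words : V (vac R m1 n) -> (forall a b, V (Pop a (Nop b (vac R m1 n)))) ->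
  forall w, wchg w = 0 -> V (wapp w (vac R m1 n)).
Proof.
move=> V0 V1 w; have [k] := ubnP (size w); elim: k w => // k IH w /ltnSE le_w e0.
have [->//|wn0] := eqVneq w [::].
have [a aw] := wchg0_mem true e0 wn0; have [ka ->] := wapp_rem (vac R m1 n) aw.
have sza := size_rem aw; have cha := wchg_rem aw.
set w1 := rem _ w in sza cha *; apply: (subZ sV).
have [b bw] : exists b, (false, b) \in w1.
  have [b bw] := wchg0_mem false e0 wn0; exists b.
  by move: bw; rewrite (perm_mem (perm_to_rem aw)) inE.
have [kb ->] := wapp_rem (vac R m1 n) bw; have szb := size_rem bw; have chb := wchg_rem bw.
set w2 := rem _ w1 in szb chb *; rewrite linearZ /=; apply: (subZ sV).
have e2 : wchg w2 = 0 by rewrite chb cha e0.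
have [->|w2n0] := eqVneq w2 [::]; first exact: V1.
(* What remains after removing one [Pop] and one [Nop] still has charge 0, so being nonempty it
   supplies the second [Nop]. *)
have [d dw] := wchg0_mem false e2 w2n0.
have [kd ->] := wapp_rem (vac R m1 n) dw; have szd := size_rem dw; have chd := wchg_rem dw.
set w3 := rem _ w2 in szd chd *; rewrite !linearZ /=; apply: (subZ sV).
have s2 : (0 < size w2)%N by case: (w2) w2n0.
have s1 : (0 < size w1)%N by case: (w1) bw.
have s0 : (0 < size w)%N by case: (w) wn0.
have Vx x : V (Nop x (wapp w3 (vac R m1 n))).
  apply: (IH ((false, x) :: w3)) => /=; first by rewrite szd prednK // szb (leq_trans _ le_w) // -(prednK s0) -sza ltnS leq_pred.
  by rewrite /wchg big_cons -/(wchg w3) chd e2.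
exact: sub_triangle.
Qed.

(** [Gop a c] replaces the letter c under [Pop] by a, and [Sop] exchanges the two letters modulo V.
    The letters must differ: for c = b the operator [Gop a c] would also hit [Nop b] and add a
    second term. *)
Lemma sub_pairs (u v : L) : u != v -> V (vac R m1 n) -> V (Pop u (Nop v (vac R m1 n))) ->
  forall a b, V (Pop a (Nop b (vac R m1 n))).
Proof.
move=> uv V0 Vuv.
have G (a b c : L) : c != b -> V (Pop c (Nop b (vac R m1 n))) -> V (Pop a (Nop b (vac R m1 n))).
  move=> cb /(Gop_sub mV a c); rewrite /Gop PdP eqxx scale1r PdN Pd_vac !linear0 addr0.
  by rewrite NdP NdN (negbTE cb) scale0r add0r Nd_vac !linear0 addr0.
have S a b : V (Pop a (Nop b (vac R m1 n))) -> V (Pop b (Nop a (vac R m1 n))).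
  move=> Vab; have /(subB sV)/(_ Vab) := Sop_sub mV a b V0.
  by rewrite addrC addKr => /(subZ sV (sg R a b)); rewrite scalerA sgK scale1r.
move=> a b; have [->|bv] := eqVneq b v; first exact: (G _ _ u).
by apply: (G _ _ v); [rewrite eq_sym | apply: S; apply: (G _ _ u)].
Qed.

Lemma sub_Ch0 : V (vac R m1 n) -> (forall a b, V (Pop a (Nop b (vac R m1 n)))) ->
  forall f, Ch 0 f -> V f.
Proof.
move=> V0 V1 f /Ch_words; elim/lspan_sub => // {f} _ [w [e ->]].
exact: sub_words.
Qed.

End Generation.

Section Generators.
Variables (R : comNzRingType) (m1 n : nat).
Local Notation A := (superpoly R (n + n) (m1 + m1)).
Implicit Types (f g F : A) (p q : 'I_(m1 + m1)).

Lemma Eact_is_linear a b : linear (@Eact R m1 n a b).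
Proof.
move=> k f g; rewrite /Eact.
case: (split a) => i; case: (split b) => j;
  try (case: (split i) => i'); try (case: (split j) => j');
  rewrite ?linearP ?mulrDr -?scalerAr ?opprD ?scalerN //.
by rewrite addrACA scalerBr scalerN.
Qed.

Lemma act_linear X k f g : act X (k *: f + g) = k *: act X f + act X g :> A.
Proof.
rewrite /act scaler_sumr -big_split; apply: eq_bigr => a _.
rewrite scaler_sumr -big_split; apply: eq_bigr => b _.
by rewrite Eact_is_linear scalerDr !scalerA mulrC.
Qed.

Lemma actD X f g : act X (f + g) = act X f + act X g :> A.
Proof. by rewrite -[f]scale1r act_linear !scale1r. Qed.

Lemma generated_osp F : osp_submodule (generated F).
Proof.
split.
- by move=> V [].
- by move=> f g Gf Gg V sV VA VF; case: (sV) => _ VD _ _; apply: VD; [apply: Gf | apply: Gg].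
- by move=> c f Gf V sV VA VF; case: (sV) => _ _ VZ _; apply: VZ; apply: Gf.
- by move=> X f oX Gf V sV VA VF; case: (sV) => _ _ _ Va; apply: Va => //; apply: Gf.
Qed.

Definition sum_sub (V W : A -> Prop) f : Prop := exists g h, [/\ V g, W h & f = g + h].

Lemma sum_sub_osp V W : osp_submodule V -> osp_submodule W -> osp_submodule (sum_sub V W).
Proof.
move=> [V0 VD VZ VX] [W0 WD WZ WX]; split.
- by exists 0, 0; rewrite addr0.
- move=> _ _ [f [g [Vf Wg ->]]] [f' [g' [Vf' Wg' ->]]].
  by exists (f + f'), (g + g'); split; [apply: VD | apply: WD | rewrite addrACA].
- move=> c _ [f [g [Vf Wg ->]]]; exists (c *: f), (c *: g).
  by split; [apply: VZ | apply: WZ | rewrite scalerDr].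
- move=> X _ oX [f [g [Vf Wg ->]]]; exists (act X f), (act X g).
  by split; [apply: VX | apply: WX | rewrite actD].
Qed.

Lemma theta_pair_comm p q (r : seq 'I_(m1 + m1)) F :
  theta R _ p * (theta R _ q * (\prod_(k <- r) theta R _ k * F)) =
  \prod_(k <- r) theta R _ k * (theta R _ p * (theta R _ q * F)).
Proof.
elim: r F => [|k r IH] F; first by rewrite !big_nil !mul1r.
rewrite !big_cons -!mulrA -IH.
by rewrite (thetaCA q k) mulrN (thetaCA p k) opprK.
Qed.

Lemma theta_prod_sign p (r : seq 'I_(m1 + m1)) F :
  theta R _ p * (\prod_(k <- r) theta R _ k * F) =
  (-1) ^+ size r *: (\prod_(k <- r) theta R _ k * (theta R _ p * F)).
Proof.
elim: r F => [|k r IH] F; first by rewrite !big_nil !mul1r scale1r.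
by rewrite !big_cons -!mulrA thetaCA IH exprS mulN1r scaleNr -scalerAr.
Qed.

Lemma dtheta_prod p (r : seq 'I_(m1 + m1)) F : p \notin r -> dtheta p F = 0 ->
  dtheta p (\prod_(k <- r) theta R _ k * F) = 0.
Proof.
move=> + F0; elim: r => [|k r IH]; first by rewrite big_nil mul1r.
rewrite inE negb_or big_cons -mulrA dthetaM => /andP[/negbTE -> /IH ->].
by rewrite mul0r mulr0 subr0.
Qed.

Lemma theta_pair_commE (I : Type) (e : I -> 'I_(m1 + m1)) p q (r : seq I) F :
  theta R _ p * (theta R _ q * (\prod_(k <- r) theta R _ (e k) * F)) =
  \prod_(k <- r) theta R _ (e k) * (theta R _ p * (theta R _ q * F)).
Proof. by rewrite -(big_map e predT (@theta R _ _)) theta_pair_comm. Qed.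

Lemma theta_prod_signE (I : Type) (e : I -> 'I_(m1 + m1)) p (r : seq I) F :
  theta R _ p * (\prod_(k <- r) theta R _ (e k) * F) =
  (-1) ^+ size r *: (\prod_(k <- r) theta R _ (e k) * (theta R _ p * F)).
Proof. by rewrite -(big_map e predT (@theta R _ _)) theta_prod_sign size_map. Qed.

Lemma dtheta_prodE (I : eqType) (e : I -> 'I_(m1 + m1)) p (r : seq I) F :
  p \notin map e r -> dtheta p F = 0 ->
  dtheta p (\prod_(k <- r) theta R _ (e k) * F) = 0.
Proof. by rewrite -(big_map e predT (@theta R _ _)) => *; apply: dtheta_prod. Qed.

End Generators.

(** * Reaching the vacuum from the two generators *)

Section Lowering.
Variables (R : comNzRingType) (m1 n : nat).
Hypothesis natinv : forall k : nat, exists h : R, h * k.+1%:R = 1.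
Local Notation A := (superpoly R (n + n) (m1 + m1)).
Implicit Types (f g F G : A) (i j : 'I_m1) (r : seq 'I_m1).
Local Notation tl j := (thl R n j).
Local Notation tr j := (thr R n j).
Local Notation dl j := (dtheta (lshift m1 j)).
Local Notation vac := (vac R m1 n).
Variables (V : A -> Prop) (mV : osp_submodule V).
Let sV := osp_subspace mV.

Lemma dl_tl i j F : dl i (tl j * F) = (i == j)%:R *: F - tl j * dl i F.
Proof. by rewrite dthetaM eq_lshift scaler_nat mulr_natl. Qed.
Lemma dl_tr i j F : dl i (tr j * F) = - (tr j * dl i F).
Proof. by rewrite dthetaM eq_lrshift mul0r sub0r. Qed.

(** The antisymmetric C block gives theta_(m1+i) d_j - theta_(m1+j) d_i. Applied twice, it replaces
    both theta_i and theta_j, with a factor 2 from the two orders in which this happens. *)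
Lemma lower_pair i j G : i != j -> dl i G = 0 -> dl j G = 0 ->
  V (tl i * (tl j * G)) -> V (tr i * (tr j * G)).
Proof.
move=> nij iG jG /(Cop_sub mV i j)/(Cop_sub mV i j) VG; apply: (sub_half natinv mV); move: VG.
have nji : (j == i) = false by rewrite eq_sym (negbTE nij).
have dB p (u v : A) : dtheta p (u - v) = dtheta p u - dtheta p v by exact: linearB.
have dN p (u : A) : dtheta p (- u) = - dtheta p u by exact: linearN.
have ii : dl i (tl i * G) = G by rewrite dl_tl eqxx scale1r iG mulr0 subr0.
have jj : dl j (tl j * G) = G by rewrite dl_tl eqxx scale1r jG mulr0 subr0.
have ij : dl i (tl j * G) = 0 by rewrite dl_tl (negbTE nij) scale0r iG mulr0 subr0.
have ji : dl j (tl i * G) = 0 by rewrite dl_tl nji scale0r jG mulr0 subr0.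
have e1 : dl j (tl i * (tl j * G)) = - (tl i * G) by rewrite dl_tl nji scale0r sub0r jj.
have e2 : dl i (tl i * (tl j * G)) = tl j * G by rewrite dl_tl eqxx scale1r ij mulr0 subr0.
have e1' : dl j (tr i * - (tl i * G)) = 0 by rewrite dl_tr dN ji oppr0 mulr0 oppr0.
have e2' : dl i (tr i * - (tl i * G)) = tr i * G by rewrite dl_tr dN ii mulrN opprK.
have e3' : dl j (tr j * (tl j * G)) = - (tr j * G) by rewrite dl_tr jj.
have e4' : dl i (tr j * (tl j * G)) = 0 by rewrite dl_tr ij mulr0 oppr0.
rewrite /= e1 e2 !dB e1' e2' e3' e4' sub0r opprK subr0.
have -> : tr j * (tr i * G) = - (tr i * (tr j * G)) by exact: thetaCA.
by rewrite opprK -mulr2n scaler_nat.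
Qed.

(** The thetas are lowered two at a time, hence the parity condition. *)
Lemma prod_tl_tr r G : uniq r -> ~~ odd (size r) -> (forall j, j \in r -> dl j G = 0) ->
  V (\prod_(j <- r) tl j * G) -> V (\prod_(j <- r) tr j * G).
Proof.
have [k] := ubnP (size r); elim: k r G => [|k IH] r G; first by rewrite ltn0.
case: r => [|i [|j r]]; first by move=> _ _ _ _; rewrite !big_nil.
  by move=> _ _ [].
rewrite !ltnS => le_r ur; rewrite /= negbK => odr G0.
move: ur => /=; rewrite inE negb_or => /and3P[/andP[nij ir] jr ur].
have inG x : x \in [:: i, j & r] -> dl x G = 0 by apply: G0.
have -> : \prod_(j0 <- [:: i, j & r]) tl j0 * G = \prod_(k <- r) tl k * (tl i * (tl j * G)).
  by rewrite !big_cons -!mulrA; apply: (theta_pair_commE (@lshift m1 m1)).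
have -> : \prod_(j0 <- [:: i, j & r]) tr j0 * G = tr i * (tr j * (\prod_(k <- r) tr k * G)).
  by rewrite !big_cons -!mulrA.
move=> /IH VG; have dl0 x : x \in [:: i, j & r] -> dl x (\prod_(k <- r) tr k * G) = 0.
  by move=> /inG xG; apply: (dtheta_prodE (e := @rshift m1 m1)); rewrite ?lshift_notin.
apply: lower_pair => //; try by apply: dl0; rewrite !inE eqxx ?orbT.
rewrite (theta_pair_commE (@rshift m1 m1)); apply: VG => // [|x xr]; first exact: ltnW.
rewrite !dl_tl inG ?inE ?xr ?orbT // mulr0 subr0.
have /negbTE -> : x != i by apply: contraNneq ir => <-.
have /negbTE -> : x != j by apply: contraNneq jr => <-.
by rewrite !scale0r mulr0 subr0.
Qed.

End Lowering.

#[local] Opaque sp_mul spX theta dX dtheta.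

Section OpLinear.
Variables (R : comNzRingType) (m1 n : nat).
Local Notation A := (superpoly R (n + n) (m1 + m1)).
Implicit Types (f g : A) (a : 'I_n + 'I_m1).
Lemma Pop_sub a f g : Pop a (f - g) = Pop a f - Pop a g. Proof. exact: linearB. Qed.
Lemma Nop_sub a f g : Nop a (f - g) = Nop a f - Nop a g. Proof. exact: linearB. Qed.
Lemma Pd_sub a f g : Pd a (f - g) = Pd a f - Pd a g. Proof. exact: linearB. Qed.
Lemma Nd_sub a f g : Nd a (f - g) = Nd a f - Nd a g. Proof. exact: linearB. Qed.
Lemma Pop_opp a f : Pop a (- f) = - Pop a f. Proof. exact: linearN. Qed.
Lemma Nop_opp a f : Nop a (- f) = - Nop a f. Proof. exact: linearN. Qed.
Lemma Pd_opp a f : Pd a (- f) = - Pd a f. Proof. exact: linearN. Qed.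
Lemma Pop0 a : Pop a (0 : A) = 0. Proof. exact: linear0. Qed.
Lemma Nop0 a : Nop a (0 : A) = 0. Proof. exact: linear0. Qed.
Lemma Pd0 a : Pd a (0 : A) = 0. Proof. exact: linear0. Qed.
Lemma Nd0 a : Nd a (0 : A) = 0. Proof. exact: linear0. Qed.
Definition op0 := (Pop0, Nop0, Pd0, Nd0, @scaler0).
End OpLinear.

Section Column.
Variables (R : comNzRingType) (m1 n : nat).
Local Notation A := (superpoly R (n + n) (m1 + m1)).
Local Notation L := ('I_n + 'I_m1)%type.
Implicit Types (F H : A) (a b c : L).

(** For two bosons this multiplies by the minor x_a x_(n+b) - x_b x_(n+a) that occurs in the odd
    generator. *)
Definition colop a b F : A := Nop a (Pop b F) - Nop b (Pop a F).

Lemma Pd_colop a b c F : c != a -> c != b -> sg R c a = 1 -> sg R c b = 1 ->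
  Pd c (colop a b F) = colop a b (Pd c F).
Proof.
move=> /negbTE ca /negbTE cb sa sb.
by rewrite /colop Pd_sub !PdN !PdP ca cb sa sb !scale0r !scale1r !add0r.
Qed.

Lemma colop0 a b : colop a b 0 = 0.
Proof. by rewrite /colop !op0 subr0. Qed.

(** Here a and b behave as bosons and c as a fermion. Two mixed lowering operators consume the
    column and at the same time turn theta_c into theta_(m1+c). This is how the single theta left
    over for odd m1 gets lowered. *)
Lemma Smop_colop a b c H : a != b -> c != a -> c != b ->
  sg R c a = 1 -> sg R c b = 1 -> sg R a b = 1 -> sg R a a = 1 -> sg R b b = 1 -> sg R c c = -1 ->
  Nd a H = 0 -> Nd b H = 0 -> Pd a H = 0 -> Pd b H = 0 -> Pd c H = 0 -> Nd c (Nd c (Pop c H)) = 0 ->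
  Smop c b (Smop c a (colop a b (Pop c H))) = 2 *: Nd c H.
Proof.
move=> ab /negbTE ca /negbTE cb sa sb sab saa sbb sc nd1 nd2 pd1 pd2 pd3 cc.
have ba : (b == a) = false by rewrite eq_sym (negbTE ab).
have ac : (a == c) = false by rewrite eq_sym.
have bc : (b == c) = false by rewrite eq_sym.
have sba : sg R b a = 1 by rewrite sgC.
have sac : sg R a c = 1 by rewrite sgC.
have sbc : sg R b c = 1 by rewrite sgC.
have e3 F : Pd a F = 0 -> Pd a (colop a b F) = - Nop b F.
  move=> aF; rewrite /colop Pd_sub (PdN a a) (PdP a b) (PdN a b) (PdP a a) aF eqxx (negbTE ab).
  by rewrite sab saa !scale1r scale0r !op0 !addr0 Nop0 sub0r.
set K := Pop c H in cc *.
have Ka : Nd a K = 0 by rewrite /K NdP nd1 !op0.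
have Kb : Nd b K = 0 by rewrite /K NdP nd2 !op0.
have Ka' : Pd a K = 0 by rewrite /K PdP pd1 !op0 ac scale0r addr0.
have Kb' : Pd b K = 0 by rewrite /K PdP pd2 !op0 bc scale0r addr0.
have Kc : Pd c K = H by rewrite /K PdP eqxx scale1r pd3 !op0 addr0.
set Q := Nd c K in cc *.
have Qa' : Pd a Q = 0 by rewrite /Q PdNdC Ka' !op0.
have Qb : Nd b Q = 0 by rewrite /Q NdNdC Kb !op0.
have Qb' : Pd b Q = 0 by rewrite /Q PdNdC Kb' !op0.
have Qc : Pd c Q = - Nd c H by rewrite /Q PdNdC Kc sc scaleN1r.
have -> : Smop c a (colop a b K) = Pop b H - Nop b Q.
  have e1 : Nd a (colop a b K) = Pop b K.
    rewrite /colop Nd_sub NdN eqxx scale1r NdP Ka !op0 addr0.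
    by rewrite NdN (negbTE ab) scale0r add0r NdP Ka !op0 subr0.
  have e2 : Nd c (colop a b K) = colop a b Q.
    by rewrite /colop Nd_sub !NdN ca cb !scale0r !add0r (NdP c a) (NdP c b) sa sb !scale1r.
  by rewrite /Smop e1 e2 e3 // PdP cb scale0r add0r Kc sa sb !scale1r.
have e1 : Nd b (Pop b H - Nop b Q) = - Q.
  by rewrite Nd_sub NdP nd2 !op0 NdN eqxx scale1r Qb !op0 addr0 sub0r.
have e2 : Nd c (Pop b H - Nop b Q) = Pop b (Nd c H).
  by rewrite Nd_sub NdP NdN cc cb !op0 scale0r add0r subr0 sb scale1r.
rewrite /Smop e1 e2 Pd_opp Qc opprK PdP eqxx scale1r PdNdC pd2 !op0 addr0.
by rewrite sb scale1r -mulr2n scaler_nat.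
Qed.

End Column.

Section MixedPair.
Variables (R : comNzRingType) (m1 n : nat).
Hypothesis natinv : forall k : nat, exists h : R, h * k.+1%:R = 1.
Local Notation A := (superpoly R (n + n) (m1 + m1)).
Local Notation L := ('I_n + 'I_m1)%type.
Variables (V : A -> Prop) (mV : osp_submodule V).
Let sV := osp_subspace mV.

(** [Sop a c] applied to [Nd c H] and [Gop a c] applied to [Pop c H] both contain [Pop a H]; their
    other terms are opposite, so the sum is twice the wanted element. *)
Lemma sub_mixed_pair (a c : L) (H : A) : sg R a c = 1 -> sg R c c = -1 ->
  Nop c (Nd c H) = H -> Pd c H = 0 ->
  V (Nd c H) -> V (Pop c H) -> V (Pop a (Nop c (Nd c H))).
Proof.
move=> sa sc eH pH VH VK.
have VS := Sop_sub mV a c VH; have := Gop_sub mV a c VK.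
rewrite /Gop PdP eqxx scale1r pH !op0 addr0 NdP sc scaleN1r Nop_opp => VG.
apply: (sub_half natinv mV); have := subD sV VS VG.
rewrite /Sop eH sa scale1r (PNC c a) sgC sa scale1r.
by rewrite [X in _ + X]addrC addrA addrK -mulr2n scaler_nat.
Qed.

End MixedPair.

Section GenAll.
Variables (R : comNzRingType) (m1 n : nat) (n_gt1 : (1 < n)%N).
Hypothesis natinv : forall k : nat, exists h : R, h * k.+1%:R = 1.
Local Notation A := (superpoly R (n + n) (m1 + m1)).
Local Notation L := ('I_n + 'I_m1)%type.
Implicit Types (f g F G : A) (i j : 'I_m1) (r : seq 'I_m1).
Local Notation tl j := (thl R n j).
Local Notation tr j := (thr R n j).
Local Notation dl j := (dtheta (lshift m1 j)).
Local Notation vac := (vac R m1 n).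
Variables (V : A -> Prop) (mV : osp_submodule V).
Let sV := osp_subspace mV.
Let u := Ordinal (ord_penult_subproof n_gt1).
Let w := Ordinal (ord_last_subproof n_gt1).

Let uw : u != w.
Proof. by rewrite -val_eqE /=; lia. Qed.
Let col := @colop R m1 n (inl u) (inl w).

Let dl_col i F : Pd (inr i) (col F) = col (Pd (inr i) F).
Proof. by apply: Pd_colop. Qed.
Let col0 : col 0 = 0.
Proof. exact: colop0. Qed.

Let mul_col G F : G * col F = col (G * F).
Proof.
have H (x y : 'I_(n + n)) : G * (spX R (m1 + m1) x * (spX R (m1 + m1) y * F)) =
    spX R (m1 + m1) x * (spX R (m1 + m1) y * (G * F)).
  by rewrite (spX_mulCA x G (spX R _ y * F)) (spX_mulCA y G F).
rewrite [LHS]mulrBr; apply: (f_equal2 (fun x y => x - y)); exact: H.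
Qed.

Lemma even_genE : even_gen R m1 n = \prod_(j <- enum 'I_m1) tl j * 1.
Proof. by rewrite mulr1 /even_gen [index_enum _]unlock -enumT. Qed.

Lemma vacE : vac = \prod_(j <- enum 'I_m1) tr j * 1.
Proof. by rewrite mulr1 /vac [index_enum _]unlock -enumT. Qed.

Lemma odd_genE : odd_gen R m1 n_gt1 = \prod_(j <- enum 'I_m1) tl j * col 1.
Proof.
rewrite mul_col -even_genE /odd_gen -/u -/w mulrBl -!mulrA.
by [].
Qed.

(** All thetas can be lowered in both generators, giving the vacuum and a bosonic column times the
    vacuum. Adding [Sop] of the vacuum to the antisymmetric column leaves twice a single ordered
    pair. *)
Lemma gens_even : ~~ odd m1 -> V (even_gen R m1 n) -> V (odd_gen R m1 n_gt1) ->
  V vac /\ exists a b : L, a != b /\ V (Pop a (Nop b vac)).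
Proof.
move=> om Ve Vo; have ue := enum_uniq 'I_m1.
have se : ~~ odd (size (enum 'I_m1)) by rewrite size_enum_ord.
have V0 : V vac.
  rewrite vacE; apply: (prod_tl_tr natinv mV) => // [j _|]; last by rewrite -even_genE.
  exact: dtheta1.
split=> //; exists (inl w), (inl u); split; first by rewrite eq_inl eq_sym.
have : V (\prod_(j <- enum 'I_m1) tr j * col 1).
  apply: (prod_tl_tr natinv mV) => // [j _|]; last by rewrite -odd_genE.
  by rewrite [LHS]dl_col /= dtheta1 col0.
rewrite mul_col -vacE => /(subD sV (Sop_sub mV (inl w) (inl u) V0)) VV.
apply: (sub_half natinv mV); move: VV.
rewrite /Sop /sg expr0 scale1r /col (PNC (inl w) (inl u)) (PNC (inl u) (inl w)) /sg expr0 !scale1r.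
by rewrite addrA addrAC addrK -mulr2n scaler_nat.
Qed.

Lemma gens_odd : odd m1 -> V (even_gen R m1 n) -> V (odd_gen R m1 n_gt1) ->
  V vac /\ exists a b : L, a != b /\ V (Pop a (Nop b vac)).
Proof.
move=> om Ve Vo; have ue := enum_uniq 'I_m1; have se := size_enum_ord m1.
move: Ve Vo; rewrite even_genE odd_genE vacE.
case: (enum _) ue se => [|p r] /=; first by move=> _ e; rewrite -e in om.
move=> /andP[pr ur] sz; have or : ~~ odd (size r) by rewrite -sz /= in om.
have sgr : (-1) ^+ size r = 1 :> R by rewrite -signr_odd (negbTE or).
(* The theta of [p] is set aside at the right end, where it counts as part of the spectator factor;
   an even number of thetas remains to be lowered. *)
have lE F : \prod_(j <- p :: r) tl j * F = \prod_(j <- r) tl j * (tl p * F).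
  by rewrite big_cons -mulrA [LHS](theta_prod_signE (@lshift m1 m1)) sgr scale1r.
have rE F : tl p * (\prod_(j <- r) tr j * F) = \prod_(j <- r) tr j * (tl p * F).
  by rewrite [LHS](theta_prod_signE (@rshift m1 m1)) sgr scale1r.
have pj j : j \in r -> (j == p) = false by apply: contraTF => /eqP ->.
rewrite !lE big_cons -mulrA => Ve Vo.
set H : A := \prod_(j <- r) tr j * 1.
have dxH a : dX a H = 0.
  rewrite /H mulr1; elim: (r) => [|k r' IH]; first by rewrite big_nil dX1.
  by rewrite big_cons [LHS]dX_theta IH mulr0.
have dlH : Pd (inr p) H = 0 by apply: (dtheta_prodE (e := @rshift m1 m1)); rewrite ?lshift_notin ?dtheta1.
have HNd0 (i : 'I_n) : Nd (inl i) H = 0 by exact: dxH.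
have HPd0 (i : 'I_n) : Pd (inl i) H = 0 by exact: dxH.
have VtH : V (Pop (inr p) H).
  rewrite [Pop _ _]rE; apply: (prod_tl_tr natinv mV) => // j jr.
  by rewrite dl_tl pj // scale0r dtheta1 mulr0 subr0.
have VcH : V (col (Pop (inr p) H)).
  rewrite [Pop _ _]rE -mul_col -mul_col; apply: (prod_tl_tr natinv mV) => // j jr.
  have z : dl j (tl p * 1) = 0 by rewrite [LHS]dl_tl pj // scale0r dtheta1 mulr0 subr0.
  by rewrite mul_col; exact: etrans (dl_col _ _) (etrans (congr1 col z) col0).
have sp : sg R (inr p : L) (inr p) = -1 by rewrite /sg expr1.
(* This element is the vacuum; it comes from the odd generator, whose column and leftover theta_p
   are traded for theta_(m1+p). *)
have VH : V (Nd (inr p) H).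
  apply: (sub_half natinv mV); rewrite -(@Smop_colop _ _ _ (inl u) (inl w) (inr p) H) //.
    by apply: (Smop_sub mV); apply: (Smop_sub mV).
  exact: thetathetaA.
split=> //; exists (inl u), (inr p); split=> //.
have drH : Nop (inr p) (Nd (inr p) H) = H.
  have e : Nop (inr p) H = 0.
    by apply: (dtheta_prodE (e := @rshift m1 m1)); rewrite ?rshift_notin ?dtheta1.
  have := NdN (inr p) (inr p) H; rewrite e op0 eqxx scale1r sp scaleN1r.
  by move=> /esym/eqP; rewrite subr_eq0 => /eqP/esym.
rewrite [X in Pop _ (Nop _ X)](_ : _ = Nd (inr p) H) //.
by apply: (sub_mixed_pair natinv mV) => //; rewrite ?drH.
Qed.

Lemma gens_all : V (even_gen R m1 n) -> V (odd_gen R m1 n_gt1) -> forall f, Ch 0 f -> V f.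
Proof.
move=> Ve Vo.
have [V0 [a [b [ab Vab]]]] : V vac /\ exists a b : L, a != b /\ V (Pop a (Nop b vac)).
  by have [o|o] := boolP (odd m1); [apply: gens_odd | apply: gens_even].
by apply: (sub_Ch0 natinv mV V0); apply: (sub_pairs mV ab).
Qed.

End GenAll.

Lemma dthetaK (R : comNzRingType) N m p (f : superpoly R N m) : dtheta p (dtheta p f) = 0.
Proof.
apply/ffunP => S; rewrite [dtheta _ _ _]ffunE [dtheta p f _]ffunE ffunE.
by case: ifP => // _; rewrite setU11 mulr0.
Qed.

(** * The involution sigma and its commutation with osp *)

Section PmDm.
Variables (R : comNzRingType) (m1 n : nat).
Local Notation A := (superpoly R (n + n) (m1 + m1)).
Local Notation L := ('I_n + 'I_m1)%type.
Implicit Types (F G H : A) (a b c : L).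

Definition pm c F : A := Pop c F - Nop c F.
Definition dm c F : A := Pd c F - Nd c F.

End PmDm.

(** For a fermionic c, [pm] and [dm] square to zero and their anticommutator is 2, so half of [pm]
    after [dm] is a projection and [tau] is the corresponding Clifford reflection, written without
    dividing by 2. It anticommutes with [pm] and [dm] and commutes with the sums P + N and Pd + Nd;
    hence it exchanges P with N and Pd with Nd. *)
HB.lock Definition tau (R : comNzRingType) (m1 n : nat) (c : 'I_n + 'I_m1)
  (F : superpoly R (n + n) (m1 + m1)) : superpoly R (n + n) (m1 + m1) := F - pm c (dm c F).

Section Tau.
Variables (R : comNzRingType) (m1 n : nat).
Local Notation A := (superpoly R (n + n) (m1 + m1)).
Local Notation L := ('I_n + 'I_m1)%type.
Implicit Types (F G H : A) (a b c : L).

Local Notation pm := (@pm R m1 n).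
Local Notation dm := (@dm R m1 n).
Local Notation tau := (@tau R m1 n).

Lemma tauE c F : tau c F = F - pm c (dm c F).
Proof. by rewrite unlock. Qed.

Lemma lin_sub (f g : A -> A) : linear f -> linear g -> linear (fun F => f F - g F).
Proof. by move=> lf lg k F G; rewrite lf lg scalerBr opprD addrACA. Qed.

Lemma pm_is_linear c : linear (pm c).
Proof. by apply: lin_sub => k F G; rewrite linearP. Qed.
HB.instance Definition _ c := GRing.isLinear.Build R A A _ (pm c) (@pm_is_linear c).
Lemma dm_is_linear c : linear (dm c).
Proof. by apply: lin_sub => k F G; rewrite linearP. Qed.
HB.instance Definition _ c := GRing.isLinear.Build R A A _ (dm c) (@dm_is_linear c).
Lemma tau_is_linear c : linear (tau c).
Proof.
move=> k F G; rewrite !tauE; move: k F G.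
by apply: (@lin_sub id (fun F => pm c (dm c F))) => k F G //; rewrite !linearP.
Qed.
HB.instance Definition _ c := GRing.isLinear.Build R A A _ (tau c) (@tau_is_linear c).

Lemma pm_sub c F G : pm c (F - G) = pm c F - pm c G. Proof. exact: linearB. Qed.
Lemma pm_opp c F : pm c (- F) = - pm c F. Proof. exact: linearN. Qed.
Lemma tau_sub c F G : tau c (F - G) = tau c F - tau c G. Proof. exact: linearB. Qed.
Lemma tauZ c k F : tau c (k *: F) = k *: tau c F. Proof. exact: linearZ. Qed.

Lemma PP0 (j : 'I_m1) F : Pop (inr j) (Pop (inr j) F) = 0. Proof. exact: thetathetaA. Qed.
Lemma NN0 (j : 'I_m1) F : Nop (inr j) (Nop (inr j) F) = 0. Proof. exact: dthetaK. Qed.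
Lemma PdPd0 (j : 'I_m1) F : Pd (inr j) (Pd (inr j) F) = 0. Proof. exact: dthetaK. Qed.
Lemma NdNd0 (j : 'I_m1) F : Nd (inr j) (Nd (inr j) F) = 0. Proof. exact: thetathetaA. Qed.

Section Same.
Variables (c : L) (sc : sg R c c = -1).
Hypotheses (PP : forall F, Pop c (Pop c F) = 0) (NN : forall F, Nop c (Nop c F) = 0).
Hypotheses (PdPd : forall F, Pd c (Pd c F) = 0) (NdNd : forall F, Nd c (Nd c F) = 0).

Lemma tau_P_ F : tau c (Pop c F) = Nop c (tau c F).
Proof.
have e : dm c (Pop c F) = F - Pop c (dm c F).
  by rewrite /Submission.dm PdP NdP eqxx sc scale1r !scaleN1r opprK Pop_sub opprB -addrA [- _ + _]addrC.
rewrite !tauE e; move: (dm c F) => G; rewrite pm_sub /Submission.pm PP sub0r opprK !Nop_sub NN subr0.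
by rewrite opprD opprB addrA addrCA subrr addr0.
Qed.

Lemma tau_N_ F : tau c (Nop c F) = Pop c (tau c F).
Proof.
have e : dm c (Nop c F) = - F - Nop c (dm c F).
  by rewrite /Submission.dm PdN NdN eqxx sc scale1r !scaleN1r opprB Nop_sub opprB addrC [_ - F]addrC -addrA [_ - Nop _ _]addrC.
rewrite !tauE e; move: (dm c F) => G; rewrite pm_sub pm_opp /Submission.pm NN subr0 !Pop_sub PP sub0r opprK.
by rewrite opprD !opprK addrA [Nop c F + _]addrC subrK.
Qed.

Lemma Nd_pm G : Nd c (pm c G) = - pm c (Nd c G) - G.
Proof.
by rewrite /Submission.pm Nd_sub NdP NdN eqxx sc scale1r !scaleN1r !opprB addrA addrAC addrC addrA addrAC.
Qed.

Lemma Pd_pm G : Pd c (pm c G) = G - pm c (Pd c G).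
Proof. by rewrite /Submission.pm Pd_sub PdP PdN eqxx sc scale1r !scaleN1r opprK opprB -addrA [_ + Nop _ _]addrC. Qed.

Lemma tau_Pd_ F : tau c (Pd c F) = Nd c (tau c F).
Proof.
have e : dm c (Pd c F) = - Nd c (Pd c F) by rewrite /Submission.dm PdPd sub0r.
have e' : Nd c (dm c F) = Nd c (Pd c F) by rewrite /Submission.dm Nd_sub NdNd subr0.
rewrite !tauE e pm_opp opprK Nd_sub Nd_pm e' /Submission.dm opprD !opprK.
by rewrite [RHS]addrCA [Nd c F + _]addrC subrK addrC.
Qed.

Lemma tau_Nd_ F : tau c (Nd c F) = Pd c (tau c F).
Proof.
have e : dm c (Nd c F) = Pd c (Nd c F) by rewrite /Submission.dm NdNd subr0.
have e' : Pd c (dm c F) = - Pd c (Nd c F) by rewrite /Submission.dm Pd_sub PdPd sub0r.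
rewrite !tauE e Pd_sub Pd_pm e' pm_opp /Submission.dm.
move: (Pd c F) (Nd c F) (pm c _) => P N X.
by rewrite opprK opprD opprB addrA [P + _]addrC subrK.
Qed.

End Same.

Section Other.
Variables (c a : L) (ac : (a == c) = false).
Let e2 := sgK R a c.
Let ca : (c == a) = false. Proof. by rewrite eq_sym. Qed.

(** Crossing [dm c] and then [pm c] costs the same sign twice, as for the other operators of this
    section. *)
Lemma tau_P F : tau c (Pop a F) = Pop a (tau c F).
Proof.
have e : dm c (Pop a F) = sg R a c *: Pop a (dm c F).
  by rewrite /Submission.dm PdP NdP ca scale0r add0r Pop_sub scalerBr sgC.
rewrite !tauE e linearZ /= Pop_sub; congr (_ - _).
by rewrite /Submission.pm Pop_sub (PPC a c) (PNC a c) scalerBr.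
Qed.
Lemma NdPdC F : Nd a (Pd c F) = sg R a c *: Pd c (Nd a F).
Proof. by rewrite (PdNdC c a) (sgC R c a) scalerA e2 scale1r. Qed.
Lemma tau_N F : tau c (Nop a F) = Nop a (tau c F).
Proof.
have e : dm c (Nop a F) = sg R a c *: Nop a (dm c F).
  by rewrite /Submission.dm PdN NdN ca scale0r add0r Nop_sub scalerBr sgC.
rewrite !tauE e linearZ /= Nop_sub; congr (_ - _).
by rewrite /Submission.pm Nop_sub (NPC a c) (NNC a c) scalerBr.
Qed.
Lemma tau_Pd F : tau c (Pd a F) = Pd a (tau c F).
Proof.
have e : dm c (Pd a F) = sg R a c *: Pd a (dm c F).
  by rewrite /Submission.dm Pd_sub scalerBr (PdPdC a c) (PdNdC a c) !scalerA e2 !scale1r.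
rewrite !tauE e linearZ /= Pd_sub; congr (_ - _).
by rewrite /Submission.pm Pd_sub (PdP a c) (PdN a c) ac scale0r add0r scalerBr.
Qed.
Lemma tau_Nd F : tau c (Nd a F) = Nd a (tau c F).
Proof.
have e : dm c (Nd a F) = sg R a c *: Nd a (dm c F).
  by rewrite /Submission.dm Nd_sub scalerBr (NdNdC a c) NdPdC !scalerA e2 !scale1r.
rewrite !tauE e linearZ /= Nd_sub; congr (_ - _).
by rewrite /Submission.pm Nd_sub (NdP a c) (NdN a c) ac scale0r add0r scalerBr.
Qed.

End Other.

Definition sw (i : 'I_(n + n)) : 'I_(n + n) :=
  match split i with inl k => rshift n k | inr k => lshift n k end.
Lemma sw_inj : injective sw.
Proof.
apply: (@inv_inj _ sw) => i; rewrite /sw.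
by case: (split_ordP i) => k ->; rewrite ?split_lshift ?split_rshift.
Qed.
Definition swp : 'S_(n + n) := perm sw_inj.
Lemma swl k : swp (lshift n k) = rshift n k. Proof. by rewrite permE /sw split_lshift. Qed.
Lemma swr k : swp (rshift n k) = lshift n k. Proof. by rewrite permE /sw split_rshift. Qed.
Lemma swpV : (swp^-1)%g = swp.
Proof.
apply/permP => i; apply: (@perm_inj _ swp); rewrite permKV.
by case: (split_ordP i) => k ->; rewrite !(swl, swr).
Qed.

Definition swapX F : A := [ffun S => msym swp (F S)].

Lemma swapX_is_linear : linear swapX.
Proof. by move=> k F G; apply/ffunP => S; rewrite !ffunE msymD msymZ. Qed.
HB.instance Definition _ := GRing.isLinear.Build R A A _ swapX swapX_is_linear.

Lemma swapX_spX i F : swapX (spX R _ i * F) = spX R _ (swp i) * swapX F.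
Proof.
apply/ffunP => S; rewrite !spXME !ffunE msymM; congr (_ * _).
rewrite msymX swpV; congr 'X_[_]; apply/mnmP => j; rewrite mnmE !mnm1E.
by rewrite -{1}swpV (can2_eq (permK _) (permKV _)).
Qed.

Lemma swapX_dX i F : swapX (dX i F) = dX (swp i) (swapX F).
Proof.
apply/ffunP => S; rewrite !ffunE; apply/mpolyP => mm.
rewrite mcoeff_sym !mcoeff_deriv mcoeff_sym mnmE; congr (_@__ *+ _).
apply/mnmP => j; rewrite !mnmE.
by rewrite (inj_eq perm_inj).
Qed.

Lemma swapX_theta p F : swapX (theta R _ p * F) = theta R _ p * swapX F.
Proof.
apply/ffunP => S; rewrite !thetaME !ffunE; case: ifP => _; last exact: msym0.
by rewrite -signr_odd; case: (odd _); rewrite ?expr1 ?expr0 ?mulN1r ?mul1r ?msymN.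
Qed.

Lemma swapX_dtheta p F : swapX (dtheta p F) = dtheta p (swapX F).
Proof.
apply/ffunP => S; rewrite !ffunE; case: ifP => _; first exact: msym0.
by rewrite -signr_odd; case: (odd _); rewrite ?expr1 ?expr0 ?mulN1r ?mul1r ?msymN.
Qed.

Lemma swapX_P a F : swapX (Pop a F) = (if a is inl _ then Nop a (swapX F) else Pop a (swapX F)).
Proof. by case: a => i; [rewrite [LHS]swapX_spX swr | exact: swapX_theta]. Qed.
Lemma swapX_N a F : swapX (Nop a F) = (if a is inl _ then Pop a (swapX F) else Nop a (swapX F)).
Proof. by case: a => i; [rewrite [LHS]swapX_spX swl | exact: swapX_dtheta]. Qed.
Lemma swapX_Pd a F : swapX (Pd a F) = (if a is inl _ then Nd a (swapX F) else Pd a (swapX F)).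
Proof. by case: a => i; [rewrite [LHS]swapX_dX swr | exact: swapX_dtheta]. Qed.
Lemma swapX_Nd a F : swapX (Nd a F) = (if a is inl _ then Pd a (swapX F) else Nd a (swapX F)).
Proof. by case: a => i; [rewrite [LHS]swapX_dX swl | exact: swapX_theta]. Qed.

Definition tauJ (J : seq 'I_m1) F : A := foldr (fun j => tau (inr j)) F J.
(** A partial [sigma], with particle-hole exchange only at the sites of J and always the full
    bosonic swap. It allows a product of letters to be peeled one site at a time. *)
Definition sigJ (J : seq 'I_m1) F : A := swapX (tauJ J F).

Definition in_sites (J : seq 'I_m1) a : bool := if a is inr j then j \in J else true.

Lemma tauJ_is_linear J : linear (tauJ J).
Proof.
elim: J => [|j J IH] k F G //.
by rewrite [LHS](congr1 (tau (inr j)) (IH k F G)) linearP.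
Qed.
HB.instance Definition _ J := GRing.isLinear.Build R A A _ (tauJ J) (@tauJ_is_linear J).
Lemma sigJ_is_linear J : linear (sigJ J).
Proof. by move=> k F G; rewrite /sigJ !linearP. Qed.
HB.instance Definition _ J := GRing.isLinear.Build R A A _ (sigJ J) (@sigJ_is_linear J).

Lemma sg_rr (j : 'I_m1) : sg R (inr j : L) (inr j) = -1.
Proof. by rewrite /sg expr1. Qed.

Section Sites.
Variables (O O' : L -> A -> A).
Hypothesis tau_same : forall (j : 'I_m1) F, tau (inr j) (O (inr j) F) = O' (inr j) (tau (inr j) F).
Hypothesis tau_diff : forall c a, (a == c) = false -> forall F, tau c (O a F) = O a (tau c F).
Hypothesis tau_diff' : forall c a, (a == c) = false -> forall F, tau c (O' a F) = O' a (tau c F).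
Hypothesis swap_O : forall a F, swapX (O a F) = if a is inl _ then O' a (swapX F) else O a (swapX F).
Hypothesis swap_O' : forall a F, swapX (O' a F) = if a is inl _ then O a (swapX F) else O' a (swapX F).

Lemma sigJ_op (J : seq 'I_m1) a F : uniq J ->
  sigJ J (O a F) = if in_sites J a then O' a (sigJ J F) else O a (sigJ J F).
Proof.
have out (K : seq 'I_m1) b G : (if b is inr j then j \notin K else true) ->
    tauJ K (O b G) = O b (tauJ K G) /\ tauJ K (O' b G) = O' b (tauJ K G).
  elim: K => //= k K IH bK.
  have [-> ->] : tauJ K (O b G) = O b (tauJ K G) /\ tauJ K (O' b G) = O' b (tauJ K G).
    by apply: IH; case: (b) bK => //= j; rewrite inE negb_or => /andP[].
  have bk : (b == inr k) = false.
    by case: (b) bK => //= j; rewrite inE negb_or => /andP[/negbTE jk _]; rewrite eq_inr.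
  by rewrite !(tau_diff, tau_diff').
move=> uJ; rewrite /sigJ; case: a => i /=.
  by rewrite (out J (inl i) F isT).1 swap_O.
case: ifP => iJ; last by rewrite (out J (inr i) F (negbT iJ)).1 swap_O.
rewrite -(swap_O' (inr i)); congr swapX.
elim: J uJ iJ => //= k K IH /andP[kK uK]; rewrite inE; case: eqVneq => [ik _|ik /= iK].
  by subst k; rewrite (out K (inr i) F kK).1 tau_same.
by rewrite IH // tau_diff' // eq_inr (negbTE ik).
Qed.
End Sites.

Lemma sigJ_P J a F : uniq J ->
  sigJ J (Pop a F) = if in_sites J a then Nop a (sigJ J F) else Pop a (sigJ J F).
Proof.
apply: sigJ_op; [move=> j G | exact: tau_P | exact: tau_N | exact: swapX_P | exact: swapX_N].
exact: (tau_P_ (sg_rr j) (@PP0 j) (@NN0 j)).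
Qed.
Lemma sigJ_N J a F : uniq J ->
  sigJ J (Nop a F) = if in_sites J a then Pop a (sigJ J F) else Nop a (sigJ J F).
Proof.
apply: sigJ_op; [move=> j G | exact: tau_N | exact: tau_P | exact: swapX_N | exact: swapX_P].
exact: (tau_N_ (sg_rr j) (@PP0 j) (@NN0 j)).
Qed.
Lemma sigJ_Pd J a F : uniq J ->
  sigJ J (Pd a F) = if in_sites J a then Nd a (sigJ J F) else Pd a (sigJ J F).
Proof.
apply: sigJ_op; [move=> j G | exact: tau_Pd | exact: tau_Nd | exact: swapX_Pd | exact: swapX_Nd].
exact: (tau_Pd_ (sg_rr j) (@PdPd0 j) (@NdNd0 j)).
Qed.
Lemma sigJ_Nd J a F : uniq J ->
  sigJ J (Nd a F) = if in_sites J a then Pd a (sigJ J F) else Nd a (sigJ J F).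
Proof.
apply: sigJ_op; [move=> j G | exact: tau_Nd | exact: tau_Pd | exact: swapX_Nd | exact: swapX_Pd].
exact: (tau_Nd_ (sg_rr j) (@PdPd0 j) (@NdNd0 j)).
Qed.

Definition sigma F : A := sigJ (enum 'I_m1) F.

Lemma in_sites_enum a : in_sites (enum 'I_m1) a.
Proof. by case: a => //= j; rewrite mem_enum. Qed.

Lemma sigma_P a F : sigma (Pop a F) = Nop a (sigma F).
Proof. by rewrite /sigma sigJ_P ?enum_uniq // in_sites_enum. Qed.
Lemma sigma_N a F : sigma (Nop a F) = Pop a (sigma F).
Proof. by rewrite /sigma sigJ_N ?enum_uniq // in_sites_enum. Qed.
Lemma sigma_Pd a F : sigma (Pd a F) = Nd a (sigma F).
Proof. by rewrite /sigma sigJ_Pd ?enum_uniq // in_sites_enum. Qed.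
Lemma sigma_Nd a F : sigma (Nd a F) = Pd a (sigma F).
Proof. by rewrite /sigma sigJ_Nd ?enum_uniq // in_sites_enum. Qed.
Lemma sigma_is_linear : linear sigma.
Proof. exact: sigJ_is_linear. Qed.
HB.instance Definition _ := GRing.isLinear.Build R A A _ sigma sigma_is_linear.

Lemma mxs_linear (f : {linear A -> A}) p q (M : 'M_(p, q)) (G : 'I_p -> 'I_q -> A) :
  f (mxs M G) = mxs M (fun i j => f (G i j)).
Proof.
by rewrite /mxs linear_sum; apply: eq_bigr => i _; rewrite linear_sum; apply: eq_bigr => j _; rewrite linearZ.
Qed.

Lemma eq_mxs p q (M : 'M[R]_(p, q)) (G H : 'I_p -> 'I_q -> A) :
  (forall i j, G i j = H i j) -> mxs M G = mxs M H.
Proof. by move=> GH; apply: eq_bigr => i _; apply: eq_bigr => j _; rewrite GH. Qed.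

Lemma sigma_G a b F : sigma (Gop a b F) = Gop a b (sigma F).
Proof. by rewrite /Gop linearD /= sigma_P sigma_Pd sigma_N sigma_Nd addrC. Qed.
Lemma sigma_S a b F : sigma (Sop a b F) = Sop a b (sigma F).
Proof.
rewrite /Sop linearD linearZ /= !sigma_P !sigma_N (NPC a b) (NPC b a) (sgC R b a) scalerA sgK scale1r.
by rewrite addrC.
Qed.
Lemma sigma_Sm a b F : sigma (Smop a b F) = Smop a b (sigma F).
Proof.
rewrite /Smop linearD linearZ /= !sigma_Pd !sigma_Nd (PdNdC b a) (PdNdC a b).
by rewrite (sgC R b a) !scalerA addrC sgK !scale1r.
Qed.

Lemma mxs_asym p (M : 'M[R]_p) (G : 'I_p -> 'I_p -> A) : M = - M^T ->
  mxs M (fun i j => (-1) *: G j i) = mxs M G.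
Proof.
move=> eM; rewrite -[RHS]mxs_tr (canRL opprK (esym eM)) mxsN /mxs -sumrN.
by apply: eq_bigr => i _; rewrite -sumrN; apply: eq_bigr => j _; rewrite scaleN1r scalerN.
Qed.

Lemma mxs_sym p (M : 'M[R]_p) (G : 'I_p -> 'I_p -> A) : M = M^T ->
  mxs M (fun i j => G j i) = mxs M G.
Proof. by move=> eM; rewrite -[RHS]mxs_tr -eM. Qed.

Lemma sigmaD F G : sigma (F + G) = sigma F + sigma G. Proof. exact: linearD. Qed.
Lemma sigmaN F : sigma (- F) = - sigma F. Proof. exact: linearN. Qed.

Lemma sigmaZ k F : sigma (k *: F) = k *: sigma F. Proof. exact: linearZ. Qed.
Lemma sigma_mxs p q (M : 'M[R]_(p, q)) (G : 'I_p -> 'I_q -> A) : sigma (mxs M G) = mxs M (fun i j => sigma (G i j)).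
Proof. exact: mxs_linear. Qed.

(** The operators [Gop], [Sop] and [Smop] are invariant under P <-> N, Pd <-> Nd. In the four
    remaining blocks the exchange reverses the two letters of a pair, which the symmetry of E, F and
    the antisymmetry of B, C undo; for fermions the reordering sign is the one of the
    antisymmetry. *)
Lemma sigma_act X F : in_osp X -> sigma (act X F) = act X (sigma F).
Proof.
move=> [A0 [B [C [D [E [F0 [H [H1 [K [K1 [eB eC eE eF ->]]]]]]]]]]].
have -> := act_osp_mx A0 B C D E F0 H H1 K K1 F.
have -> := act_osp_mx A0 B C D E F0 H H1 K K1 (sigma F).
have split10 (x1 x2 x3 x4 x5 x6 x7 x8 x9 x10 : A) :
    sigma (x1 + x2 + x3 - x4 + x5 - x6 - x7 + x8 - x9 + x10) =
    sigma x1 + sigma x2 + sigma x3 - sigma x4 + sigma x5 - sigma x6 - sigma x7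
    + sigma x8 - sigma x9 + sigma x10.
  by rewrite !(sigmaD, sigmaN).
rewrite split10.
have PN a b : sigma (Pop a (Nop b F)) = sg R a b *: Pop b (Nop a (sigma F)).
  by rewrite sigma_P sigma_N NPC.
have NdPd a b : sigma (Nd a (Pd b F)) = sg R a b *: Nd b (Pd a (sigma F)).
  by rewrite sigma_Nd sigma_Pd PdNdC.
have sgf (i j : 'I_m1) : sg R (inr i : L) (inr j) = -1 by rewrite /sg expr1.
have sgb (i j : 'I_n) : sg R (inl i : L) (inl j) = 1 by rewrite /sg expr0.
apply: (f_equal2 +%R); last by rewrite [LHS]sigma_mxs; apply: eq_mxs => i j; rewrite [LHS]sigma_Sm.
apply: (f_equal2 +%R); last by apply: (f_equal -%R); rewrite [LHS]sigma_mxs; apply: eq_mxs => i j; rewrite [LHS]sigma_G.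
apply: (f_equal2 +%R); last by rewrite [LHS]sigma_mxs; apply: eq_mxs => i j; rewrite [LHS]sigma_G.
apply: (f_equal2 +%R); last by apply: (f_equal -%R); rewrite [LHS]sigma_mxs; apply: eq_mxs => i j; rewrite [LHS]sigma_S.
apply: (f_equal2 +%R); last first.
  apply: (f_equal -%R); rewrite -(mxs_sym (fun i j => Pop (inl i) (Nop (inl j) (sigma F))) eF).
  by rewrite [LHS]sigma_mxs; apply: eq_mxs => i j; rewrite [LHS]PN sgb scale1r.
apply: (f_equal2 +%R); last first.
  rewrite -(mxs_sym (fun i j => Nd (inl i) (Pd (inl j) (sigma F))) eE).
  by rewrite [LHS]sigma_mxs; apply: eq_mxs => i j; rewrite [LHS]NdPd sgb scale1r.
apply: (f_equal2 +%R); last first.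
  by apply: (f_equal -%R); rewrite [LHS]sigma_mxs; apply: eq_mxs => i j; rewrite [LHS]sigmaD sigma_G sigmaZ.
apply: (f_equal2 +%R); last first.
  rewrite -(mxs_asym (fun i j => Nd (inr i) (Pd (inr j) (sigma F))) eC).
  by rewrite [LHS]sigma_mxs; apply: eq_mxs => i j; rewrite [LHS]NdPd sgf.
apply: (f_equal2 +%R); last first.
  rewrite -(mxs_asym (fun i j => Pop (inr i) (Nop (inr j) (sigma F))) eB).
  by rewrite [LHS]sigma_mxs; apply: eq_mxs => i j; rewrite [LHS]PN sgf.
by rewrite [LHS]sigma_mxs; apply: eq_mxs => i j; rewrite [LHS]sigmaD sigmaN sigma_G sigmaZ.
Qed.

End Tau.

(** * Even central elements, columns and the action of eta *)

Section Central.
Variables (R : comNzRingType) (m1 n : nat).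
Local Notation A := (superpoly R (n + n) (m1 + m1)).
Local Notation L := ('I_n + 'I_m1)%type.
Implicit Types (F G : A) (a b c : L) (S : {set 'I_(m1 + m1)}).

Definition comp S (p : {mpoly R[n + n]}) : A := [ffun T => if T == S then p else 0].

Lemma comp_sum F : F = \sum_S comp S (F S).
Proof.
apply/ffunP => T; rewrite sum_ffunE (bigD1 T) //= ffunE eqxx big1 ?addr0 // => S nS.
by rewrite ffunE eq_sym (negbTE nS).
Qed.

Lemma comp_is_linear S : linear (comp S).
Proof.
move=> k p q; apply/ffunP => T; rewrite !ffunE; case: ifP => _ //.
by rewrite scaler0 addr0.
Qed.
HB.instance Definition _ S := GRing.isLinear.Build R _ _ _ (comp S) (@comp_is_linear S).

Lemma superpoly_ind (V : A -> Prop) : subspace V -> V 1 ->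
  (forall i F, V F -> V (spX R _ i * F)) -> (forall p F, V F -> V (theta R _ p * F)) ->
  forall F, V F.
Proof.
move=> sV V1 VX Vt F; rewrite [F]comp_sum; apply: (sub_sum sV) => S _.
have sK k : (-1) ^+ k *: ((-1) ^+ k : {mpoly R[n + n]}) = 1.
  by elim: k => [|k IH]; rewrite ?scale1r // !exprS !mulN1r scaleNr scalerN opprK.
have Vc1 T : V (comp T 1).
  have [k] := ubnP #|T|; elim: k T => // k IH T le_T.
  have [->|/set0Pn[p pT]] := eqVneq T set0.
    by rewrite (_ : comp _ _ = 1) //; apply/ffunP => U; rewrite !ffunE; case: eqP.
  have /IH/(Vt p) : (#|T :\ p| < k)%N by rewrite (cardsD1 p T) pT in le_T.
  rewrite thetaME; set G := [ffun _ => _].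
  have -> : comp T 1 = (-1) ^+ ninv [set p] (T :\ p) *: G.
    apply/ffunP => U; rewrite !ffunE; have [->|nU] := eqVneq U T.
      by rewrite pT eqxx mulr1 sK.
    have [pU|_] := boolP (p \in U); last by rewrite scaler0.
    case: eqP => [e|_]; last by rewrite mulr0 scaler0.
    by case/eqP: nU; rewrite -(setD1K pU) e setD1K.
  by move=> VG; apply: (subZ sV).
have VXc p i : V (comp S p) -> V (comp S ('X_i * p)).
  move=> /(VX i); congr V; rewrite spXME; apply/ffunP => T; rewrite !ffunE.
  by case: ifP; rewrite ?mulr0.
rewrite [F S]mpolyE linear_sum; apply: (sub_sum sV) => mm _; rewrite linearZ.
apply: (subZ sV) => /=; rewrite mpolyXE_id.
elim: (index_enum _) => [|i r IH]; first by rewrite big_nil.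
rewrite big_cons; elim: (mm i) => [|k IHk]; first by rewrite mul1r.
by rewrite exprS -mulrA; apply: VXc.
Qed.

Definition uu (j : 'I_m1) : A := thl R n j * thr R n j.

Lemma uu_comm j F : uu j * F = F * uu j.
Proof.
move: F; apply: superpoly_ind.
- split; [by rewrite mulr0 mul0r | |].
    by move=> F G eF eG; rewrite mulrDr mulrDl eF eG.
  by move=> k F eF; rewrite -scalerAr -scalerAl eF.
- by rewrite mulr1 mul1r.
- by move=> i F eF; rewrite -[RHS]mulrA -eF; exact: spX_mulCA.
- move=> p F eF; rewrite -[RHS]mulrA -eF /uu -!mulrA.
  have -> : thr R n j * (theta R _ p * F) = - (theta R _ p * (thr R n j * F)) by exact: thetaCA.
  by rewrite mulrN; apply/eqP; rewrite eqr_oppLR; apply/eqP; exact: thetaCA.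
Qed.

Lemma uuK j : uu j * uu j = 0.
Proof.
rewrite /uu -mulrA [X in _ * X](_ : _ = - (thl R n j * (thr R n j * thr R n j))); last exact: thetaCA.
by rewrite [thr R n j * _]theta_sqr0 mulr0 oppr0 mulr0.
Qed.

Definition hgen (i : 'I_((n + n) + m1)) : A :=
  match split i with inl k => spX R _ k | inr j => uu j end.

End Central.

(** A' is not commutative, but the elements theta_j theta_(m1+j) are central. [Psi] evaluates
    ordinary polynomials, with one extra variable per fermionic site, at the x_i and these elements.
    Identities between columns can thus be checked by [ring] upstairs, where the extra variables are
    not yet nilpotent. *)
HB.lock Definition Psi (R : comNzRingType) (m1 n : nat) (p : {mpoly R[(n + n) + m1]}) :
  superpoly R (n + n) (m1 + m1) := mmap (GRing.in_alg (superpoly R (n + n) (m1 + m1))) (@hgen R m1 n) p.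

Section CentralImage.
Variables (R : comNzRingType) (m1 n : nat).
Local Notation A := (superpoly R (n + n) (m1 + m1)).
Local Notation L := ('I_n + 'I_m1)%type.
Local Notation Pm := {mpoly R[(n + n) + m1]}.
Local Notation hgen := (@hgen R m1 n).
Local Notation Psi := (@Psi R m1 n).
Local Notation uu := (@uu R m1 n).
Implicit Types (F G : A) (a b : L) (c : L * L) (p q : Pm).

Lemma hgen_comm i F : GRing.comm F (hgen i).
Proof.
by rewrite /GRing.comm /hgen; case: (split i) => k; rewrite ?spX_comm // uu_comm.
Qed.

Lemma mmap1_comm (mm : 'X_{1..(n + n) + m1}) F : GRing.comm F (mmap1 hgen mm).
Proof. by apply/commr_prod => i _; apply/commrX/hgen_comm. Qed.

Lemma Psi_morph : multiplicative Psi.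
Proof.
rewrite unlock; apply: commr_mmap_is_multiplicative => [i F|p m' m'']; first exact: hgen_comm.
exact: mmap1_comm.
Qed.

Lemma Psi1 : Psi 1 = 1. Proof. exact: Psi_morph.2. Qed.
Lemma PsiM p q : Psi (p * q) = Psi p * Psi q. Proof. exact: Psi_morph.1. Qed.
Lemma PsiD p q : Psi (p + q) = Psi p + Psi q. Proof. by rewrite unlock mmapD. Qed.
Lemma PsiB p q : Psi (p - q) = Psi p - Psi q. Proof. by rewrite unlock mmapB. Qed.
Lemma Psi0 : Psi 0 = 0. Proof. by rewrite unlock mmap0. Qed.
Lemma PsiZ k p : Psi (k *: p) = k *: Psi p.
Proof. by rewrite unlock mmapZ /= mulr_algl. Qed.

Lemma Psi_comm p F : F * Psi p = Psi p * F.
Proof.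
rewrite unlock /mmap mulr_suml mulr_sumr; apply: eq_bigr => mm _ /=.
by rewrite mulr_algl -scalerAr -scalerAl mmap1_comm.
Qed.

Definition zp a : Pm :=
  match a with inl i => 'X_(lshift m1 (lshift n i)) | inr _ => 1 end.
Definition zb a : Pm :=
  match a with inl i => 'X_(lshift m1 (rshift n i)) | inr j => 'X_(rshift (n + n) j) end.

Lemma Psi_X i : Psi 'X_i = hgen i.
Proof. by rewrite unlock mmapX mmap1U. Qed.
Lemma Psi_zpl i : Psi (zp (inl i)) = xl R m1 i.
Proof. by rewrite /= Psi_X /hgen split_lshift. Qed.
Lemma Psi_zpr j : Psi (zp (inr j)) = 1. Proof. exact: Psi1. Qed.
Lemma Psi_zbl i : Psi (zb (inl i)) = xr R m1 i.
Proof. by rewrite /= Psi_X /hgen split_lshift. Qed.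
Lemma Psi_zbr j : Psi (zb (inr j)) = uu j.
Proof. by rewrite /= Psi_X /hgen split_rshift. Qed.

Definition ecol (c : L * L) : Pm := zp c.1 * zb c.2 - zp c.2 * zb c.1.
Definition ee k (s : seq L) : Pm := (\prod_(a <- s) ((zp a)%:P + zb a *: 'X))`_k.

Lemma ee_nil k : ee k [::] = (k == 0)%:R.
Proof. by rewrite /ee big_nil coef1. Qed.
Lemma ee_cons k a s : ee k (a :: s) = zp a * ee k s + (if k is l.+1 then zb a * ee l s else 0).
Proof.
rewrite /ee big_cons mulrDl coefD coefCM; congr (_ + _).
by rewrite -scalerAl coefZ coefXM; case: k => [|k] //=; rewrite mulr0.
Qed.
Lemma ee_perm k s s' : perm_eq s s' -> ee k s = ee k s'.
Proof. by move=> ss'; rewrite /ee (perm_big _ ss'). Qed.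
Lemma ee_gt k s : (size s < k)%N -> ee k s = 0.
Proof.
elim: s k => [|a s IH] [|k] //= ks; first by rewrite ee_nil.
by rewrite ee_cons !IH ?mulr0 ?addr0 // ltnW.
Qed.
Lemma ee0 s : ee 0 s = \prod_(a <- s) zp a.
Proof. by elim: s => [|a s IH]; rewrite ?big_nil ?ee_nil // ee_cons big_cons IH addr0. Qed.
Lemma ee_size s : ee (size s) s = \prod_(a <- s) zb a.
Proof.
elim: s => [|a s IH]; first by rewrite big_nil ee_nil.
by rewrite ee_cons big_cons ee_gt // mulr0 add0r IH.
Qed.

#[local] Opaque ee.
Definition Zlo a : A := Psi (zp a).
Definition Zhi a : A := Psi (zb a).
Lemma Zlo_comm a F : F * Zlo a = Zlo a * F. Proof. exact: Psi_comm. Qed.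
Lemma Zhi_comm a F : F * Zhi a = Zhi a * F. Proof. exact: Psi_comm. Qed.

Definition Uw a : A := if a is inr j then uu j else 0.
Definition Dx F : A := \sum_(i < n) xr R m1 i * dX (lshift n i) F.
(** A version of [eta] that keeps only the products theta_j theta_(m1+j) of the fermionic letters in
    l. A letter can then be peeled off a product together with its own contribution, and in this
    sense [De] is a derivation with z_a -> zb_a -> 0. *)
Definition De (l : seq L) F : A := Dx F + (\sum_(a <- l) Uw a) * F.

Lemma Dx_is_linear : linear Dx.
Proof.
move=> k F G; rewrite /Dx scaler_sumr -big_split; apply: eq_bigr => i _.
by rewrite linearP mulrDr scalerAr.
Qed.
HB.instance Definition _ := GRing.isLinear.Build R A A _ Dx Dx_is_linear.

Lemma De_is_linear l : linear (De l).
Proof. by move=> k F G; rewrite /De linearP mulrDr scalerDr -scalerAr addrACA. Qed.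
HB.instance Definition _ l := GRing.isLinear.Build R A A _ (De l) (@De_is_linear l).

Lemma De_perm l l' F : perm_eq l l' -> De l F = De l' F.
Proof. by move=> ll'; rewrite /De (perm_big _ ll'). Qed.

Lemma Dx_uu j F : Dx (uu j * F) = uu j * Dx F.
Proof.
rewrite /Dx mulr_sumr; apply: eq_bigr => i _.
have -> : dX (lshift n i) (uu j * F) = uu j * dX (lshift n i) F.
  by rewrite /uu -!mulrA [LHS]dX_theta [X in _ * X]dX_theta.
by rewrite [RHS]spX_mulCA.
Qed.

Lemma De_Zlo a l F : De (a :: l) (Zlo a * F) = Zlo a * De l F + Zhi a * F.
Proof.
rewrite /De big_cons; case: a => [i|j]; rewrite /Zlo /Zhi.
  rewrite Psi_zpl Psi_zbl add0r.
  have -> : Dx (xl R m1 i * F) = xr R m1 i * F + xl R m1 i * Dx F.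
    rewrite /Dx (eq_bigr (fun k => (k == i)%:R *: (xr R m1 k * F) + xl R m1 i * (xr R m1 k * dX (lshift n k) F))).
      rewrite big_split -mulr_sumr; apply: (f_equal2 +%R) => //.
      rewrite (bigD1 i) //= eqxx scale1r big1 ?addr0 // => k /negbTE ->.
      by rewrite scale0r.
    move=> k _; rewrite (_ : dX _ _ = (k == i)%:R *: F + xl R m1 i * dX (lshift n k) F).
      by rewrite mulrDr -scalerAr; apply: (congr1 (fun z => _ + z)); exact: spX_mulCA.
    by rewrite [LHS]dX_spX eq_lshift.
  rewrite mulrDr; set S := \sum_(_ <- _) _.
  have -> : S * (xl R m1 i * F) = xl R m1 i * (S * F) by exact: spX_mulCA.
  by rewrite -[LHS]addrA addrC.
rewrite Psi_zpr Psi_zbr !mul1r mulrDl -[RHS]addrA; congr (_ + _); exact: addrC.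
Qed.

Lemma De_Zhi a l F : De (a :: l) (Zhi a * F) = Zhi a * De l F.
Proof.
rewrite /De big_cons mulrDr; set S := \sum_(_ <- _) _.
case: a => [i|j]; rewrite /Zhi.
  rewrite Psi_zbl add0r; congr (_ + _); last exact: spX_mulCA.
  rewrite /Dx mulr_sumr; apply: eq_bigr => k _.
  have -> : dX (lshift n k) (xr R m1 i * F) = xr R m1 i * dX (lshift n k) F.
    by rewrite [LHS]dX_spX eq_lrshift scale0r add0r.
  exact: spX_mulCA.
rewrite Psi_zbr Dx_uu; congr (_ + _).
rewrite mulrDl mulrA [uu j * uu j]uuK mul0r add0r mulrA -[S * uu j]uu_comm.
by rewrite mulrA.
Qed.

Lemma Psi_ee_cons j a s G : Psi (ee j (a :: s)) * G = Zlo a * (Psi (ee j s) * G) +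
    (if j is i.+1 then Zhi a * (Psi (ee i s) * G) else 0).
Proof.
rewrite ee_cons PsiD PsiM mulrDl -mulrA -/(Zlo a).
by case: j => [|j]; [rewrite Psi0 mul0r | rewrite PsiM -mulrA -/(Zhi a)].
Qed.

(** In the generating product over s, each factor z_a + zb_a X is differentiated into zb_a, which is
    the X-derivative; its coefficient of X^k is (k+1) e_(k+1). *)
Lemma De_ee k s l F :
  De (s ++ l) (Psi (ee k s) * F) = Psi (ee k s) * De l F + k.+1%:R *: (Psi (ee k.+1 s) * F).
Proof.
elim: s k => [|a s IH] k.
  rewrite !ee_nil /= Psi0 mul0r scaler0 addr0; case: k => [|k] /=.
    by rewrite Psi1 !mul1r.
  by rewrite Psi0 !mul0r linear0.
rewrite (Psi_ee_cons k a s F) (Psi_ee_cons k a s (De l F)) (Psi_ee_cons k.+1 a s F) cat_cons.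
rewrite linearD /= De_Zlo IH.
set P := Psi (ee k s) * De l F; set Q := Psi (ee k.+1 s) * F; set S := Psi (ee k s) * F.
case: k @P @Q @S => [|k] P Q S.
  by rewrite linear0 !addr0 !scale1r mulrDr addrA.
rewrite De_Zhi IH; set P' := Psi (ee k s) * De l F; rewrite -/S.
rewrite [X in _ = _ + X]scalerDr [k.+2%:R *: (Zhi a * S)](_ : _ = Zhi a * S + k.+1%:R *: (Zhi a * S)); last first.
  by rewrite -[k.+2]addn1 addnC natrD scalerDl scale1r.
rewrite !mulrDr -!scalerAr [LHS](AC (3*2) ((1*4)*(2*(3*5)))).
by [].
Qed.

(** A column behaves as a constant: its derivative is zb_a zb_b - zb_b zb_a. *)
Lemma De_ecol (c : L * L) l F : De (c.1 :: c.2 :: l) (Psi (ecol c) * F) = Psi (ecol c) * De l F.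
Proof.
case: c => a b; rewrite /ecol /= PsiB !PsiM !mulrBl -!mulrA linearB /=.
rewrite De_Zlo De_Zhi (@De_perm [:: a, b & l] [:: b, a & l]); last first.
  by apply/seq.permP => q /=; rewrite addnCA.
rewrite De_Zlo De_Zhi.
have -> : Zhi b * (Zhi a * F) = Zhi a * (Zhi b * F) by rewrite !mulrA Zhi_comm.
by rewrite opprD addrACA subrr addr0.
Qed.

Local Notation S2 := (seq (L * L)).
Definition Th (w : seq 'I_(m1 + m1)) : A := \prod_(p <- w) theta R _ p.
Definition lett (s : seq L) (C : S2) : seq L := s ++ flatten [seq [:: c.1; c.2] | c <- C].
Definition vv k (s : seq L) (C : S2) (w : seq 'I_(m1 + m1)) : A :=
  Psi (ee k s * \prod_(c <- C) ecol c) * Th w.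

(* Every site carries exactly one letter, or one of its two thetas alone. *)
Definition valid (l : seq L) (w : seq 'I_(m1 + m1)) : Prop :=
  forall q : 'I_m1, (count_mem (inr q) l + count_mem (lshift m1 q) w + count_mem (rshift m1 q) w = 1)%N.

Lemma De_cols (C : S2) l F :
  De (flatten [seq [:: c.1; c.2] | c <- C] ++ l) (Psi (\prod_(c <- C) ecol c) * F) =
  Psi (\prod_(c <- C) ecol c) * De l F.
Proof.
elim: C => [|c C IH] /=; first by rewrite big_nil Psi1 !mul1r.
by rewrite big_cons PsiM -!mulrA De_ecol IH.
Qed.

Lemma De_vv k s C w : De (lett s C) (vv k s C w) = k.+1%:R *: vv k.+1 s C w.
Proof.
rewrite /vv !PsiM -!mulrA /lett De_ee.
have -> : De (flatten [seq [:: c.1; c.2] | c <- C]) (Psi (\prod_(c <- C) ecol c) * Th w) = 0.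
  rewrite -[flatten _]cats0 De_cols /De big_nil mul0r addr0 (_ : Dx _ = 0) ?mulr0 //.
  rewrite /Dx big1 // => i _; rewrite (_ : dX _ _ = 0) ?mulr0 //.
  rewrite /Th; elim: w => [|p w IH]; first by rewrite big_nil dX1.
  by rewrite big_cons dX_theta IH mulr0.
by rewrite mulr0 add0r.
Qed.

Lemma sum_Uw l : \sum_(a <- l) Uw a = \sum_j uu j *+ count_mem (inr j) l :> A.
Proof.
elim: l => [|a l IH]; first by rewrite big_nil big1.
rewrite big_cons IH; case: a => [i|j] /=; first by rewrite add0r.
rewrite (bigD1 j) //= [RHS](bigD1 j) //= eqxx mulrS addrA; congr (_ + _).
by apply: eq_bigr => k /negbTE kj; rewrite eq_inr eq_sym kj.
Qed.

Lemma theta_Th (p : 'I_(m1 + m1)) w : p \in w -> theta R _ p * Th w = 0.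
Proof. exact: theta_prod_mem. Qed.

Lemma uu_Th j w : (lshift m1 j \in w) || (rshift m1 j \in w) -> uu j * Th w = 0.
Proof.
rewrite /Submission.uu -mulrA => /orP[/theta_Th e|/theta_Th e]; last first.
  by rewrite [X in _ * X]e mulr0.
rewrite [LHS]thetaCA [X in _ * X]e mulr0 oppr0; exact: erefl.
Qed.

(** By [valid], a site missing from the letters carries a lone theta, which kills its theta_j
    theta_(m1+j). So [eta] and [De] over the letters agree on this element. *)
Lemma eta_vv k s C w : valid (lett s C) w -> eta (vv k s C w) = k.+1%:R *: vv k.+1 s C w.
Proof.
move=> V; have := De_vv k s C w; move=> <-.
rewrite /eta /De /Dx; apply: (congr1 (fun z => _ + z)).
rewrite sum_Uw mulr_suml; apply: eq_bigr => j _.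
have := V j; case: (count_mem (inr j) _) => [|[|c]] e; last 2 first.
- by [].
- by move: e => /=; lia.
rewrite mulr0n mul0r /vv mulrA Psi_comm -mulrA uu_Th ?mulr0 // -!has_pred1 !has_count.
by lia.
Qed.

Lemma etaZ (k : R) F : eta (k *: F) = k *: eta F :> A.
Proof.
rewrite /eta scalerDr !scaler_sumr; apply: (f_equal2 +%R); apply: eq_bigr => j _.
  by rewrite linearZ scalerAr.
by rewrite scalerAr.
Qed.

Lemma iter_etaZ t (k : R) F : iter t (@eta R m1 n) (k *: F) = k *: iter t (@eta R m1 n) F.
Proof. by elim: t => //= t ->; exact: etaZ. Qed.

Lemma iter_eta_vv t s C w : valid (lett s C) w -> iter t (@eta R m1 n) (vv 0 s C w) = t`!%:R *: vv t s C w.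
Proof.
move=> V; elim: t => [|t IH]; first by rewrite scale1r.
by rewrite iterS IH etaZ eta_vv // scalerA factS natrM mulrC.
Qed.

Lemma vv_gt k s C w : (size s < k)%N -> vv k s C w = 0.
Proof. by move=> sk; rewrite /vv ee_gt // mul0r Psi0 mul0r. Qed.

End CentralImage.

(** * The sign by which sigma acts on products of columns *)

Section SigmaBasis.
Variables (R : comNzRingType) (m1 n : nat).
Local Notation A := (superpoly R (n + n) (m1 + m1)).
Local Notation L := ('I_n + 'I_m1)%type.
Local Notation Psi := (@Psi R m1 n).
Local Notation uu := (@uu R m1 n).
Implicit Types (F G : A) (a b : L) (c : L * L) (j : 'I_m1) (J : seq 'I_m1) (s l : seq L).

Lemma tau_comm a b F : (a == b) = false -> tau a (tau b F) = tau b (tau a F).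
Proof.
move=> ab; have ba : (b == a) = false by rewrite eq_sym.
have dmC G : tau a (dm b G) = dm b (tau a G).
  by rewrite /dm [LHS]tau_sub (tau_Pd ba) (tau_Nd ba).
have pmC G : tau a (pm b G) = pm b (tau a G).
  by rewrite /pm [LHS]tau_sub (tau_P ba) (tau_N ba).
by rewrite (tauE b F) [LHS]tau_sub pmC dmC -tauE.
Qed.

Lemma tauJ_tau J j F : j \notin J -> tauJ J (tau (inr j) F) = tau (inr j) (tauJ J F).
Proof.
elim: J => //= k J IH; rewrite inE negb_or => /andP[jk /IH ->].
by apply: tau_comm; rewrite eq_inr eq_sym (negbTE jk).
Qed.

Lemma tauJ_rem J j F : j \in J -> uniq J -> tauJ J F = tau (inr j) (tauJ (rem j J) F).
Proof.
elim: J => //= k J IH; rewrite inE; case: eqVneq => [-> //|jk /= jJ /andP[kJ uJ]].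
by rewrite IH //; apply: tau_comm; rewrite eq_inr eq_sym (negbTE jk).
Qed.

Lemma sigJ_perm J J' F : perm_eq J J' -> uniq J -> sigJ J F = sigJ J' F.
Proof.
move=> + uJ; rewrite /sigJ => pJ; congr swapX.
elim: J J' uJ pJ => [|j J IH] J' /= => [_|/andP[jJ uJ] pJ].
  by rewrite perm_sym => /perm_nilP ->.
have jJ' : j \in J' by rewrite -(perm_mem pJ) mem_head.
rewrite (tauJ_rem _ jJ') -?(perm_uniq pJ) /= ?jJ //; congr (tau _ _); apply: IH => //.
by rewrite -(perm_cons j) (perm_trans pJ) // perm_to_rem.
Qed.

Lemma sigJ_cons J j F : j \notin J -> sigJ (j :: J) F = sigJ J (tau (inr j) F).
Proof. by move=> jJ; rewrite /sigJ /= tauJ_tau. Qed.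

(** Neither theta of site j occurs in F, phrased through the annihilating derivations so that the
    relations between operators apply directly. *)
Definition free j F : Prop := Pd (inr j) F = 0 /\ Nop (inr j) F = 0.

Lemma uuE j F : uu j * F = Pop (inr j) (Nd (inr j) F).
Proof. by rewrite /Submission.uu -mulrA. Qed.

Lemma free_NN j F : free j F -> Nop (inr j) (Nd (inr j) F) = F.
Proof.
move=> [_ f2]; have := NdN (inr j) (inr j) F.
by rewrite f2 op0 eqxx scale1r sg_rr scaleN1r => /esym/eqP; rewrite subr_eq0 => /eqP/esym.
Qed.

(** On an empty site [tau] exchanges 1 and theta_j theta_(m1+j), that is z and zb of the letter. *)
Lemma tau_free j F : free j F -> tau (inr j) F = uu j * F.
Proof.
move=> fF; have NN := free_NN fF; case: fF => f1 f2.
rewrite tauE /dm f1 sub0r /pm Pop_opp Nop_opp NN !opprK uuE.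
by rewrite opprD opprK addrC addrNK.
Qed.

Lemma tau_uu j F : free j F -> tau (inr j) (uu j * F) = F.
Proof.
move=> fF; have NN := free_NN fF; case: (fF) => f1 f2.
rewrite uuE (tau_P_ (sg_rr R n j) (@PP0 R m1 n j) (@NN0 R m1 n j)).
rewrite (tau_Nd_ (sg_rr R n j) (@PdPd0 R m1 n j) (@NdNd0 R m1 n j)).
rewrite tau_free // uuE PdP eqxx scale1r PdNdC f1 !op0 addr0.
exact: NN.
Qed.

Lemma sigJ_uu J j F : uniq J -> j \notin J -> sigJ J (uu j * F) = uu j * sigJ J F.
Proof. by move=> uJ jJ; rewrite !uuE sigJ_P // sigJ_Nd // /in_sites (negbTE jJ). Qed.

Definition ext a J : seq 'I_m1 := if a is inr j then j :: J else J.
Definition freeL a F : Prop := if a is inr j then free j F else True.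
Local Notation Zlo := (@Zlo R m1 n).
Local Notation Zhi := (@Zhi R m1 n).

Lemma sigJ_Zlo a J F : uniq (ext a J) -> freeL a F -> sigJ (ext a J) (Zlo a * F) = Zhi a * sigJ J F.
Proof.
case: a => [i|j] /=; rewrite /Submission.Zlo /Submission.Zhi.
  by move=> uJ _; rewrite Psi_zpl Psi_zbl [LHS](sigJ_N (inl i)).
by move=> /andP[jJ uJ] fF; rewrite Psi_zpr Psi_zbr mul1r sigJ_cons // tau_free // sigJ_uu.
Qed.

Lemma sigJ_Zhi a J F : uniq (ext a J) -> freeL a F -> sigJ (ext a J) (Zhi a * F) = Zlo a * sigJ J F.
Proof.
case: a => [i|j] /=; rewrite /Submission.Zlo /Submission.Zhi.
  by move=> uJ _; rewrite Psi_zpl Psi_zbl [LHS](sigJ_P (inl i)).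
by move=> /andP[jJ uJ] fF; rewrite Psi_zpr Psi_zbr mul1r sigJ_cons // tau_uu.
Qed.

Lemma free_Zlo j a F : free j F -> free j (Zlo a * F).
Proof.
move=> [f1 f2]; rewrite /Submission.Zlo; case: a => [i|k]; rewrite ?Psi_zpl ?Psi_zpr ?mul1r //.
by split; [rewrite [LHS]dthetaX [X in _ * X]f1 mulr0 | rewrite [LHS]dthetaX [X in _ * X]f2 mulr0].
Qed.

Lemma free_Zhi j a F : (inr j == a) = false -> free j F -> free j (Zhi a * F).
Proof.
move=> ja [f1 f2]; rewrite /Submission.Zhi; case: a ja => [i|k] ja; rewrite ?Psi_zbl ?Psi_zbr.
  by split; [rewrite [LHS]dthetaX [X in _ * X]f1 mulr0 | rewrite [LHS]dthetaX [X in _ * X]f2 mulr0].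
rewrite uuE; split; first by rewrite PdP ja scale0r add0r PdNdC f1 !op0.
rewrite NPC (_ : Nop (inr j) (Nd (inr k) F) = 0) ?op0 //.
have := NdN (inr k) (inr j) F; rewrite f2 op0 eq_sym ja scale0r add0r => /esym.
by move=> /(congr1 (fun z => sg R (inr k : L) (inr j) *: z)); rewrite scalerA sgK scale1r scaler0.
Qed.

Lemma free_subspace j : subspace (free j).
Proof.
split; first by split; rewrite op0.
  by move=> F G [f1 f2] [g1 g2]; split; [rewrite [LHS]linearD [X in X + _]f1 [X in _ + X]g1 | rewrite [LHS]linearD [X in X + _]f2 [X in _ + X]g2]; rewrite addr0.
by move=> k F [f1 f2]; split; apply: etrans (linearZ_LR _ _ _) _; [exact: etrans (congr1 _ f1) (scaler0 _ k) | exact: etrans (congr1 _ f2) (scaler0 _ k)].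
Qed.

Lemma free_ee j k s F : inr j \notin s -> free j F -> free j (Psi (ee R k s) * F).
Proof.
move=> + fF; elim: s k => [|a s IH] k.
  move=> _; rewrite ee_nil; case: k => [|k]; first by rewrite Psi1 mul1r.
  by rewrite Psi0 mul0r; apply: (sub0 (free_subspace j)).
rewrite inE negb_or => /andP[/negbTE ja js]; rewrite Psi_ee_cons.
apply: (subD (free_subspace j)); first by apply: free_Zlo; apply: IH.
case: k => [|k]; first exact: (sub0 (free_subspace j)).
by apply: free_Zhi => //; apply: IH.
Qed.

Definition extl l J : seq 'I_m1 := foldr ext J l.

Lemma uniq_ext a J : uniq (ext a J) -> uniq J.
Proof. by case: a => //= j /andP[]. Qed.

Lemma mem_extl j l J : (j \in extl l J) = (inr j \in l) || (j \in J).
Proof.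
elim: l => //= -[i|k] l IH; rewrite !inE /= ?IH ?inE //.
by rewrite orbA.
Qed.

Lemma ext_notin a l J : uniq (ext a (extl l J)) -> if a is inr j then inr j \notin l else true.
Proof. by case: a => //= j /andP[]; rewrite mem_extl negb_or => /andP[]. Qed.

Lemma uniq_extl l J : uniq (extl l J) -> uniq J.
Proof. by elim: l => //= a l IH /uniq_ext. Qed.

(** Exchanging z_a and zb_a in every factor reverses the generating polynomial, so degree k becomes
    degree |s| - k. *)
Lemma sigJ_ee s : forall (k l : nat) J F, (k + l = size s)%N -> uniq (extl s J) ->
  (forall a, a \in s -> freeL a F) ->
  sigJ (extl s J) (Psi (ee R k s) * F) = Psi (ee R l s) * sigJ J F.
Proof.
elim: s => [|a s IH] k l J F.
  by case: k l => [|k] [|l] //= _ _ _; rewrite !ee_nil Psi1 !mul1r.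
move=> /= kl uJ fF; have uJ' := uniq_ext uJ.
have fF' b : b \in s -> freeL b F by move=> bs; apply: fF; rewrite inE bs orbT.
have fa i : freeL a (Psi (ee R i s) * F).
  have := ext_notin uJ; have := fF a (mem_head _ _); case: (a) => //= j fj js.
  exact: free_ee.
rewrite (Psi_ee_cons k) (Psi_ee_cons l) [LHS]linearD /= sigJ_Zlo //.
rewrite [RHS]addrC; apply: (f_equal2 +%R).
  case: l kl => [|l] kl; last by rewrite (IH k l) //; lia.
  by rewrite ee_gt ?Psi0 ?mul0r ?linear0 ?mulr0 //; lia.
case: k kl => [|k] kl; last by rewrite sigJ_Zhi // (IH k l) //; lia.
by rewrite linear0 ee_gt ?Psi0 ?mul0r ?mulr0 //; lia.
Qed.

Lemma sigJ_ecol c J F : uniq (ext c.1 (ext c.2 J)) -> freeL c.1 F -> freeL c.2 F ->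
  sigJ (ext c.1 (ext c.2 J)) (Psi (ecol R c) * F) = - (Psi (ecol R c) * sigJ J F).
Proof.
case: c => a b /= uJ fa fb; have uJ' := uniq_ext uJ.
have nab : if a is inr j then (inr j == b) = false else true.
  case: a uJ {fa} => //= j /andP[+ _]; case: b {fb uJ'} => //= k.
  by rewrite inE negb_or => /andP[/negbTE].
have pab : perm_eq (ext a (ext b J)) (ext b (ext a J)).
  case: (a) => [i|j]; case: (b) => [i'|k] //=.
  by apply/seq.permP => p /=; rewrite addnCA.
have uJ2 : uniq (ext b (ext a J)) by rewrite -(perm_uniq pab).
have fab : freeL a (Zhi b * F).
  by case: (a) fa nab => //= j fj ja; apply: free_Zhi.
have fba : freeL b (Zhi a * F).
  case: (b) fb nab => //= k fk; case: (a) => [i|j] /= ja; apply: free_Zhi => //.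
  by rewrite eq_sym.
rewrite /ecol /= PsiB !PsiM !mulrBl -!mulrA [LHS]linearB /=.
rewrite [X in X - _]sigJ_Zlo // [X in _ * X - _]sigJ_Zhi //.
rewrite (sigJ_perm _ pab) // [X in _ - X]sigJ_Zlo // [X in _ - _ * X]sigJ_Zhi // ?(uniq_ext uJ2) //.
rewrite opprB; apply: (f_equal2 (fun x y => x - y)).
  by rewrite !mulrA; exact: (congr1 (fun z => z * _) (Zlo_comm _ _)).
by rewrite !mulrA; exact: (congr1 (fun z => z * _) (Zlo_comm _ _)).
Qed.

Lemma free_ecol j c F : (inr j == c.1) = false -> (inr j == c.2) = false ->
  free j F -> free j (Psi (ecol R c) * F).
Proof.
move=> j1 j2 fF; rewrite /ecol PsiB !PsiM mulrBl -!mulrA.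
by apply: (subB (free_subspace j)); apply: free_Zlo; apply: free_Zhi.
Qed.

Lemma sigJ_cols (C : seq (L * L)) J F : uniq (extl (flatten [seq [:: c.1; c.2] | c <- C]) J) ->
  (forall a, a \in flatten [seq [:: c.1; c.2] | c <- C] -> freeL a F) ->
  (sigJ (extl (flatten [seq [:: c.1; c.2] | c <- C]) J) (Psi (\prod_(c <- C) ecol R c) * F) =
     (-1) ^+ size C *: (Psi (\prod_(c <- C) ecol R c) * sigJ J F)) /\
  (forall j, inr j \notin flatten [seq [:: c.1; c.2] | c <- C] -> free j F ->
     free j (Psi (\prod_(c <- C) ecol R c) * F)).
Proof.
elim: C => [|[a b] C IH] /= uJ fF.
  by rewrite big_nil Psi1 !mul1r scale1r; split.
have uJ2 := uniq_ext uJ; have uJ1 := uniq_ext uJ2.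
have [IH1 IH2] := IH uJ1 (fun x xC => fF x (mem_behead (s := [:: a, b & _]) (mem_behead (s := _ :: _) xC))).
rewrite big_cons PsiM -!mulrA; split; last first.
  move=> j; rewrite !inE !negb_or => /and3P[/negbTE ja /negbTE jb jC] fj.
  by apply: free_ecol => //; apply: IH2.
have fa : freeL a (Psi (\prod_(c <- C) ecol R c) * F).
  have fj := fF a (mem_head _ _); have := ext_notin (l := b :: _) uJ.
  case: (a) fj => //= j fj; rewrite inE negb_or => /andP[_ jC]; exact: IH2.
have fb : freeL b (Psi (\prod_(c <- C) ecol R c) * F).
  have fj : freeL b F by apply: fF; rewrite !inE eqxx orbT.
  have := ext_notin uJ2; case: (b) fj => //= j fj jC; exact: IH2.
rewrite (sigJ_ecol (c := (a, b)) uJ fa fb) IH1 exprS mulN1r scaleNr.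
by rewrite -scalerAr.
Qed.

Definition nleft (w : seq 'I_(m1 + m1)) : nat := (\sum_(j < m1) (lshift m1 j \in w))%N.

(** A lone theta_j gives -1 and a lone theta_(m1+j) gives +1, which explains why only the left
    thetas are counted by [nleft]. *)
Lemma tau_left j F : thl R n j * F = 0 -> dtheta (rshift m1 j) F = 0 -> tau (inr j) F = - F.
Proof.
move=> tF dF; rewrite tauE.
have P0 : Pop (inr j) F = 0 by exact: tF.
have N0 : Nop (inr j) F = 0 by exact: dF.
have e1 : Pop (inr j) (Pd (inr j) F) = F.
  have := PdP (inr j) (inr j) F; rewrite P0 op0 eqxx scale1r sg_rr scaleN1r.
  by move=> /esym/eqP; rewrite subr_eq0 => /eqP/esym.
have e2 : Pop (inr j) (Nd (inr j) F) = 0.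
  have := NdP (inr j) (inr j) F; rewrite P0 op0 sg_rr scaleN1r => /esym/eqP.
  by rewrite oppr_eq0 => /eqP.
have e3 : Nop (inr j) (Pd (inr j) F) = 0.
  have := PdN (inr j) (inr j) F; rewrite N0 op0 sg_rr scaleN1r => /esym/eqP.
  by rewrite oppr_eq0 => /eqP.
have e4 : Nop (inr j) (Nd (inr j) F) = F.
  have := NdN (inr j) (inr j) F; rewrite N0 op0 eqxx scale1r sg_rr scaleN1r.
  by move=> /esym/eqP; rewrite subr_eq0 => /eqP/esym.
rewrite /dm /pm Pop_sub Nop_sub e1 e2 e3 e4 subr0 sub0r opprK.
by rewrite opprD addrA subrr sub0r.
Qed.

Lemma tau_right j F : thr R n j * F = 0 -> dtheta (lshift m1 j) F = 0 -> tau (inr j) F = F.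
Proof.
move=> tF dF; rewrite tauE.
have P0 : Pd (inr j) F = 0 by exact: dF.
have N0 : Nd (inr j) F = 0 by exact: tF.
by rewrite /dm /pm P0 N0 subr0 !op0 !subr0.
Qed.

Lemma dtheta_Th (p : 'I_(m1 + m1)) w : p \notin w -> dtheta p (Th R n w) = 0.
Proof. by move=> pw; rewrite -[Th _ _ _]mulr1; apply: dtheta_prod => //; exact: dtheta1. Qed.

Lemma swapX_Th (w : seq 'I_(m1 + m1)) : swapX (Th R n w) = Th R n w.
Proof.
rewrite /Th; elim: w => [|p w IH].
  by rewrite big_nil; apply/ffunP => S; rewrite !ffunE; case: eqP => _; rewrite ?msym1 ?msym0.
by rewrite big_cons swapX_theta IH.
Qed.

Lemma sigJ_Th J (w : seq 'I_(m1 + m1)) : uniq J ->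
  (forall j, j \in J -> (lshift m1 j \in w) (+) (rshift m1 j \in w)) ->
  sigJ J (Th R n w) = (-1) ^+ (\sum_(j <- J) (lshift m1 j \in w))%N *: Th R n w.
Proof.
move=> uJ Jw; rewrite /sigJ.
have -> : tauJ J (Th R n w) = (-1) ^+ (\sum_(j <- J) (lshift m1 j \in w))%N *: Th R n w.
  elim: J uJ Jw => [|j J IH] /= uJ Jw; first by rewrite big_nil scale1r.
  rewrite IH ?(andP uJ).2 // => [|k kJ]; last by apply: Jw; rewrite inE kJ orbT.
  rewrite tauZ big_cons exprD; have := Jw j (mem_head _ _).
  have [jl /= jr|jl /= jr] := boolP (lshift m1 j \in w).
    rewrite tau_left ?expr1 ?mulN1r ?scalerN ?scaleNr //; first exact: theta_Th.
    exact: dtheta_Th.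
  by rewrite tau_right ?expr0 ?mul1r //; [exact: theta_Th | exact: dtheta_Th].
by rewrite linearZ /= swapX_Th.
Qed.

Lemma valid_cases (l : seq L) (w : seq 'I_(m1 + m1)) j : valid l w ->
  count_mem (inr j : L) l = ~~ ((lshift m1 j \in w) || (rshift m1 j \in w)) :> nat /\
  ~~ ((lshift m1 j \in w) && (rshift m1 j \in w)).
Proof.
move=> /(_ j) /=; have cm p : (p \in w) = (0 < count_mem p w)%N by rewrite -has_count has_pred1.
rewrite !cm.
move: (count_mem (inr j) l) (count_mem (lshift m1 j) w) (count_mem (rshift m1 j) w).
by case=> [|[|x]] [|[|y]] [|[|z]].
Qed.

Lemma sigma_vv (k l : nat) s C w : (k + l = size s)%N -> valid (lett s C) w ->
  sigma (vv R k s C w) = (-1) ^+ (size C + nleft w) *: vv R l s C w.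
Proof.
move=> kl V.
pose J := [seq j <- enum 'I_m1 | (lshift m1 j \in w) || (rshift m1 j \in w)].
have cntJ j : count_mem j J = ((lshift m1 j \in w) || (rshift m1 j \in w)).
  have uJ : uniq J by rewrite filter_uniq ?enum_uniq.
  by rewrite count_uniq_mem // [j \in J]mem_filter mem_enum andbT.
have cntE j (l' : seq L) : count_mem j (extl l' J) = (count_mem (inr j : L) l' + count_mem j J)%N.
  by elim: l' => //= -[i|i] l' IH /=; rewrite IH // addnA.
(* The letters of s and C account for all sites outside J, so [sigma] is reached from [sigJ J] by
   adding one letter at a time. *)
have pe : perm_eq (extl (lett s C) J) (enum 'I_m1).
  apply/allP => j _ /=; rewrite [X in _ == X]count_uniq_mem ?enum_uniq // mem_enum cntE cntJ.
  by rewrite (valid_cases j V).1; case: (_ || _).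
have uE : uniq (extl (lett s C) J) by rewrite (perm_uniq pe) enum_uniq.
have extl_cat l1 l2 : extl (l1 ++ l2) J = extl l1 (extl l2 J) by rewrite /extl foldr_cat.
have fTh a : a \in lett s C -> freeL a (Th R n w).
  case: a => //= j; rewrite -has_pred1 has_count (valid_cases j V).1 lt0b negb_or => /andP[jl jr].
  by split; apply: dtheta_Th.
rewrite /sigma -(sigJ_perm _ pe) // /vv PsiM -!mulrA extl_cat.
have uC : uniq (extl (flatten [seq [:: c.1; c.2] | c <- C]) J).
  by move: uE; rewrite extl_cat => /uniq_extl.
have [sC fC] := sigJ_cols uC (fun a aC => fTh a (etrans (mem_cat _ _ _) (introT orP (or_intror aC)))).
rewrite (sigJ_ee kl) -?extl_cat // => [|a aS]; last first.
  have fa : freeL a (Th R n w) by apply: fTh; rewrite mem_cat aS.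
  case: a aS fa => //= j js fj; apply: fC => //.
  apply/negP => jC; have [+ _] := valid_cases j V; rewrite /lett count_cat.
  have : (0 < count_mem (inr j : L) s)%N by rewrite -has_count has_pred1.
  have : (0 < count_mem (inr j : L) (flatten [seq [:: c.1; c.2] | c <- C]))%N.
    by rewrite -has_count has_pred1.
  by case: (~~ _); lia.
rewrite sC sigJ_Th ?(uniq_extl uC) // => [|j]; last first.
  rewrite mem_filter => /andP[jw _]; have [_] := valid_cases j V.
  by move: jw; case: (_ \in _); case: (_ \in _).
have -> : (\sum_(j <- J) (lshift m1 j \in w))%N = nleft w.
  rewrite /J big_filter big_enum_cond /nleft [RHS](bigID (fun j => (lshift m1 j \in w) || (rshift m1 j \in w))) /=.
  rewrite [X in _ = (_ + X)%N]big1 ?addn0 // => j; rewrite negb_or => /andP[/negbTE -> _] //.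
by rewrite -!scalerAr scalerA -exprD [X in _ = _ *: (X * _)]PsiM mulrA.
Qed.

End SigmaBasis.

(** * Monomials with every fermionic site accounted for *)

Section Monomials.
Variables (R : comNzRingType) (m1 n : nat).
Local Notation A := (superpoly R (n + n) (m1 + m1)).
Local Notation L := ('I_n + 'I_m1)%type.
Local Notation Psi := (@Psi R m1 n).
Local Notation uu := (@uu R m1 n).
Local Notation Th := (@Th R m1 n).
Implicit Types (F G : A) (a b : L) (c : L * L) (j : 'I_m1) (s l X Y : seq L) (w : seq 'I_(m1 + m1)).

Definition mhi X : {mpoly R[(n + n) + m1]} := \prod_(a <- X) zb R a.
Definition mlo X : {mpoly R[(n + n) + m1]} := \prod_(a <- X) zp R a.

Lemma mhi_cons a X : mhi (a :: X) = zb R a * mhi X. Proof. exact: big_cons. Qed.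
Lemma mlo_cons a X : mlo (a :: X) = zp R a * mlo X. Proof. exact: big_cons. Qed.
Lemma mhi_perm X Y : perm_eq X Y -> mhi X = mhi Y. Proof. exact: perm_big. Qed.
Lemma mlo_perm X Y : perm_eq X Y -> mlo X = mlo Y. Proof. exact: perm_big. Qed.

Lemma valid_perm l l' w : perm_eq l l' -> valid l w -> valid l' w.
Proof. by move=> /seq.permP pl V q; rewrite -pl; apply: V. Qed.

Definition monset (k : int) (v : A) : Prop := exists X Y w,
  [/\ valid (X ++ Y) w, (size X)%:Z - (size Y)%:Z = k & v = Psi (mhi X * mlo Y) * Th w].

Lemma Th_rem (p : 'I_(m1 + m1)) w : p \in w -> exists k, Th w = (-1) ^+ k *: (theta R _ p * Th (rem p w)).
Proof.
elim: w => // q w IH; rewrite inE /=; case: eqVneq => [-> _|_ /= /IH[k e]].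
  by exists 0%N; rewrite scale1r /Submission.Th big_cons.
exists k.+1; rewrite /Submission.Th !big_cons [X in _ * X]e -scalerAr exprS mulN1r scaleNr -scalerN; congr (_ *: _).
exact: thetaCA.
Qed.

Lemma Psi_uu0 j X F : inr j \in X -> uu j * F = 0 -> Psi (mhi X) * F = 0.
Proof.
move=> jX uF; rewrite (mhi_perm (perm_to_rem jX)) mhi_cons PsiM Psi_zbr.
by rewrite Psi_comm -mulrA uF mulr0.
Qed.

Lemma uu_theta p j F : p = lshift m1 j \/ p = rshift m1 j -> uu j * (theta R _ p * F) = 0.
Proof.
move=> pj; rewrite mulrA uu_comm -mulrA; case: pj => ->; rewrite /Submission.uu -[X in _ * X]mulrA.
  exact: thetathetaA.
have -> : thl R n j * (thr R n j * F) = - (thr R n j * (thl R n j * F)) by exact: thetaCA.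
by rewrite mulrN [X in - X]thetathetaA oppr0.
Qed.

(** Four states of the site j: theta_p already present, giving 0; its partner present, and the two
    merge into a high letter; a high letter, giving 0; a low letter, i.e. an empty site, replaced by
    the lone theta_p. *)
Lemma theta_site_mon p q j X Y w : (p = lshift m1 j /\ q = rshift m1 j) \/ (p = rshift m1 j /\ q = lshift m1 j) ->
  valid (X ++ Y) w ->
  lspan (monset ((size X)%:Z - (size Y)%:Z + 1)) (theta R _ p * (Psi (mhi X * mlo Y) * Th w)).
Proof.
move=> pq V; have cp : forall x, (x \in w) = (0 < count_mem x w)%N.
  by move=> x; rewrite -has_count has_pred1.
have -> : theta R _ p * (Psi (mhi X * mlo Y) * Th w) = Psi (mhi X * mlo Y) * (theta R _ p * Th w).
  by rewrite !mulrA Psi_comm.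
have [pw|pw] := boolP (p \in w).
  by rewrite theta_Th // mulr0; apply: lspan0.
have uuF F : exists k : R, theta R _ p * (theta R _ q * F) = k *: (uu j * F).
  case: pq => -[-> ->]; first by exists 1; rewrite scale1r /Submission.uu -mulrA.
  exists (- 1); rewrite scaleN1r /Submission.uu -mulrA; exact: thetaCA.
have [qw|qw] := boolP (q \in w).
  have [k ->] := Th_rem qw; have [k' e] := uuF (Th (rem q w)).
  rewrite -scalerAr e -!scalerAr; do 2!apply: lspanZ; apply: lspan_mem.
  exists (inr j :: X), Y, (rem q w); split; last by rewrite mhi_cons -mulrA [in RHS]PsiM Psi_zbr mulrA -uu_comm.
    move=> i; have := V i; have := fun x => seq.permP (perm_to_rem qw) (pred1 x).
    move=> cr; rewrite /= (cr (lshift m1 i)) (cr (rshift m1 i)) /= => Vi.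
    rewrite -Vi !count_cat; have [ji|ji] := eqVneq j i.
      subst i; case: pq => -[? ?]; subst p q; rewrite !eqxx ?eq_lrshift ?eq_rlshift; lia.
    have -> : (inr j == inr i :> L) = false by rewrite eq_inr (negbTE ji).
    by case: pq => -[? ?]; subst p q; rewrite ?eq_lshift ?eq_rshift ?eq_lrshift ?eq_rlshift (negbTE ji); lia.
  by rewrite /=; lia.
have [cj _] := valid_cases j V.
have {}cj : count_mem (inr j : L) (X ++ Y) = 1%N.
  by rewrite cj; case: pq pw qw => -[-> ->] /negbTE -> /negbTE ->.
have : inr j \in X ++ Y by rewrite -has_pred1 has_count cj.
rewrite mem_cat; have [jX _|jX /= jY] := boolP (inr j \in X).
  rewrite [mhi X * _]mulrC PsiM -mulrA (Psi_uu0 jX) ?mulr0; first exact: lspan0.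
  by apply: uu_theta; case: pq => -[-> _]; [left | right].
apply: lspan_mem; exists X, (rem (inr j) Y), (p :: w); split.
- move=> i; have := V i; rewrite !count_cat (seq.permP (perm_to_rem jY)) /=.
  have [ji|ji] := eqVneq j i.
    by subst i; case: pq => -[-> _]; rewrite !eqxx ?eq_lrshift ?eq_rlshift; lia.
  rewrite eq_inr (negbTE ji).
  by case: pq => -[-> _]; rewrite ?eq_lshift ?eq_rshift ?eq_lrshift ?eq_rlshift (negbTE ji); lia.
- rewrite size_rem //; have : (0 < size Y)%N by case: (Y) jY.
  by case: (size Y) => //= k _; lia.
- by rewrite (mlo_perm (perm_to_rem jY)) mlo_cons mul1r /Submission.Th big_cons.
Qed.

Lemma Ch_mon k F : Ch k F -> lspan (monset k) F.
Proof.
elim=> {k F} [|k|k f g _ IHf _ IHg|k c f _ IH|k j f _ IH|k q f _ IH].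
(* The unit is the product of all low fermionic letters, each equal to 1; their number yields the
   charge -m1. *)
- apply: lspan_mem; exists [::], [seq inr j | j <- enum 'I_m1], [::]; split.
  + move=> j /=; rewrite !addn0 count_map (eq_count (a2 := pred1 j)) => [|//].
    by rewrite count_uniq_mem ?enum_uniq // mem_enum.
  + by rewrite size_map size_enum_ord sub0r.
  + rewrite /mhi /mlo big_nil big_map mul1r big1 => [|//].
    by rewrite Psi1 mul1r /Submission.Th big_nil.
- exact: lspan0.
- exact: lspanD.
- exact: lspanZ.
- elim/lspan_sub: IH => {f} [|_ [X [Y [w [V e ->]]]]].
    split=> [|f g|c f]; rewrite ?mulr0 ?mulrDr -?scalerAr; first exact: lspan0.
      exact: lspanD.
    exact: lspanZ.
  apply: lspan_mem; rewrite /chg; case: (split_ordP j) => i ->.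
    exists X, (inl i :: Y), w; split; last 1 first.
    + by rewrite mlo_cons [mhi X * (_ * _)]mulrCA [in RHS]PsiM Psi_zpl mulrA.
    + by move=> q; have := V q; rewrite !count_cat.
    + by rewrite -e /=; lia.
  exists (inl i :: X), Y, w; split; last 1 first.
  + by rewrite mhi_cons -mulrA [in RHS]PsiM Psi_zbl mulrA.
  + by move=> q; have := V q; rewrite !count_cat.
  + by rewrite -e /=; lia.
- elim/lspan_sub: IH => {f} [|_ [X [Y [w [V e ->]]]]].
    split=> [|f g|c f]; rewrite ?mulr0 ?mulrDr -?scalerAr; first exact: lspan0.
      exact: lspanD.
    exact: lspanZ.
  rewrite -e; case: (split_ordP q) => j ->.
    by apply: (theta_site_mon (j := j) (q := rshift m1 j)) => //; left.
  by apply: (theta_site_mon (j := j) (q := lshift m1 j)) => //; right.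
Qed.

End Monomials.

(** * Polarization of monomials into the products e_t(s) times columns *)

Section Polarization.
Variables (R : comNzRingType) (m1 n : nat).
Hypothesis natinv : forall k : nat, exists h : R, h * k.+1%:R = 1.
Local Notation L := ('I_n + 'I_m1)%type.
Local Notation Pm := {mpoly R[(n + n) + m1]}.
Local Notation mhi := (@mhi R m1 n).
Local Notation mlo := (@mlo R m1 n).
Implicit Types (a b : L) (c : L * L) (s l X Y : seq L) (C : seq (L * L)).
Variables (T : Pm -> Prop) (val : seq L -> Prop).
Hypotheses (T0 : T 0) (TD : forall p q, T p -> T q -> T (p + q)) (TZ : forall (k : R) p, T p -> T (k *: p)).
Hypothesis val_perm : forall l l', perm_eq l l' -> val l -> val l'.
Definition cols C : Pm := \prod_(c <- C) ecol R c.
Hypothesis T_ee : forall t s C, size s = (t + t)%N -> val (lett s C) -> T (ee R t s * cols C).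

Let TB p q : T p -> T q -> T (p - q).
Proof. by move=> Tp Tq; apply: TD => //; rewrite -scaleN1r; apply: TZ. Qed.

Let M X Y C := mhi X * mlo Y * cols C.

Section Step.
Variables (t : nat) (IH : forall X Y C, size X = t -> size Y = t -> val (lett (X ++ Y) C) -> T (M X Y C)).

(** Exchanging a high with a low letter changes the monomial by a column times a monomial of smaller
    degree, which the induction hypothesis covers. *)
Lemma T_swap a b X Y C : size X = t -> size Y = t -> val (lett ([:: a, b & X ++ Y]) C) ->
  T (M (a :: X) (b :: Y) C - M (b :: X) (a :: Y) C).
Proof.
move=> sX sY V.
have -> : M (a :: X) (b :: Y) C - M (b :: X) (a :: Y) C = M X Y ((b, a) :: C).
  by rewrite /M !mhi_cons !mlo_cons /cols big_cons /ecol /=; ring.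
apply: IH => //; apply: val_perm V; rewrite /lett /=.
by apply/seq.permP => p /=; rewrite !count_cat /= ?count_cat; lia.
Qed.

(** Modulo T, only the multiset of letters matters, not which of them are high. [Z] collects the
    high letters on which both monomials already agree. *)
Lemma T_exch k : forall X X' Y Y' Z C, size X = k -> size X' = k -> (size Z + k = t.+1)%N ->
  size Y = t.+1 -> perm_eq (X ++ Y) (X' ++ Y') -> val (lett (Z ++ X ++ Y) C) ->
  T (M (Z ++ X) Y C - M (Z ++ X') Y' C).
Proof.
elim: k => [|k IHk] X X' Y Y' Z C.
  move=> /size0nil -> /size0nil -> _ _ /= pY _.
  by rewrite /M (mlo_perm _ pY) subrr.
case: X => // a X [sX] sX' sZ sY pXY V.
have MZ U a' X1 Y1 : M (U ++ a' :: X1) Y1 C = M ((a' :: U) ++ X1) Y1 C.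
  by rewrite /M (@mhi_perm _ _ _ (U ++ a' :: X1) (a' :: U ++ X1)) // -cat1s perm_catCA.
have : a \in X' ++ Y' by rewrite -(perm_mem pXY) mem_head.
rewrite mem_cat; have [aX' _|aX' /= aY'] := boolP (a \in X').
  have pX' := perm_to_rem aX'; set X1' := rem a X' in pX'.
  have -> : M (Z ++ X') Y' C = M (Z ++ a :: X1') Y' C.
    by rewrite /M (@mhi_perm _ _ _ (Z ++ X') (Z ++ a :: X1')) // perm_cat2l.
  rewrite !MZ; apply: IHk => //.
  - by have := perm_size pX'; rewrite sX' => -[].
  - by rewrite /=; lia.
  - rewrite -(perm_cons a); apply: perm_trans pXY _.
    by rewrite -cat_cons perm_cat2r.
  - by apply: val_perm V; rewrite /lett perm_cat2r; apply/seq.permP => p; rewrite !count_cat /= ?count_cat /=; lia.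
case: X' sX' pXY aX' => // a' X1' [sX1'] pXY; rewrite inE negb_or => /andP[aa' aX'].
have pY' := perm_to_rem aY'; set Y1' := rem a Y' in pY'.
have -> : M (Z ++ a' :: X1') Y' C = M (a' :: Z ++ X1') (a :: Y1') C.
  by rewrite MZ /M (@mlo_perm _ _ _ Y' (a :: Y1')).
have sY' : size Y' = t.+1.
  by have := perm_size pXY; rewrite /= !size_cat; lia.
have sY1' : size Y1' = t by have := perm_size pY'; rewrite sY' => -[].
have T1 : T (M (Z ++ a :: X) Y C - M (Z ++ a :: X1') (a' :: Y1') C).
  rewrite !MZ; apply: IHk => //.
  - by rewrite /=; lia.
  - rewrite -(perm_cons a); apply: perm_trans pXY _; apply/seq.permP => p.
    by rewrite /= !count_cat (seq.permP pY') /=; lia.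
  - by apply: val_perm V; rewrite /lett perm_cat2r; apply/seq.permP => p; rewrite !count_cat /= ?count_cat /=; lia.
have T2 : T (M (a :: Z ++ X1') (a' :: Y1') C - M (a' :: Z ++ X1') (a :: Y1') C).
  apply: T_swap => //; first by rewrite size_cat; lia.
  apply: val_perm V; rewrite /lett perm_cat2r; apply/seq.permP => p.
  have := seq.permP pXY p; rewrite /= !count_cat /= ?count_cat (seq.permP pY') /=; lia.
rewrite -[X in T X](subrKA (M (Z ++ a :: X1') (a' :: Y1') C)); apply: TD => //.
by rewrite MZ.
Qed.

(** Every monomial of e_k(s) is congruent to the same one, so only their number counts; X and Y hold
    the letters already chosen high or low, and the count follows Pascal's rule. *)
Lemma T_expand s : forall k X Y X' Y' C, (k <= size s)%N -> (size X + k = t.+1)%N ->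
  (size Y + (size s - k) = t.+1)%N -> size X' = t.+1 -> size Y' = t.+1 ->
  perm_eq (X' ++ Y') (s ++ X ++ Y) -> val (lett (X' ++ Y') C) ->
  T (ee R k s * (mhi X * mlo Y) * cols C - 'C(size s, k)%:R *: M X' Y' C).
Proof.
elim: s => [|a s IHs] k X Y X' Y' C.
  rewrite leqn0 => /eqP -> /=; rewrite ?subn0 !addn0 => sX sY sX' sY' pXY V.
  rewrite ee_nil mul1r bin0 scale1r -/(M X Y C).
  apply: (@T_exch t.+1 X X' Y Y' [::]) => //; first by rewrite perm_sym.
  by apply: val_perm V; rewrite /lett perm_cat2r.
move=> ks sX sY sX' sY' pXY V; rewrite ee_cons /= in ks sY *.
have pXY1 : perm_eq (X' ++ Y') (s ++ X ++ a :: Y).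
  apply: perm_trans pXY _; apply/seq.permP => p; rewrite /= !count_cat /= ?count_cat /=; lia.
have pXY2 : perm_eq (X' ++ Y') (s ++ (a :: X) ++ Y).
  apply: perm_trans pXY _; apply/seq.permP => p; rewrite /= !count_cat /= ?count_cat /=; lia.
case: k ks sX sY => [|k] ks sX sY.
  have := IHs 0%N X (a :: Y) X' Y' C isT sX; rewrite /= !bin0 => H.
  rewrite addr0; have := H ltac:(lia) sX' sY' pXY1 V; rewrite mlo_cons.
  by congr T; congr (_ - _); ring.
have T2 := IHs k (a :: X) Y X' Y' C ltac:(lia) ltac:(rewrite /=; lia) ltac:(lia) sX' sY' pXY2 V.
have T1 : T (ee R k.+1 s * (mhi X * mlo (a :: Y)) * cols C - 'C(size s, k.+1)%:R *: M X' Y' C).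
  have [ks'|ks'] := leqP k.+1 (size s).
    by apply: IHs => //=; lia.
  by rewrite ee_gt // bin_small // !mul0r scale0r subr0.
have := TD T1 T2; rewrite mlo_cons mhi_cons binS natrD scalerDl.
by congr T; ring.
Qed.
End Step.

Lemma T_mon t : forall X Y C, size X = t -> size Y = t -> val (lett (X ++ Y) C) -> T (M X Y C).
Proof.
elim: t => [|t IHt] X Y C sX sY V.
  move: (size0nil sX) (size0nil sY) => eX eY; subst X Y.
  have := @T_ee 0 [::] C erefl V; rewrite ee_nil /M.
  by rewrite /Submission.mhi /Submission.mlo !big_nil mulr1.
have := @T_expand t IHt (X ++ Y) t.+1 [::] [::] X Y C.
rewrite size_cat sX sY addnK => /(_ (leq_addr _ _) erefl erefl erefl erefl).
rewrite !cats0 /Submission.mhi /Submission.mlo !big_nil !mulr1 => /(_ (perm_refl _) V) T1.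
have T2 : T (ee R t.+1 (X ++ Y) * cols C) by apply: T_ee; rewrite // size_cat sX sY.
(* Subtracting from e_(t+1) its difference with the multiple of the monomial leaves that multiple;
   the binomial is then divided out. *)
have T3 : T ('C(t.+1 + t.+1, t.+1)%:R *: M X Y C).
  by have := TB T2 T1; rewrite opprB addrC addrNK.
have [h] := natinv ('C(t.+1 + t.+1, t.+1)).-1; rewrite prednK ?bin_gt0 ?leq_addr // => e.
by have := TZ h T3; rewrite scalerA e scale1r.
Qed.

End Polarization.

(** * Weights for the straightening algorithm *)

Section Weights.
Variables (m1 n : nat).
Local Notation L := ('I_n + 'I_m1)%type.
Implicit Types (a b : L) (c : L * L).
Local Open Scope nat_scope.

Definition rank a : nat := match a with inl i => i | inr j => n + j end.
Definition oriented c : bool := rank c.1 < rank c.2.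

(** The conditions of I as forbidden pairs of an unpaired letter and a column. The gap condition on
    [lls] becomes the last fermionic case: a site with no theta and no column carries an unpaired
    letter, which must not lie under an arc. *)
Definition bad1 a c : bool :=
  match a, c with
  | inl t, (inl i, inl j) => j < t
  | inl t, (inl p, inr q) => t < p
  | inl t, (inr i, inr j) => true
  | inr t, (inr i, inr j) => (i < t) && (t < j)
  | _, _ => false
  end.

Definition bad2 c c' : bool :=
  match c, c' with
  | (inl i, inl j), (inl i', inl j') => (i' < i) && (j < j')
  | (inl i, inl j), (inl p, inr q) => j < p
  | (inl p, inr q), (inl p', inr q') => (p' < p) && (q < q')
  | (inr i, inr j), (inr i', inr j') => [&& i < i', i' < j & j < j']
  | (inr i, inr j), (inl p, inr q) => j < q
  | _, _ => false
  end.

(* These weights make both terms on the right-hand side of ee_plucker and of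
   ecol_plucker smaller than the left-hand side whenever the latter has a bad pair:
   mu1_dec and mu2_dec. *)
Definition dist (i j : nat) : nat := (i - j) + (j - i).
(** Convexity makes nested bosonic columns heaviest. [wt_ff] is instead concave and increasing up to
    m1, so that crossing fermionic columns outweigh both nested and disjoint ones. *)
Definition wt_bb (i j : nat) : nat := dist i j * dist i j.
Definition wt_ff (i j : nat) : nat := dist i j * (m1 + m1 - dist i j).
(** The constant lets two mixed columns outweigh one bosonic plus one fermionic column. The linear
    terms dominate the variation of [wt_bb] and [wt_ff], and p(m1 - q) decides between the two ways
    of matching two bosons with two fermions. *)
Definition wt_bf (p q : nat) : nat :=
  (n * n + m1 * m1).+1 + p * (n + n).+1 + q * (n + m1 + m1).+1 + p * (m1 - q).
(** The constant exceeds every [wt_bf]. The slope 2n is large enough to beat differences of [wt_bb],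
    yet just below the slope of [wt_bf] in p, as required for an unpaired t < p. *)
Definition wt_b (t : nat) : nat :=
  (n * n + m1 * m1).+1 + n * (n + n).+1 + m1 * (n + m1 + m1).+1 + n * m1 + n * n + 1 + t * (n + n).

Definition mu1 a : nat := if a is inl t then wt_b t else 0.
Definition mu2 a b : nat :=
  match a, b with
  | inl i, inl j => wt_bb i j
  | inl p, inr q => wt_bf p q
  | inr q, inl p => wt_bf p q
  | inr i, inr j => wt_ff i j
  end.

Lemma wt_bbC i j : wt_bb i j = wt_bb j i.
Proof. by rewrite /wt_bb /dist addnC. Qed.
Lemma wt_ffC i j : wt_ff i j = wt_ff j i.
Proof. by rewrite /wt_ff /dist addnC. Qed.
Lemma mu2C a b : mu2 a b = mu2 b a.
Proof. by case: a b => [i|i] [j|j] //=; [apply: wt_bbC | apply: wt_ffC]. Qed.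

Lemma wt_bbE i u : wt_bb i (i + u) = u * u.
Proof. by rewrite /wt_bb /dist; congr muln; lia. Qed.
Lemma wt_ffE i u : wt_ff i (i + u) = u * (m1 + m1 - u).
Proof. by rewrite /wt_ff /dist; congr muln; lia. Qed.

Lemma ltn_ex x y : x < y -> exists u, y = x + u.+1.
Proof. by move=> xy; exists (y - x.+1); lia. Qed.

Lemma mu1_dec a c : oriented c -> bad1 a c ->
  mu1 c.1 + mu2 a c.2 < mu1 a + mu2 c.1 c.2 /\ mu1 c.2 + mu2 a c.1 < mu1 a + mu2 c.1 c.2.
Proof.
case: c => -[i|i] [j|j]; case: a => t; rewrite /oriented /bad1 /= => // ij bad.
- have ht := ltn_ord t; rewrite (wt_bbC t j) (wt_bbC t i).
  move: (nat_of_ord i) (nat_of_ord j) (nat_of_ord t) ht ij bad => {}i {}j {}t ht.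
  case/ltn_ex => u ej; case/ltn_ex => v et; subst j t.
  rewrite wt_bbE -addnA !wt_bbE /wt_b.
  by split; nia.
- have hi := ltn_ord i; have hj := ltn_ord j.
  clear ij; move: (nat_of_ord i) (nat_of_ord j) (nat_of_ord t) hi hj bad => {}i {}j {}t hi hj.
  case/ltn_ex => u ei; subst i.
  case/ltn_ex: hj => r er; have er' : m1 - j = r.+1 by lia.
  rewrite wt_bbE /wt_b /wt_bf er'.
  by split; nia.
- have ht := ltn_ord t; have hi := ltn_ord i; have hj := ltn_ord j.
  by rewrite /wt_b /wt_bf !add0n; split; nia.
- have hj := ltn_ord j.
  clear ij; move: (nat_of_ord i) (nat_of_ord j) (nat_of_ord t) hj bad => {}i {}j {}t hj.
  case/andP => /ltn_ex[u et] /ltn_ex[v ej]; subst t j.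
  rewrite !add0n (wt_ffC (i + _) i) wt_ffE wt_ffE -addnA wt_ffE.
  by split; nia.
Qed.

Lemma mu2_dec c d : oriented c -> oriented d -> bad2 c d ->
  mu2 c.1 d.1 + mu2 c.2 d.2 < mu2 c.1 c.2 + mu2 d.1 d.2 /\
  mu2 c.1 d.2 + mu2 c.2 d.1 < mu2 c.1 c.2 + mu2 d.1 d.2.
Proof.
case: c d => -[i|i] [j|j] [[p|p] [q|q]]; rewrite /oriented /bad2 /= => // ij pq bad.
- move: (nat_of_ord i) (nat_of_ord j) (nat_of_ord p) (nat_of_ord q) ij pq bad => {}i {}j {}p {}q ij _.
  case/andP => /ltn_ex[u ei] /ltn_ex[v eq]; case/ltn_ex: ij => r ej; subst.
  have -> : p + u.+1 + r.+1 + v.+1 = p + (u.+1 + r.+1 + v.+1) by lia.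
  rewrite (wt_bbC (p + u.+1) p) !wt_bbE (wt_bbC (_ + r.+1) p).
  have -> : p + (u.+1 + r.+1 + v.+1) = p + u.+1 + r.+1 + v.+1 by lia.
  rewrite wt_bbE -!addnA !wt_bbE !addnA.
  have -> : p + u.+1 + r.+1 + v.+1 = (p + u.+1) + (r.+1 + v.+1) by lia.
  rewrite wt_bbE; have uv : 0 < u.+1 * v.+1 by [].
  have ur : 0 < u.+1 * r.+1 by [].
  by split; lia.
- have hp := ltn_ord p; have hq := ltn_ord q.
  clear pq; move: (nat_of_ord i) (nat_of_ord j) (nat_of_ord p) (nat_of_ord q) hp hq ij bad => {}i {}j {}p {}q hp hq.
  case/ltn_ex=> r ej; case/ltn_ex=> s ep; subst.
  case/ltn_ex: hq => z ez; have ez' : m1 - q = z.+1 by lia.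
  have e : i + r.+1 + s.+1 = i + (r.+1 + s.+1) by lia.
  rewrite wt_bbE {1}e wt_bbE wt_bbE /wt_bf ez'.
  by split; nia.
- have hi := ltn_ord i; have hj := ltn_ord j; have hp := ltn_ord p; have hq := ltn_ord q.
  clear ij pq; move: (nat_of_ord i) (nat_of_ord j) (nat_of_ord p) (nat_of_ord q) hi hj hp hq bad => {}i {}j {}p {}q hi hj hp hq.
  case/andP => /ltn_ex[u ei] /ltn_ex[v eq]; subst.
  case/ltn_ex: hq => z ez; have ez' : m1 - (j + v.+1) = z.+1 by lia.
  have ej' : m1 - j = z.+1 + v.+1 by lia.
  rewrite (wt_bbC _ p) wt_bbE wt_ffE /wt_bf ez' ej'.
  by split; nia.
- have hi := ltn_ord i; have hj := ltn_ord j; have hp := ltn_ord p; have hq := ltn_ord q.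
  clear pq; move: (nat_of_ord i) (nat_of_ord j) (nat_of_ord p) (nat_of_ord q) hi hj hp hq ij bad => {}i {}j {}p {}q hi hj hp hq.
  rewrite ltn_add2l => /ltn_ex[u ej] /ltn_ex[v eq]; subst.
  case/ltn_ex: hq => z ez.
  have e1 : m1 - (i + u.+1 + v.+1) = z.+1 by lia.
  have e2 : m1 - (i + u.+1) = z.+1 + v.+1 by lia.
  have e3 : m1 - i = z.+1 + v.+1 + u.+1 by lia.
  have e : i + u.+1 + v.+1 = i + (u.+1 + v.+1) by lia.
  have ew : wt_ff i (i + u.+1 + v.+1) = wt_ff i (i + (u.+1 + v.+1)) by rewrite e.
  rewrite wt_ffE ew !wt_ffE.
  rewrite /wt_bf e1 e2 e3.
  have pn (x : nat) : p * x <= n * x by rewrite leq_mul2r ltnW ?orbT.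
  have sm k l : m1 + m1 = k + l -> m1 + m1 - k = l by move=> ->; rewrite addKn.
  rewrite (sm v.+1 (i + u.+1 + z.+1 + m1)); last by lia.
  rewrite (sm u.+1 (i + v.+1 + z.+1 + m1)); last by lia.
  rewrite (sm (u.+1 + v.+1) (i + z.+1 + m1)); last by lia.
  have := pn u.+1; have := pn v.+1; rewrite ez; clear.
  by split; lia.
- have hq := ltn_ord q.
  clear ij pq; move: (nat_of_ord i) (nat_of_ord j) (nat_of_ord p) (nat_of_ord q) hq bad => {}i {}j {}p {}q hq.
  case/and3P=> /ltn_ex[u ep] /ltn_ex[v ej] /ltn_ex[r eq]; subst.
  have E x k l : l = x + k -> wt_ff x l = k * (m1 + m1 - k) by move=> ->; rewrite wt_ffE.
  rewrite (E i u.+1) // (E (i + u.+1 + v.+1) r.+1) // (E i (u.+1 + v.+1)); last by lia.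
  rewrite (E (i + u.+1) (v.+1 + r.+1)); last by lia.
  rewrite (E i (u.+1 + v.+1 + r.+1)); last by lia.
  rewrite (wt_ffC _ (i + u.+1)) (E (i + u.+1) v.+1) //.
  have [z ez] : exists z, m1 = u.+1 + v.+1 + r.+1 + z by exists (m1 - (u.+1 + v.+1 + r.+1)); lia.
  have sm k l : m1 + m1 = k + l -> m1 + m1 - k = l by move=> ->; rewrite addKn.
  rewrite (sm _ (v.+1 + r.+1 + z + m1)); last by lia.
  rewrite (sm r.+1 (u.+1 + v.+1 + z + m1)); last by lia.
  rewrite (sm (u.+1 + v.+1) (r.+1 + z + m1)); last by lia.
  rewrite (sm (v.+1 + r.+1) (u.+1 + z + m1)); last by lia.
  rewrite (sm (_ + r.+1) (z + m1)); last by lia.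
  rewrite (sm v.+1 (u.+1 + r.+1 + z + m1)); last by lia.
  rewrite ez; have uv : 0 < u.+1 * r.+1 by [].
  by clear -uv; split; lia.
Qed.

End Weights.

(** * Straightening by the Pluecker relations *)

Section Straightening.
Variables (R : comNzRingType) (m1 n : nat).
Local Notation L := ('I_n + 'I_m1)%type.
Local Notation Pm := {mpoly R[(n + n) + m1]}.
Implicit Types (a b : L) (c : L * L) (s l : seq L) (C : seq (L * L)).

Definition standard s C : Prop := [/\ forall c, c \in C -> oriented c,
  forall a c, a \in s -> c \in C -> ~~ bad1 a c
  & forall c c', c \in C -> c' \in C -> ~~ bad2 c c'].

Definition weight s C : nat := (\sum_(a <- s) mu1 a + \sum_(c <- C) mu2 c.1 c.2)%N.

Definition orient c := if oriented c then c else (c.2, c.1).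

Lemma rank_inj : injective (@rank m1 n).
Proof.
move=> [i|i] [j|j] /= e; first 1 last.
- by have := ltn_ord i; rewrite e ltnNge leq_addr.
- by have := ltn_ord j; rewrite -e ltnNge leq_addr.
- by congr inr; apply: val_inj; apply/eqP; rewrite -(eqn_add2l n) e.
- by congr inl; apply: val_inj.
Qed.

Lemma orientP c : c.1 != c.2 -> oriented (orient c).
Proof.
case: c => a b; rewrite /orient /oriented /=; case: (ltngtP (rank a) (rank b)) => //= e ab.
by rewrite (rank_inj e) eqxx in ab.
Qed.

Lemma cols_orient C : exists k : R, cols R C = k *: cols R (map orient C).
Proof.
elim: C => [|c C [k e]]; first by exists 1; rewrite /cols /= !big_nil scale1r.
rewrite /cols /= !big_cons -!/(cols R _) e /orient; case: (oriented c).
  by exists k; rewrite scalerAr.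
by exists (- k); rewrite scaleNr -scalerN -mulNr /ecol /= opprB scalerAr.
Qed.

Lemma weight_orient s C : weight s (map orient C) = weight s C.
Proof.
rewrite /weight big_map; congr addn; apply: eq_bigr => c _.
by rewrite /orient; case: (oriented c) => //=; exact: mu2C.
Qed.

Lemma weight_perm s s' C C' : perm_eq s s' -> perm_eq C C' -> weight s C = weight s' C'.
Proof. by move=> ss' CC'; rewrite /weight (perm_big _ ss') (perm_big _ CC'). Qed.

Lemma lett_orient s C : perm_eq (lett s C) (lett s (map orient C)).
Proof.
rewrite /lett perm_cat2l; elim: C => //= c C IH; rewrite /orient.
case: (oriented c) => /=; first by rewrite !perm_cons.
by apply/seq.permP => p /=; rewrite (seq.permP IH) addnCA.
Qed.

Lemma lett_perm s s' C C' : perm_eq s s' -> perm_eq C C' -> perm_eq (lett s C) (lett s' C').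
Proof. by move=> ss' CC'; apply: perm_cat ss' _; apply: perm_flatten; apply: perm_map. Qed.

Lemma cols_perm C C' : perm_eq C C' -> cols R C = cols R C'.
Proof. exact: perm_big. Qed.

(** The linear relation v_a [b c] - v_b [a c] + v_c [a b] = 0 among three vectors v = (z, zb) of a
    rank 2 module, as e_t(a :: s) is linear in v_a. *)
Lemma ee_plucker t a b (c : L) s : ee R t (a :: s) * ecol R (b, c) =
  ee R t (b :: s) * ecol R (a, c) - ee R t (c :: s) * ecol R (a, b).
Proof. by rewrite !ee_cons /ecol /=; case: t => [|t]; ring. Qed.

Lemma ecol_plucker a b (c d : L) : ecol R (a, b) * ecol R (c, d) =
  ecol R (a, c) * ecol R (b, d) - ecol R (a, d) * ecol R (b, c).
Proof. by rewrite /ecol /=; ring. Qed.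

Variables (T : Pm -> Prop) (val : seq L -> Prop).
Hypotheses (T0 : T 0) (TD : forall p q, T p -> T q -> T (p + q)) (TZ : forall (k : R) p, T p -> T (k *: p)).
Hypothesis val_perm : forall l l', perm_eq l l' -> val l -> val l'.
Hypothesis T_standard : forall t s C, size s = (t + t)%N -> val (lett s C) -> standard s C ->
  T (ee R t s * cols R C).

Let TB p q : T p -> T q -> T (p - q).
Proof. by move=> Tp Tq; apply: TD => //; rewrite -scaleN1r; apply: TZ. Qed.

Lemma T_straighten t s C : size s = (t + t)%N -> val (lett s C) -> T (ee R t s * cols R C).
Proof.
have [N] := ubnP (weight s C); elim: N s C => // N IH s C.
(* A column with equal letters vanishes. The others are first oriented, at the cost of a sign and no
   change of weight, because the weight lemmas assume oriented columns. *)
have [/allP ndeg|/allPn[c cC]] := boolP (all (fun c => c.1 != c.2) C); last first.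
  rewrite negbK => /eqP e _ _ _; rewrite (cols_perm (perm_to_rem cC)) /cols big_cons.
  by rewrite {1}/ecol e subrr mul0r mulr0.
have [k ->] := cols_orient C; rewrite -scalerAr -weight_orient => wN ss /(val_perm (lett_orient s C)) V.
apply: TZ; have {ndeg}oC : all (@oriented m1 n) (map orient C).
  by apply/allP => c /mapP[c' c'C ->]; apply/orientP/ndeg.
move: (map orient C) oC wN V => {k}C /allP oC wN V.
have [/hasP[a sa /hasP[c cC bad]]|/hasPn nb1] := boolP (has (fun a => has (bad1 a) C) s).
  have ps := perm_to_rem sa; have pC := perm_to_rem cC.
  move: wN V ss (oC _ cC); rewrite (ee_perm R t ps) (cols_perm pC) (perm_size ps) (weight_perm ps pC).
  move=> wN /(val_perm (lett_perm ps pC)); move: (rem a s) (rem c C) wN => {ps pC cC sa}s' C' wN V ss oc.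
  case: c => b d in bad wN V oc *; have [/= d1 d2] := mu1_dec oc bad.
  rewrite /cols big_cons mulrA ee_plucker mulrBl -!mulrA.
  move: wN; rewrite /weight !big_cons /= => wN.
  have := IH (b :: s') ((a, d) :: C'); have := IH (d :: s') ((a, b) :: C').
  rewrite /cols !big_cons => IH1 IH2; apply: TB.
    apply: IH2 => //; first by rewrite /weight !big_cons /=; lia.
    apply: val_perm V; apply/seq.permP => p; rewrite /lett /= !count_cat /=; lia.
  apply: IH1 => //; first by rewrite /weight !big_cons /=; lia.
  apply: val_perm V; apply/seq.permP => p; rewrite /lett /= !count_cat /=; lia.
have [/hasP[c cC /hasP[c' c'C bad]]|/hasPn nb2] := boolP (has (fun c => has (bad2 c) C) C).
  have cc' : c' != c.
    apply: contraTneq bad => ->; case: (c) => -[i|i] [j|j] /=; rewrite ?ltnn //.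
    have pC : perm_eq C (c :: c' :: rem c' (rem c C)).
    rewrite (perm_trans (perm_to_rem cC)) // perm_cons perm_to_rem //.
    by move: c'C; rewrite (perm_mem (perm_to_rem cC)) inE (negbTE cc').
  move: wN V ss (oC _ cC) (oC _ c'C); rewrite (cols_perm pC) (weight_perm (perm_refl s) pC).
  move=> wN /(val_perm (lett_perm (perm_refl s) pC)).
  move: (rem _ _) wN => {cC c'C pC cc'}C' wN V ss oc oc'.
  case: c c' => [a b] [x y] in bad wN V oc oc' *; have [/= d1 d2] := mu2_dec oc oc' bad.
  rewrite /cols !big_cons (mulrA (ecol _ _)) ecol_plucker mulrBl -!(mulrA (ecol _ _)) mulrBr.
  move: wN; rewrite /weight !big_cons /= => wN.
  have := IH s ((a, x) :: (b, y) :: C'); have := IH s ((a, y) :: (b, x) :: C').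
  rewrite /cols !big_cons => IH1 IH2; apply: TB.
    apply: IH2 => //; first by rewrite /weight !big_cons /=; lia.
    apply: val_perm V; apply/seq.permP => p; rewrite /lett /= !count_cat /=; lia.
  apply: IH1 => //; first by rewrite /weight !big_cons /=; lia.
  apply: val_perm V; apply/seq.permP => p; rewrite /lett /= !count_cat /=; lia.
apply: T_standard => //; split=> //.
- by move=> a c /nb1/hasPn; apply.
- by move=> c c' /nb2/hasPn; apply.
Qed.

End Straightening.

(** * Dictionary between index data and lists of letters *)

Section Matching.
Variables (R : comNzRingType) (m1 n : nat).
Local Notation A := (superpoly R (n + n) (m1 + m1)).
Local Notation L := ('I_n + 'I_m1)%type.
Local Notation Pm := {mpoly R[(n + n) + m1]}.
Local Notation Psi := (@Psi R m1 n).
Local Notation Th := (@Th R m1 n).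
Implicit Types (a b : L) (c : L * L) (s l : seq L) (C : seq (L * L)) (w : seq 'I_(m1 + m1)).
Implicit Types (d : index_data m1 n).

Lemma Th_perm w w' : perm_eq w w' -> exists k, Th w = (-1) ^+ k *: Th w'.
Proof.
elim: w w' => [|p w IH] w'.
  by rewrite perm_sym => /perm_nilP ->; exists 0%N; rewrite scale1r.
move=> pw; have pw' : p \in w' by rewrite -(perm_mem pw) mem_head.
have [k ek] := @Th_rem R m1 n _ _ pw'.
have [|k' ek'] := IH (rem p w').
  by rewrite -(perm_cons p); apply: perm_trans pw _; exact: perm_to_rem.
exists (k' + k)%N; rewrite ek scalerA exprD -mulrA -expr2 sqrr_sign mulr1.
by rewrite /Submission.Th big_cons [X in _ * X]ek' scalerAr.
Qed.

Lemma prod_count (S : comNzRingType) (I : finType) (F : I -> S) (r : seq I) :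
  \prod_(x <- r) F x = \prod_x F x ^+ count_mem x r.
Proof.
elim: r => [|x r IH]; first by rewrite big_nil big1.
rewrite big_cons IH (bigD1 x) //= [RHS](bigD1 x) //= eqxx exprS mulrA; congr (_ * _).
by apply: eq_bigr => y /negbTE yx; rewrite eq_sym yx.
Qed.

Lemma prod_pairs (S : comNzRingType) (F : L * L -> S) (C : seq (L * L)) :
  (forall c, c \in C -> oriented c) -> \prod_(c <- C) F c =
  (\prod_(i < n) \prod_(j < n | (i < j)%N) F (inl i, inl j) ^+ count_mem (inl i, inl j) C) *
  (\prod_(i < m1) \prod_(j < m1 | (i < j)%N) F (inr i, inr j) ^+ count_mem (inr i, inr j) C) *
  (\prod_(p < n) \prod_(q < m1) F (inl p, inr q) ^+ count_mem (inl p, inr q) C).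
Proof.
move=> oC; have c0 c : ~~ oriented c -> F c ^+ count_mem c C = 1.
  by move=> nc; rewrite (_ : count_mem c C = 0%N) //; apply/count_memPn; apply: contra nc; exact: oC.
rewrite prod_count (eq_bigr (fun c => F (c.1, c.2) ^+ count_mem (c.1, c.2) C)) => [|[] //].
rewrite -(pair_bigA _ (fun a b => F (a, b) ^+ count_mem (a, b) C)) /= big_sumType /=.
rewrite (eq_bigr (fun i : 'I_n => (\prod_(j < n | (i < j)%N) F (inl i, inl j) ^+ count_mem (inl i, inl j) C) *
   \prod_(q < m1) F (inl i, inr q) ^+ count_mem (inl i, inr q) C)) => [|i _]; last first.
  rewrite big_sumType /=; congr (_ * _); rewrite (bigID (fun j : 'I_n => (i < j)%N)) /= [X in _ * X]big1 ?mulr1 // => j ij.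
  exact: c0.
rewrite big_split /= mulrAC; congr (_ * _ * _).
apply: eq_bigr => i _; rewrite big_sumType /= big1 ?mul1r => [|j _]; last first.
  by apply: c0; rewrite /oriented /= -leqNgt ltnW // (leq_trans (ltn_ord j)) // leq_addr.
rewrite (bigID (fun j : 'I_m1 => (i < j)%N)) /= [X in _ * X]big1 ?mulr1 // => j ij.
by apply: c0; rewrite /oriented /= ltn_add2l.
Qed.

(** The fermionic letters of s are left open, since d does not mention them and their z is 1.
    [valid] fixes them: they are the sites that nothing else occupies. *)
Definition lists_of d s C w : Prop :=
  [/\ (forall c, c \in C -> oriented c),
      (forall t, ks d t = count_mem (inl t) s), (forall p, ls d p = count_mem p w :> nat) &
      [/\ forall i j : 'I_n, (i < j)%N -> kks d i j = count_mem (inl i, inl j) C,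
          forall i j : 'I_m1, (i < j)%N -> lls d i j = count_mem (inr i, inr j) C :> nat
        & forall p q, ss d p q = count_mem (inl p, inr q) C :> nat]].

Definition matches d s C w : Prop := valid (lett s C) w /\ lists_of d s C w.

Lemma Psi_prod (I : Type) (r : seq I) (P : pred I) (F : I -> Pm) :
  Psi (\prod_(i <- r | P i) F i) = \prod_(i <- r | P i) Psi (F i).
Proof. by apply: (big_morph _ _ (@Psi1 R m1 n)); exact: PsiM. Qed.

Lemma Psi_exp p k : Psi (p ^+ k) = Psi p ^+ k.
Proof. by elim: k => [|k IH]; rewrite ?expr0 ?Psi1 // !exprS PsiM IH. Qed.

Lemma Th_cat w w' : Th (w ++ w') = Th w * Th w'.
Proof. exact: big_cat. Qed.

Lemma Th_flatten (I : Type) (r : seq I) (F : I -> seq 'I_(m1 + m1)) :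
  Th (flatten [seq F i | i <- r]) = \prod_(i <- r) Th (F i).
Proof.
elim: r => [|i r IH]; first by rewrite big_nil /Submission.Th big_nil.
by rewrite big_cons [LHS]Th_cat IH.
Qed.

Definition psgn (F : A) p := exists k, F = (-1) ^+ k *: Psi p.

Lemma psgn1 : psgn 1 1.
Proof. by exists 0%N; rewrite scale1r Psi1. Qed.

Lemma psgnM F G p q : psgn F p -> psgn G q -> psgn (F * G) (p * q).
Proof.
move=> [k ->] [l ->]; exists (k + l)%N.
by rewrite -scalerAr -scalerAl scalerA PsiM exprD mulrC.
Qed.

Lemma psgn_exp F p k : psgn F p -> psgn (F ^+ k) (p ^+ k).
Proof.
by move=> Fp; elim: k => [|k IH]; rewrite ?exprS; [apply: psgn1 | apply: psgnM].
Qed.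

Lemma psgn_prod (I : finType) (P : pred I) (F : I -> A) (G : I -> Pm) :
  (forall i, P i -> psgn (F i) (G i)) -> psgn (\prod_(i | P i) F i) (\prod_(i | P i) G i).
Proof. by move=> FG; elim/big_ind2: _; [apply: psgn1 | move=> *; apply: psgnM|]. Qed.

Lemma hvec_vv d s C w : matches d s C w -> exists k, hvec R d = (-1) ^+ k *: vv R 0 s C w.
Proof.
case=> V [oC ek el [ekk ell es]]; rewrite /vv ee0 prod_count big_sumType /=.
(* Unpaired fermionic letters are invisible in e_0(s). *)
rewrite [X in _ * X * _]big1 ?mulr1 => [|j _]; last by rewrite expr1n.
have eK : \prod_(t < n) xl R m1 t ^+ ks d t = Psi (\prod_(t < n) 'X_(lshift m1 (lshift n t)) ^+ count_mem (inl t) s).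
  by rewrite Psi_prod; apply: eq_bigr => t _; rewrite Psi_exp ek -Psi_zpl.
have eKK : \prod_(i < n) \prod_(j < n | (i < j)%N) (xl R m1 i * xr R m1 j - xl R m1 j * xr R m1 i) ^+ kks d i j =
    Psi (\prod_(i < n) \prod_(j < n | (i < j)%N) ecol R (inl i, inl j) ^+ count_mem (inl i, inl j) C).
  rewrite Psi_prod; apply: eq_bigr => i _; rewrite Psi_prod; apply: eq_bigr => j ij.
  by rewrite Psi_exp ekk // PsiB !PsiM !Psi_zpl !Psi_zbl.
have eLL : psgn (\prod_(i < m1) \prod_(j < m1 | (i < j)%N) (thl R n i * thr R n i - thl R n j * thr R n j) ^+ lls d i j)
    (\prod_(i < m1) \prod_(j < m1 | (i < j)%N) ecol R (inr i, inr j) ^+ count_mem (inr i, inr j) C).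
  apply: psgn_prod => i _; apply: psgn_prod => j ij; rewrite ell //; apply/psgn_exp.
  by exists 1%N; rewrite expr1 scaleN1r PsiB !PsiM !Psi_zpr !Psi_zbr !mul1r opprB.
have eS : psgn (\prod_(p < n) \prod_(q < m1) (xr R m1 p - xl R m1 p * thl R n q * thr R n q) ^+ ss d p q)
    (\prod_(p < n) \prod_(q < m1) ecol R (inl p, inr q) ^+ count_mem (inl p, inr q) C).
  apply: psgn_prod => p _; apply: psgn_prod => q _; rewrite es; apply/psgn_exp.
  exists 1%N; rewrite expr1 scaleN1r PsiB !PsiM Psi_zpr Psi_zbr Psi_zbl Psi_zpl mul1r opprB.
  by rewrite -mulrA.
have [kt et] : exists k, \prod_(j < m1) (thl R n j ^+ ls d (lshift m1 j) * thr R n j ^+ ls d (rshift m1 j)) = (-1) ^+ k *: Th w.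
  pose G j := nseq (ls d (lshift m1 j)) (lshift m1 j) ++ nseq (ls d (rshift m1 j)) (rshift m1 j).
  have -> : \prod_(j < m1) (thl R n j ^+ ls d (lshift m1 j) * thr R n j ^+ ls d (rshift m1 j)) =
      Th (flatten [seq G j | j <- index_enum 'I_m1]).
    rewrite Th_flatten; apply: eq_bigr => j _; rewrite Th_cat /Submission.Th.
    by congr (_ * _); case: (ls d _); rewrite /= ?big_cons big_nil ?mulr1.
  apply: Th_perm; apply/allP => p _ /=; apply/eqP; rewrite -el count_flatten sumnE !big_map.
  have cG j : count_mem p (G j) = ((lshift m1 j == p) * ls d p + (rshift m1 j == p) * ls d p)%N.
    by rewrite count_cat !count_nseq /=; do 2![case: eqP => [->|_] //=].
  rewrite (eq_bigr _ (fun j _ => cG j)); case: (split_ordP p) => j ->.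
    rewrite (bigD1 j) //= eqxx eq_rlshift big1 => [|i /negbTE ij]; first by rewrite addn0 mul1n addn0.
    by rewrite eq_lshift ij eq_rlshift.
  rewrite (bigD1 j) //= eqxx eq_lrshift big1 => [|i /negbTE ij]; first by rewrite addn0 mul1n.
  by rewrite eq_rshift ij eq_lrshift.
move: eLL eS => [kL eL] [kS eS].
exists (kt + kL + kS)%N; rewrite /hvec eK eKK et eL eS prod_pairs // !PsiM.
set P1 := Psi _; set P2 := Psi _; set P3 := Psi _; set P4 := Psi _.
rewrite -!scalerAr -!scalerAl !scalerA -!exprD; congr (_ *: _); first by congr (_ ^+ _); lia.
rewrite -!mulrA; congr (_ * (_ * _)); rewrite mulrA [Th w * P3](_ : _ = P3 * Th w); last exact: Psi_comm.
by rewrite -mulrA [Th w * P4](_ : _ = P4 * Th w) //; exact: Psi_comm.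
Qed.

Definition ccnt a b C : nat := count_mem (a, b) C.

Lemma count_lett a s C : count_mem a (lett s C) =
  (count_mem a s + (\sum_b ccnt a b C + \sum_b ccnt b a C))%N.
Proof.
rewrite /lett /ccnt count_cat; congr addn; elim: C => [|c C IH] /=; first by rewrite !big1.
rewrite IH !big_split /= addnACA addnA; congr addn; congr addn.
  rewrite (bigD1 c.2) //= big1 => [|b /negbTE bc]; first by rewrite -pair_eqE /= eqxx andbT addn0.
  by rewrite -pair_eqE /= [c.2 == b]eq_sym bc andbF.
rewrite (bigD1 c.1) //= big1 => [|b /negbTE bc]; first by rewrite -pair_eqE /= eqxx addn0.
by rewrite -pair_eqE /= [c.1 == b]eq_sym bc.
Qed.

Lemma count0 (I : eqType) (r : seq I) (P : pred I) x : (forall y, y \in r -> P y) -> ~~ P x -> count_mem x r = 0%N.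
Proof. by move=> rP nP; apply/count_memPn; apply: contra nP; apply: rP. Qed.

Definition left_deg d (t : 'I_m1) : nat := (\sum_(j < m1 | (t < j)%N) lls d t j)%N.
Definition right_deg d (t : 'I_m1) : nat := (\sum_(i < m1 | (i < t)%N) lls d i t)%N.

Lemma lists_left d s C w t : lists_of d s C w -> (\sum_b ccnt (inr t) b C = left_deg d t)%N.
Proof.
case=> oC _ _ [_ ell es]; rewrite big_sumType /= big1 => [|i _]; last first.
  by apply: (count0 oC); rewrite /oriented /= -leqNgt ltnW // (leq_trans (ltn_ord i)) // leq_addr.
rewrite add0n /left_deg [RHS]big_mkcond; apply: eq_bigr => j _; case: ifP => [/ell -> //|ij].
by apply: (count0 oC); rewrite /oriented /= ltn_add2l ij.
Qed.

Lemma lists_right d s C w t : lists_of d s C w -> (\sum_b ccnt b (inr t) C = s_deg d t + right_deg d t)%N.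
Proof.
case=> oC _ _ [_ ell es]; rewrite big_sumType /=; congr addn.
  by apply: eq_bigr => p _; rewrite es.
rewrite /right_deg [RHS]big_mkcond; apply: eq_bigr => j _; case: ifP => [/ell -> //|ij].
by apply: (count0 oC); rewrite /oriented /= ltn_add2l ij.
Qed.

Lemma matches_site d s C w t : matches d s C w ->
  (count_mem (inr t) s + (left_deg d t + (s_deg d t + right_deg d t)) + ls d (lshift m1 t) + ls d (rshift m1 t) = 1)%N.
Proof.
case=> V M; have [_ _ el _] := M.
by have := V t; rewrite !el count_lett (lists_left _ M) (lists_right _ M).
Qed.

Lemma bool_count (x : nat) : (x <= 1)%N -> ((0 < x)%N : nat) = x.
Proof. by case: x => [|[]]. Qed.

Lemma matches_exists s C w : valid (lett s C) w -> (forall c, c \in C -> oriented c) ->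
  exists d, matches d s C w.
Proof.
move=> V oC.
have cC a q : (ccnt a (inr q) C <= 1)%N.
  have := V q; rewrite count_lett => e.
  have : (ccnt a (inr q) C <= \sum_b ccnt b (inr q) C)%N by rewrite (bigD1 a) //= leq_addr.
  move/leq_trans; apply; rewrite -e; do 2!apply: leq_trans (leq_addr _ _).
  by apply: leq_trans (leq_addl _ _); exact: leq_addl.
have cw p : (count_mem p w <= 1)%N.
  by case: (split_ordP p) => q ->; have := V q; lia.
exists (IndexData (fun t => count_mem (inl t) s) (fun i j => count_mem (inl i, inl j) C)
  (fun p => 0 < count_mem p w)%N (fun i j => 0 < count_mem (inr i, inr j) C)%N
  (fun p q => 0 < count_mem (inl p, inr q) C)%N).
split=> //; split=> //= [p|]; first exact: bool_count.
by split=> // *; exact/bool_count/cC.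
Qed.

Lemma muln0_pos (x y : nat) : (0 < x -> 0 < y -> False)%N -> (x * y = 0)%N.
Proof. by case: x y => [|x] [|y] // h; rewrite ?muln0 //; case: h. Qed.

Lemma standard_in_I d s C w : matches d s C w -> standard s C -> in_I d.
Proof.
move=> M [_ nb1 nb2]; have site t := matches_site t M; have [V [oC ek el [ekk ell es]]] := M.
have mem (I : eqType) (r : seq I) x : (0 < count_mem x r)%N -> x \in r by rewrite -has_count has_pred1.
split.
- by move=> t; have := site t; rewrite /ll_deg -/(left_deg d t) -/(right_deg d t); lia.
- move=> i j t ij jt; apply: muln0_pos; rewrite ekk // ek => /mem c /mem a.
  by have := nb1 _ _ a c; rewrite /= jt.
- move=> i j i' j' ij ij' ii jj; apply: muln0_pos; rewrite !ekk // => /mem c /mem c'.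
  by have := nb2 _ _ c c'; rewrite /= ii jj.
- move=> t i j ij; apply: muln0_pos; rewrite ell // ek => /mem a /mem c.
  by have := nb1 _ _ a c.
- move=> t p q tp; apply: muln0_pos; rewrite es // ek => /mem a /mem c.
  by have := nb1 _ _ a c; rewrite /= tp.
- move=> i j p q ij jp; apply: muln0_pos; rewrite es // ekk // => /mem c /mem c'.
  by have := nb2 _ _ c c'; rewrite /= jp.
- move=> p p' q q' pp qq; apply: muln0_pos; rewrite !es // => /mem c /mem c'.
  by have := nb2 _ _ c c'; rewrite /= pp qq.
- move=> i t j it tj l0 r0 s0; rewrite /ll_deg -/(left_deg d t) -/(right_deg d t) => d0.
  (* The site equation forces an unpaired letter wherever the gap condition finds nothing else. *)
  have /mem a : (0 < count_mem (inr t) s)%N.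
    by have := site t; rewrite l0 r0 s0 !addn0 add0n [(left_deg d t + _)%N]addnC d0 addn0 => ->.
  rewrite ell ?(ltn_trans it) //; apply/eqP; rewrite -leqn0 leqNgt; apply/negP => /mem c.
  by have := nb1 _ _ a c; rewrite /= it tj.
- move=> i j i' j' ii ij jj; apply: muln0_pos; rewrite (ell i j) ?(ltn_trans ii ij) // (ell i' j') ?(ltn_trans ij jj) // => /mem c /mem c'.
  by have := nb2 _ _ c c'; rewrite /= ii ij jj.
- move=> i j q p ij jq; apply: muln0_pos; rewrite es // ell // => /mem c /mem c'.
  by have := nb2 _ _ c c'; rewrite /= jq.
Qed.

Lemma count_flatten_nseq (I : finType) (e : I -> nat) x :
  count_mem x (flatten [seq nseq (e y) y | y <- index_enum I]) = e x.
Proof.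
rewrite count_flatten sumnE !big_map (bigD1 x) //= big1 => [|y /negbTE yx].
  by rewrite count_nseq /= eqxx mul1n addn0.
by rewrite count_nseq /= yx.
Qed.

Lemma in_I_matches d : in_I d -> exists s C w, matches d s C w.
Proof.
move=> Id.
(* Truncated subtraction is harmless here: [I_deg] bounds the subtracted sum by 1. *)
pose free t := (1 - (left_deg d t + (s_deg d t + right_deg d t) + ls d (lshift m1 t) + ls d (rshift m1 t)))%N.
pose s := flatten [seq nseq (match a with inl t => ks d t | inr t => free t end) a | a <- index_enum (L : finType)].
pose mult c : nat := match c with (inl i, inl j) => if (i < j)%N then kks d i j else 0%N
  | (inr i, inr j) => if (i < j)%N then nat_of_bool (lls d i j) else 0%N
  | (inl p, inr q) => ss d p q | _ => 0%N end.
pose C := flatten [seq nseq (mult c) c | c <- index_enum ((L * L)%type : finType)].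
pose w := flatten [seq nseq (ls d p) p | p <- index_enum 'I_(m1 + m1)].
exists s, C, w.
have cs a : count_mem a s = match a with inl t => ks d t | inr t => free t end.
  exact: count_flatten_nseq.
have cC c : count_mem c C = mult c by exact: count_flatten_nseq.
have cw p : count_mem p w = ls d p :> nat by exact: count_flatten_nseq.
have oC c : c \in C -> oriented c.
  rewrite -has_pred1 has_count cC; case: c => -[i|i] [j|j] //=; rewrite /oriented /= ?ltn_add2l.
  - by case: (ltnP i j).
  - by rewrite (leq_trans (ltn_ord i)) ?leq_addr.
  - by case: (ltnP i j).
have M : lists_of d s C w.
  split=> //.
  by split=> [i j ij|i j ij|p q]; rewrite cC /= ?ij.
split=> // t; rewrite count_lett (lists_left _ M) (lists_right _ M) cs /free !cw.
have := I_deg Id t; rewrite /ll_deg -/(left_deg d t) -/(right_deg d t) => h.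
move: (left_deg d t) (right_deg d t) (s_deg d t) (ls d _ : nat) (ls d _ : nat) h => *.
lia.
Qed.

Lemma sum_count (I : finType) (f : I -> nat) (r : seq I) :
  (\sum_(x <- r) f x = \sum_x f x * count_mem x r)%N.
Proof.
elim: r => [|x r IH]; first by rewrite big_nil big1 // => x _; rewrite muln0.
rewrite big_cons IH (bigD1 x) //= [RHS](bigD1 x) //= eqxx mulnDr muln1 addnA; congr addn.
by apply: eq_bigr => y /negbTE yx; rewrite eq_sym yx.
Qed.

Lemma size_count (I : finType) (r : seq I) : size r = (\sum_x count_mem x r)%N.
Proof. by rewrite -sum1_size sum_count; apply: eq_bigr => x _; rewrite mul1n. Qed.

Lemma lists_left_boson d s C w i : lists_of d s C w ->
  (\sum_b ccnt (inl i) b C = \sum_(j < n | i < j) kks d i j + \sum_(q < m1) ss d i q)%N.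
Proof.
case=> oC _ _ [ekk _ es]; rewrite big_sumType /=; congr addn; last by apply: eq_bigr => q _; rewrite es.
rewrite [RHS]big_mkcond; apply: eq_bigr => j _; case: ifP => [/ekk -> //|ij].
by apply: (count0 oC); rewrite /oriented /= ij.
Qed.

Lemma lists_size d s C w : lists_of d s C w ->
  [/\ size C = (sum_kk d + sum_s d + sum_ll d)%N, nleft w = (\sum_(j < m1) ls d (lshift m1 j))%N &
    (size s = sum_k d + \sum_(t < m1) count_mem (inr t) s)%N].
Proof.
move=> M; have [_ ek el _] := M; split.
- rewrite size_count (eq_bigr (fun c => ccnt c.1 c.2 C)) => [|[] //].
  rewrite -(pair_bigA _ (fun a b => ccnt a b C)) big_sumType /=; congr addn.
    rewrite -big_split; apply: eq_bigr => i _; exact: lists_left_boson M.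
  by apply: eq_bigr => t _; exact: lists_left M.
- apply: eq_bigr => j _; rewrite -has_pred1 has_count -el.
  by case: (ls _ _).
- rewrite size_count big_sumType /=; congr addn.
  by apply: eq_bigr => t _; rewrite ek.
Qed.

Lemma sum_right_deg d : (\sum_t right_deg d t = sum_ll d)%N.
Proof.
rewrite /right_deg /sum_ll; under eq_bigr do rewrite big_mkcond.
rewrite exchange_big; apply: eq_bigr => i _; rewrite [RHS]big_mkcond.
exact: eq_bigr.
Qed.

Lemma matches_total d s C w : matches d s C w ->
  (\sum_(t < m1) count_mem (inr t) s + (sum_ll d + (sum_s d + sum_ll d)) +
   \sum_(j < m1) ls d (lshift m1 j) + \sum_(j < m1) ls d (rshift m1 j) = m1)%N.
Proof.
move=> M; rewrite -[RHS]card_ord -sum1_card -(eq_bigr _ (fun t _ => matches_site t M)).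
rewrite !big_split /= sum_right_deg; congr (_ + (_ + (_ + _)) + _ + _)%N.
by rewrite /sum_s exchange_big.
Qed.

(** After summing the site equations over all sites, the two numerical conditions of B_(t,q) say
    that |s| = 2t and that q counts the columns and the lone left thetas. *)
Lemma matches_B d s C w t q : matches d s C w -> in_I d ->
  size s = (t + t)%N -> q = (size C + nleft w)%N -> B_set t q (hvec R d).
Proof.
move=> M Id st ->; exists d; have [sC nw sk] := lists_size M.2; have := matches_total M.
move: sC nw sk; rewrite st => -> -> e1 e2; split=> //; first by lia.
by lia.
Qed.

Lemma B_matches t q v : B_set t q v -> exists d s C w,
  [/\ in_I d, matches d s C w, size s = (t + t)%N, q = (size C + nleft w)%N & v = hvec R d].
Proof.
move=> [d [Id e1 e2 ->]]; have [s [C [w M]]] := in_I_matches Id.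
exists d, s, C, w; have [sC nw sk] := lists_size M.2; have := matches_total M.
split=> //; last by rewrite sC nw; lia.
by lia.
Qed.
End Matching.

(** * Spanning of A'_(m1) *)

Section Spanning.
Variables (R : comNzRingType) (m1 n : nat).
Hypothesis natinv : forall k : nat, exists h : R, h * k.+1%:R = 1.
Local Notation L := ('I_n + 'I_m1)%type.
Local Notation Pm := {mpoly R[(n + n) + m1]}.
Local Notation Psi := (@Psi R m1 n).
Local Notation Th := (@Th R m1 n).
Implicit Types (s l : seq L) (C : seq (L * L)) (w : seq 'I_(m1 + m1)) (d : index_data m1 n).

Lemma iter_eta_hvec t d s C w : matches d s C w ->
  exists k, iter t (@eta R m1 n) (hvec R d) = (-1) ^+ k * t`!%:R *: vv R t s C w.
Proof.
move=> M; have [k ->] := hvec_vv R M; exists k.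
by rewrite iter_etaZ (iter_eta_vv _ _ M.1) scalerA.
Qed.

Lemma span_vv t s C w : size s = (t + t)%N -> valid (lett s C) w -> standard s C ->
  lspan (@eta_B R m1 n (fun _ => True)) (vv R t s C w).
Proof.
move=> st V sC; have [oC _ _] := sC; have [d M] := matches_exists V oC.
have [k e] := iter_eta_hvec t M.
have [h et] : exists h : R, h * t`!%:R = 1 by have := natinv t`!.-1; rewrite prednK ?fact_gt0.
have -> : vv R t s C w = (h * (-1) ^+ k) *: iter t (@eta R m1 n) (hvec R d).
  by rewrite e scalerA mulrA -(mulrA h) -expr2 sqrr_sign mulr1 et scale1r.
apply/lspanZ/lspan_mem; exists t, (size C + nleft w)%N, (hvec R d); split=> //.
exact: matches_B M (standard_in_I M sC) st _.
Qed.

Lemma span_eta_B F : Ch 0 F -> lspan (@eta_B R m1 n (fun _ => True)) F.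
Proof.
move=> /(Ch_mon (k := 0)); apply: lspan_min; [exact: lspan0 | exact: lspanD | exact: lspanZ |].
move=> _ [X [Y [w [V e ->]]]].
(* The theta word stays fixed, so polarization and straightening take place among commutative
   polynomials. *)
pose T (p : Pm) := lspan (@eta_B R m1 n (fun _ => True)) (Psi p * Th w).
have T0 : T 0 by rewrite /T Psi0 mul0r; exact: lspan0.
have TD p q : T p -> T q -> T (p + q) by rewrite /T PsiD mulrDl; exact: lspanD.
have TZ (k : R) p : T p -> T (k *: p) by rewrite /T PsiZ -scalerAl; exact: lspanZ.
have val_perm l l' : perm_eq l l' -> valid l w -> valid l' w by exact: valid_perm.
have T_std t s C : size s = (t + t)%N -> valid (lett s C) w -> standard s C -> T (ee R t s * cols R C).
  exact: span_vv.
have T_ee := T_straighten T0 TD TZ val_perm T_std.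
have := T_mon natinv T0 TD TZ val_perm T_ee (X := X) (Y := Y) (C := [::]) (t := size X) erefl.
rewrite /cols big_nil mulr1; apply; first by lia.
by rewrite /lett cats0.
Qed.

End Spanning.

(** * Nonnegative matrices determined by their margins *)

Section Chains.
Local Open Scope nat_scope.

Definition chain (a b : nat) (M : 'I_a -> 'I_b -> nat) : Prop :=
  forall (i : 'I_a) (j : 'I_b) (i' : 'I_a) (j' : 'I_b), i' < i -> j < j' -> M i j * M i' j' = 0.

Lemma sum_eq_gt (I : finType) (f g : I -> nat) x :
  \sum_i f i = \sum_i g i -> f x < g x -> exists y, g y < f y.
Proof.
move=> fg lt_x; have [/existsP //|/existsPn le_fg] := boolP [exists y, g y < f y].
suff : \sum_i f i < \sum_i g i by rewrite fg ltnn.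
rewrite (bigD1 x) //= [X in _ < X](bigD1 x) //= -addSn leq_add // leq_sum // => i _.
by rewrite leqNgt.
Qed.

(** The uniqueness behind the north-west corner rule. At the first differing entry, the matrix with
    the smaller value must compensate further along the row and further down the column; these two
    positive entries violate the chain condition. *)
Lemma chain_unique (a b : nat) (M M' : 'I_a -> 'I_b -> nat) : chain M -> chain M' ->
  (forall i, \sum_j M i j = \sum_j M' i j) -> (forall j, \sum_i M i j = \sum_i M' i j) ->
  forall i j, M i j = M' i j.
Proof.
have main (N N' : 'I_a -> 'I_b -> nat) (i : 'I_a) (j : 'I_b) : chain N ->
    (forall i, \sum_j N i j = \sum_j N' i j) -> (forall j, \sum_i N i j = \sum_i N' i j) ->
    (forall i' : 'I_a, i' < i -> N i' j = N' i' j) -> (forall j' : 'I_b, j' < j -> N i j' = N' i j') ->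
    N i j < N' i j -> False.
  move=> cN eR eC lt_i lt_j ij.
  have [j' hj] := sum_eq_gt (eR i) ij; have [i' hi] := sum_eq_gt (eC j) ij.
  have jj : j < j'.
    rewrite ltnNge leq_eqVlt; apply/negP => /orP[/eqP/val_inj e|/lt_j e].
      by rewrite e in hj; lia.
    by rewrite e ltnn in hj.
  have ii : i < i'.
    rewrite ltnNge leq_eqVlt; apply/negP => /orP[/eqP/val_inj e|/lt_i e].
      by rewrite e in hi; lia.
    by rewrite e ltnn in hi.
  by have := cN i' j i j' ii jj; nia.
move=> cM cM' eR eC.
suff H k' (i : 'I_a) (j : 'I_b) : i * b + j < k' -> M i j = M' i j.
  by move=> i j; apply: (H (i * b + j).+1).
elim: k' i j => // k' IH i j; rewrite ltnS => ij.
have lt1 (i' : 'I_a) : i' < i -> M i' j = M' i' j.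
  by move=> lt_i; apply: IH; apply: leq_trans ij; rewrite ltn_add2r ltn_mul2r lt_i (leq_ltn_trans _ (ltn_ord j)).
have lt2 (j' : 'I_b) : j' < j -> M i j' = M' i j'.
  by move=> lt_j; apply: IH; apply: leq_trans ij; rewrite ltn_add2l.
case: (ltngtP (M i j) (M' i j)) => // h.
  by case: (main M M' i j).
by case: (main M' M i j) => // *; rewrite ?lt1 ?lt2.
Qed.

End Chains.

(** * Recovering index data from the leading monomial *)

Section Decoding.
Variables (m1 n : nat).
Implicit Types (d : index_data m1 n).
Local Open Scope nat_scope.

Definition Xdeg d (i : 'I_n) : nat := \sum_(j < n | i < j) kks d i j.
Definition Jdeg d (j : 'I_n) : nat := \sum_(i < n | i < j) kks d i j.
Definition Pdeg d (p : 'I_n) : nat := \sum_(q < m1) ss d p q.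

Definition Zmat d (a : 'I_2) (q : 'I_m1) : nat := if val a == 0 then s_deg d q else right_deg d q.
(** The leading monomial sees only the column sums: the exponent of x_(n+j). The order of the rows
    is the one for which [I_k_s], [I_kk_s] and [I_kk_k] together form the chain condition; [Zmat]
    treats [I_ll_s] in the same way. *)
Definition Ymat d (a : 'I_3) (j : 'I_n) : nat :=
  if val a == 0 then Pdeg d j else if val a == 1 then ks d j else Jdeg d j.

Lemma sum_pos (I : finType) (P : pred I) (f : I -> nat) : 0 < \sum_(i | P i) f i -> exists2 i, P i & 0 < f i.
Proof.
rewrite lt0n sum_nat_eq0 negb_forall ; case/existsP => i; rewrite negb_imply => /andP[Pi].
by rewrite -lt0n; exists i.
Qed.

Lemma mul_pos0 x y : x * y = 0 -> 0 < x -> 0 < y -> False.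
Proof. by case: x y => [|x] [|y]. Qed.

Lemma Ymat_chain d : in_I d -> chain (Ymat d).
Proof.
move=> Id a j a' j' aa jj; apply: muln0_pos; rewrite /Ymat.
case: a a' aa => [[|[|[|a]]] ha] [[|[|a']] ha'] //= _.
- move=> hk /sum_pos[q _ hs].
  by apply: (mul_pos0 (I_k_s Id q jj)).
- move=> /sum_pos[i ij hk] /sum_pos[q _ hs].
  by apply: (mul_pos0 (I_kk_s Id q ij jj)).
- move=> /sum_pos[i ij hk] hs.
  by apply: (mul_pos0 (I_kk_k Id ij jj)).
Qed.

Lemma Zmat_chain d : in_I d -> chain (Zmat d).
Proof.
move=> Id a q a' q' aa qq; apply: muln0_pos; rewrite /Zmat.
case: a a' aa => [[|[|a]] ha] [[|a'] ha'] //= _ /sum_pos[i iq hl] /sum_pos[p _ hs].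
by apply: (mul_pos0 (I_ll_s Id p iq qq)).
Qed.

Definition kmat d (i j : 'I_n) : nat := if i < j then kks d i j else 0.

Lemma kmat_chain d : in_I d -> chain (kmat d).
Proof.
move=> Id i j i' j' ii jj; rewrite /kmat; case: ifP => // ij; case: ifP => [ij'|_]; last by rewrite muln0.
exact: (I_kk_kk Id ij ij' ii jj).
Qed.

Lemma smat_chain d : in_I d -> chain (fun p q => ss d p q : nat).
Proof. by move=> Id p q p' q' pp qq; apply: (I_s_s Id pp qq). Qed.

Lemma sum_kmatl d i : \sum_j kmat d i j = Xdeg d i.
Proof. by rewrite /Xdeg [RHS]big_mkcond. Qed.
Lemma sum_kmatr d j : \sum_i kmat d i j = Jdeg d j.
Proof. by rewrite /Jdeg [RHS]big_mkcond. Qed.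

Lemma in_I_cases d : in_I d -> sum_k d = 0 \/ sum_ll d = 0.
Proof.
move=> Id; have [->|/sum_pos[t _ hk]] := posnP (sum_k d); [by left | right].
have [->//|] := posnP (sum_ll d).
by case/sum_pos=> i _ /sum_pos[j ij hl]; case: (mul_pos0 (I_k_ll Id t ij)).
Qed.

Lemma sum_Jdeg d : \sum_j Jdeg d j = sum_kk d.
Proof.
rewrite /Jdeg /sum_kk; under eq_bigr do rewrite big_mkcond.
by rewrite exchange_big; apply: eq_bigr => i _; rewrite [RHS]big_mkcond.
Qed.
Lemma sum_sdeg d : \sum_q s_deg d q = sum_s d. Proof. by rewrite /s_deg exchange_big. Qed.

Lemma sum_two (I : finType) (P : pred I) (f : I -> nat) x y : P x -> P y -> x != y ->
  0 < f x -> 0 < f y -> 1 < \sum_(i | P i) f i.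
Proof.
move=> Px Py xy fx fy; rewrite (bigD1 x) //= (bigD1 y) /=; last by rewrite Py eq_sym.
by rewrite addnA; apply: leq_trans (leq_addr _ _); case: (f x) (f y) fx fy => [|a] [|b] //; lia.
Qed.

Lemma sum_one (I : finType) (P : pred I) (f : I -> nat) x : P x -> 0 < f x -> 0 < \sum_(i | P i) f i.
Proof. by move=> Px fx; rewrite (bigD1 x) //= addn_gt0 fx. Qed.

Section Arcs.
Variables (d d' : index_data m1 n) (Id : in_I d) (Id' : in_I d').
Hypotheses (eL : forall p, ls d p = ls d' p) (eS : forall q, s_deg d q = s_deg d' q)
  (eR : forall q, right_deg d q = right_deg d' q).

(** Since i' opens an arc in d', it carries nothing else in either datum, so the gap condition makes
    it open an arc (i', k) in d. For k < j that arc is also in d', doubling i'; for k > j it crosses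
    (i, j); for k = j the site j is used twice. *)
Lemma arc_nested (i i' j : 'I_m1) : i < i' -> i' < j -> lls d i j -> lls d' i' j ->
  (forall x y : 'I_m1, x < y -> y < j -> lls d x y = lls d' x y) -> False.
Proof.
move=> ii ij a a' IH.
have l' : 0 < left_deg d' i' by apply: (sum_one (x := j)) => //; rewrite a'.
have := I_deg Id' i'; rewrite /ll_deg -/(left_deg d' i') -/(right_deg d' i') -!eL -eS -eR => deg'.
have ll0 : ll_deg d i' <> 0.
  move=> ll0; have := I_ll_gap Id ii ij; rewrite ll0 a => H.
  by suff : 1 = 0 by []; apply: H; lia.
have /sum_pos[k ik b] : 0 < left_deg d i'.
  by move: ll0; rewrite /ll_deg -/(left_deg d i') -/(right_deg d i'); lia.
case: (ltngtP k j) => kj.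
- have b' : lls d' i' k by rewrite -IH //; case: (lls d i' k) b.
  have : 1 < left_deg d' i'.
    by apply: (sum_two (x := k) (y := j)) => //; rewrite ?b' ?a' //; apply: contraTneq kj => ->; rewrite ltnn.
  lia.
- by have := I_ll_ll Id ii ij kj; rewrite a; case: (lls d i' k) b.
- have : 1 < right_deg d j.
    apply: (sum_two (x := i) (y := i')) => //; rewrite ?a ?(ltn_trans ii) //.
      by apply: contraTneq ii => ->; rewrite ltnn.
    by rewrite -(val_inj kj).
  have := I_deg Id j; rewrite /ll_deg -/(left_deg d j) -/(right_deg d j); lia.
Qed.
End Arcs.

Section Two.
Variables (d d' : index_data m1 n) (Id : in_I d) (Id' : in_I d').
Hypotheses (eL : forall p, ls d p = ls d' p)
  (eX : forall i, Xdeg d i = Xdeg d' i)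
  (eY : forall j, ks d j + Jdeg d j + Pdeg d j = ks d' j + Jdeg d' j + Pdeg d' j)
  (eZ : forall q, s_deg d q + right_deg d q = s_deg d' q + right_deg d' q).

(** Only the sums k + s and s + ll are visible; that k or ll vanishes in each datum separates them
    and supplies the row sums for [chain_unique]. *)
Lemma decode_sums : [/\ sum_kk d = sum_kk d', sum_s d = sum_s d', sum_k d = sum_k d' & sum_ll d = sum_ll d'].
Proof.
have e1 : sum_kk d = sum_kk d' by apply: eq_bigr => i _; apply: eX.
have e2 : sum_k d + sum_kk d + sum_s d = sum_k d' + sum_kk d' + sum_s d'.
  rewrite -!sum_Jdeg /sum_k /sum_s -!big_split; apply: eq_bigr => j _; exact: eY.
have e3 : sum_s d + sum_ll d = sum_s d' + sum_ll d'.
  by rewrite -!sum_sdeg -!sum_right_deg -!big_split; apply: eq_bigr => j _; exact: eZ.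
by have := in_I_cases Id; have := in_I_cases Id'; split=> //; lia.
Qed.

Lemma decode_Y j : [/\ ks d j = ks d' j, Jdeg d j = Jdeg d' j & Pdeg d j = Pdeg d' j].
Proof.
have [e1 e2 e3 e4] := decode_sums.
have H : forall a j, Ymat d a j = Ymat d' a j.
  apply: chain_unique; [exact: Ymat_chain|exact: Ymat_chain| |] => [[[|[|[|a]]] ha]|i] //.
  - by rewrite /Ymat /= !sum_Jdeg.
  - rewrite !big_ord_recl !big_ord0 /Ymat /=; have := eY i; lia.
by have := H ord0 j; have := H (inord 1) j; have := H ord_max j; rewrite /Ymat /= inordK.
Qed.

Lemma decode_Z q : s_deg d q = s_deg d' q /\ right_deg d q = right_deg d' q.
Proof.
have [e1 e2 e3 e4] := decode_sums.
have H : forall a q, Zmat d a q = Zmat d' a q.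
  apply: chain_unique; [exact: Zmat_chain|exact: Zmat_chain| |] => [[[|[|a]] ha]|i] //.
  - by rewrite /Zmat /= !sum_sdeg.
  - by rewrite /Zmat /= !sum_right_deg.
  - by rewrite !big_ord_recl !big_ord0 /Zmat /= !addn0; exact: eZ.
by have := H ord0 q; have := H ord_max q.
Qed.

Lemma decode_kks (i j : 'I_n) : i < j -> kks d i j = kks d' i j.
Proof.
move=> ij; have := @chain_unique n n (kmat d) (kmat d') (kmat_chain Id) (kmat_chain Id').
rewrite /kmat => /(_ _ _ i j); rewrite ij; apply=> k; rewrite ?sum_kmatl ?sum_kmatr ?eX //.
by have [] := decode_Y k.
Qed.

Lemma decode_ss p q : ss d p q = ss d' p q.
Proof.
have := @chain_unique n m1 (fun p q => ss d p q : nat) (fun p q => ss d' p q : nat) (smat_chain Id) (smat_chain Id').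
have eP k : Pdeg d k = Pdeg d' k by have [] := decode_Y k.
have eS k : s_deg d k = s_deg d' k by have [] := decode_Z k.
by move=> /(_ eP eS p q); do 2![case: (ss _ p q)].
Qed.

Lemma decode_lls (i j : 'I_m1) : i < j -> lls d i j = lls d' i j.
Proof.
have eS q : s_deg d q = s_deg d' q by have [] := decode_Z q.
have eR q : right_deg d q = right_deg d' q by have [] := decode_Z q.
(* As in bracket matching, arcs are recovered in the order of their right ends, which are known from
   [right_deg]. *)
have [k] := ubnP (j : nat); elim: k i j => // k IH i j; rewrite ltnS => jk ij.
have IHj (x y : 'I_m1) : x < y -> y < j -> lls d x y = lls d' x y.
  by move=> xy yj; apply: IH => //; apply: leq_trans yj jk.
have IHj' (x y : 'I_m1) : x < y -> y < j -> lls d' x y = lls d x y by move=> *; rewrite IHj.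
have := fun i' i j => arc_nested Id' Id (fun p => esym (eL p)) (fun q => esym (eS q)) (fun q => esym (eR q)) (i := i') (i' := i) (j := j).
have := fun i' i j => arc_nested Id Id' eL eS eR (i := i') (i' := i) (j := j) => H H'.
apply/idP/idP => a.
  have /sum_pos[i' ij' a'] : 0 < right_deg d' j by rewrite -eR; apply: (sum_one (x := i)) => //; rewrite a.
  have {}a' : lls d' i' j by case: (lls d' i' j) a'.
  case: (ltngtP i i') => ii; [by case: (H i i' j) | by case: (H' i' i j) | by rewrite (val_inj ii)].
have /sum_pos[i' ij' a'] : 0 < right_deg d j by rewrite eR; apply: (sum_one (x := i)) => //; rewrite a.
have {}a' : lls d i' j by case: (lls d i' j) a'.
case: (ltngtP i i') => ii; [by case: (H' i i' j) | by case: (H i' i j) | by rewrite (val_inj ii)].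
Qed.

Lemma decode_hvec (R : comNzRingType) : hvec R d = hvec R d'.
Proof.
rewrite /hvec; apply: (f_equal2 *%R); first apply: (f_equal2 *%R); first apply: (f_equal2 *%R); first apply: (f_equal2 *%R).
- by apply: eq_bigr => t _; have [-> _ _] := decode_Y t.
- by apply: eq_bigr => i _; apply: eq_bigr => j ij; rewrite decode_kks.
- by apply: eq_bigr => j _; rewrite !eL.
- by apply: eq_bigr => i _; apply: eq_bigr => j ij; rewrite decode_lls.
- by apply: eq_bigr => p _; apply: eq_bigr => q _; rewrite decode_ss.
Qed.

End Two.
End Decoding.

(** * Leading monomials of the top coefficients *)

Section Leading.
Variables (R : comNzRingType) (m1 n : nat).
Local Notation A := (superpoly R (n + n) (m1 + m1)).
Local Notation L := ('I_n + 'I_m1)%type.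
Local Notation Psi := (@Psi R m1 n).
Local Notation Th := (@Th R m1 n).
Implicit Types (F G : A) (S : {set 'I_(m1 + m1)}) (mm : 'X_{1..n + n}).
Implicit Types (xs : seq 'I_(n + n)) (th : seq 'I_(m1 + m1)).

(* For this weight the leading monomial of a column with i < j is x_i x_(n+j) for
   [b_i b_j], x_(n+i) for [b_i f_j] and theta_i theta_(m1+i) for [f_i f_j]. *)
Definition omx (i : 'I_(n + n)) : nat := match split i with inl _ => 0%N | inr j => (j + m1).+1 end.
Definition omt (p : 'I_(m1 + m1)) : nat := match split p with inl q => (m1 - q)%N | inr _ => 0%N end.
Definition om S mm : nat := (\sum_(p in S) omt p + \sum_i mm i * omx i)%N.

Definition low F N : Prop := forall S mm, (F S)@_mm != 0 -> (om S mm < N)%N.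

Definition keym xs : 'X_{1..n + n} := [multinom count_mem i xs | i < n + n].
Definition keyS th : {set 'I_(m1 + m1)} := [set p in th].

(** The weight [om] is not a total order on monomials, so strict dominance over all other monomials
    is part of the notion. The leading coefficient is a sign, hence a unit in any ring. *)
Definition lead F xs th : Prop :=
  (exists e, (F (keyS th))@_(keym xs) = (-1) ^+ e) /\
  forall S mm, (F S)@_mm != 0 -> (S, mm) = (keyS th, keym xs) \/ (om S mm < om (keyS th) (keym xs))%N.

Lemma lead_low F xs th : lead F xs th -> low F (om (keyS th) (keym xs)).+1.
Proof. by move=> [_ H] S mm /H [[-> ->] //|/ltnW]. Qed.

Lemma omD1 S mm i : om S (U_(i) + mm)%MM = (om S mm + omx i)%N.
Proof.
rewrite /om -addnA; congr addn; under eq_bigr do rewrite mnmDE mulnDl.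
rewrite big_split /= addnC; congr addn; rewrite (bigD1 i) //= big1 => [|j /negbTE ji].
  by rewrite mnm1E eqxx mul1n addn0.
by rewrite mnm1E eq_sym ji.
Qed.

Lemma omU1 p S mm : p \notin S -> om (p |: S) mm = (om S mm + omt p)%N.
Proof. by move=> pS; rewrite /om big_setU1 //= -addnA addnC. Qed.

Lemma coef_spX i F S mm : ((spX R _ i * F) S)@_mm != 0 ->
  exists2 mm', mm = (U_(i) + mm')%MM & (F S)@_mm' != 0.
Proof.
rewrite spXME ffunE mulrC -mcoeff_msupp (perm_mem (msuppMX _ _)) => /mapP[mm' h ->].
by exists mm'; rewrite // -mcoeff_msupp.
Qed.

Lemma coef_theta p F S mm : ((theta R _ p * F) S)@_mm != 0 ->
  exists S', [/\ p \notin S', S = p |: S' & (F S')@_mm != 0].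
Proof.
rewrite thetaME ffunE; case: ifP => pS; last by rewrite mcoeff0 eqxx.
move=> nz; exists (S :\ p); rewrite !inE eqxx setD1K //; split=> //.
by apply: contraNneq nz; rewrite -signr_odd; case: odd; rewrite ?mulN1r ?mul1r ?mcoeffN => ->; rewrite ?oppr0.
Qed.

Lemma low_spX i F N : low F N -> low (spX R _ i * F) (N + omx i).
Proof. by move=> lF S mm /coef_spX[mm' -> /lF]; rewrite omD1 ltn_add2r. Qed.

Lemma low_theta p F N : low F N -> low (theta R _ p * F) (N + omt p).
Proof. by move=> lF S mm /coef_theta[S' [pS -> /lF]]; rewrite omU1 // ltn_add2r. Qed.

Lemma keym_cons i xs : keym (i :: xs) = (U_(i) + keym xs)%MM.
Proof. by apply/mnmP => j; rewrite mnmDE mnm1E !mnmE. Qed.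

Lemma keyS_cons p th : keyS (p :: th) = p |: keyS th.
Proof. by apply/setP => q; rewrite !inE. Qed.

Lemma lead_spX i F xs th : lead F xs th -> lead (spX R _ i * F) (i :: xs) th.
Proof.
move=> [[e eF] lF]; rewrite /lead keym_cons; split.
  by exists e; rewrite spXME ffunE mulrC mcoeffMX.
move=> S mm /coef_spX[mm' -> /lF [[-> ->]|lt]]; first by left.
by right; rewrite !omD1 ltn_add2r.
Qed.

Lemma lead_theta p F xs th : p \notin th -> lead F xs th -> lead (theta R _ p * F) xs (p :: th).
Proof.
move=> pth [[e eF] lF]; rewrite /lead keyS_cons.
have pS : p \notin keyS th by rewrite inE.
split.
  exists (ninv [set p] (keyS th) + e)%N; rewrite thetaME ffunE setU11 setU1K // exprD -eF.
  by rewrite -signr_odd -[in RHS]signr_odd; case: odd; rewrite ?mulN1r ?mul1r ?mcoeffN.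
move=> S mm /coef_theta[S' [pS' -> /lF [[-> ->]|lt]]]; first by left.
by right; rewrite !omU1 // ltn_add2r.
Qed.

Lemma leadB F G xs th : lead F xs th -> low G (om (keyS th) (keym xs)) -> lead (F - G) xs th.
Proof.
have fB S : (F - G) S = F S - G S by rewrite !ffunE.
move=> [[e eF] lF] lG; split.
  exists e; rewrite fB mcoeffB eF.
  have [->|/lG] := eqVneq ((G (keyS th))@_(keym xs)) 0; first by rewrite subr0.
  by rewrite ltnn.
move=> S mm; rewrite fB mcoeffB.
have [->|/lG] := eqVneq ((G S)@_mm) 0; first by rewrite subr0 => /lF.
by right.
Qed.

Lemma leadN F xs th : lead F xs th -> lead (- F) xs th.
Proof.
have fN S : (- F) S = - F S by rewrite !ffunE.
move=> [[e eF] lF]; split; first by exists e.+1; rewrite fN mcoeffN eF exprS mulN1r.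
by move=> S mm; rewrite fN mcoeffN oppr_eq0 => /lF.
Qed.

Lemma lead1 : lead 1 [::] [::].
Proof.
have k0 : keym [::] = 0%MM by apply/mnmP => j; rewrite !mnmE.
have S0 : keyS [::] = set0 by apply/setP => q; rewrite !inE.
rewrite /lead k0 S0; split; first by exists 0%N; rewrite ffunE eqxx mcoeff1 eqxx.
move=> S mm; rewrite ffunE; have [->|_] := eqVneq S set0; last by rewrite mcoeff0 eqxx.
by rewrite mcoeff1; have [->|_] := eqVneq mm 0%MM; rewrite ?eqxx //; left.
Qed.

Lemma lead_Th th : uniq th -> lead (Th th) [::] th.
Proof.
elim: th => [|p th IH] /=; first by rewrite /Submission.Th big_nil => _; exact: lead1.
by case/andP=> pth /IH; rewrite /Submission.Th big_cons; exact: lead_theta.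
Qed.

Definition xlead (c : L * L) : seq 'I_(n + n) := match c with
  | (inl i, inl j) => [:: lshift n i; rshift n j] | (inl p, inr _) => [:: rshift n p] | _ => [::] end.
Definition tlead (c : L * L) : seq 'I_(m1 + m1) :=
  if c.1 is inr i then [:: lshift m1 i; rshift m1 i] else [::].
Definition xhi (a : L) : seq 'I_(n + n) := if a is inl j then [:: rshift n j] else [::].
Definition thi (a : L) : seq 'I_(m1 + m1) := if a is inr q then [:: lshift m1 q; rshift m1 q] else [::].

Lemma lead_hi a F xs th : uniq (thi a ++ th) -> lead F xs th ->
  lead (Psi (zb R a) * F) (xhi a ++ xs) (thi a ++ th).
Proof.
case: a => [j _|q]; first by rewrite Psi_zbl; exact: lead_spX.
rewrite Psi_zbr -mulrA => /= /and3P[h1 h2 _] lF; apply: lead_theta => //; exact: lead_theta.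
Qed.

Lemma low_hi a F N : low F N -> low (Psi (zb R a) * F) (N + match a with inl j => (j + m1).+1 | inr q => m1 - q end).
Proof.
case: a => [j|q] lF; first by rewrite Psi_zbl; have := low_spX (i := rshift n j) lF; rewrite /omx split_rshift.
rewrite Psi_zbr -mulrA; have := low_theta (p := lshift m1 q) (low_theta (p := rshift m1 q) lF).
by rewrite /omt split_lshift split_rshift addn0.
Qed.

Lemma low_le F N N' : low F N -> (N <= N')%N -> low F N'.
Proof. by move=> lF NN S mm /lF /leq_trans; apply. Qed.

Lemma low_lo a F N : low F N -> low (Psi (zp R a) * F) N.
Proof.
case: a => [j|q] lF; last by rewrite Psi_zpr mul1r.
by rewrite Psi_zpl; have := low_spX (i := lshift n j) lF; rewrite /omx split_lshift addn0.
Qed.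

(** The shift by m1 + 1 in [omx] lets any x_(n+p) beat any pair of thetas at one site, while [omx]
    increases and [omt] decreases with the index, which settles the two pure cases. *)
Lemma lead_col c F xs th : oriented c -> uniq (tlead c ++ th) -> lead F xs th ->
  lead (Psi (ecol R c) * F) (xlead c ++ xs) (tlead c ++ th).
Proof.
have P2 a b : Psi (zp R a * zb R b) * F = Psi (zp R a) * (Psi (zb R b) * F) by rewrite PsiM mulrA.
move=> oc u lF; have lo := lead_low lF; rewrite /ecol PsiB mulrBl !P2.
case: c oc u => -[i|i] [j|j] ij u; rewrite /oriented /= ?ltn_add2l in ij; rewrite [xlead _]/= [tlead _]/= [fst _]/= [snd _]/=.
- apply: leadB; first by rewrite Psi_zpl Psi_zbl; do 2!apply: lead_spX.
  apply: low_le (low_lo (a := inl j) (low_hi (a := inl i) lo)) _.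
  by rewrite !keym_cons !omD1 /omx split_lshift split_rshift /=; move: (om _ _) => N; lia.
- rewrite -opprB; apply: leadN; apply: leadB; first by rewrite Psi_zpr mul1r Psi_zbl; apply: lead_spX.
  apply: low_le (low_lo (a := inl i) (low_hi (a := inr j) lo)) _.
  by rewrite !keym_cons !omD1 /omx split_rshift /=; move: (om _ _) => N; lia.
- by have := ltn_ord j; lia.
- case/and3P: u => h1 h2 u; rewrite -opprB; apply: leadN; apply: leadB.
    by rewrite Psi_zpr mul1r Psi_zbr -mulrA; do 2!apply: lead_theta => //.
  apply: low_le (low_lo (a := inr i) (low_hi (a := inr j) lo)) _.
  rewrite !keyS_cons !omU1 /omt ?split_lshift ?split_rshift /=; first by have := ltn_ord j; move: (om _ _) => N; lia.
    by rewrite inE.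
  by move: h1; rewrite !inE.
Qed.

Definition xkey (s : seq L) (C : seq (L * L)) := flatten (map xhi s) ++ flatten (map xlead C).
Definition tkey (s : seq L) (C : seq (L * L)) w := flatten (map thi s) ++ flatten (map tlead C) ++ w.

Lemma lead_top s C w : uniq (tkey s C w) -> (forall c, c \in C -> oriented c) ->
  lead (vv R (size s) s C w) (xkey s C) (tkey s C w).
Proof.
rewrite /vv ee_size => u oC; rewrite PsiM -mulrA.
have : lead (Psi (\prod_(c <- C) ecol R c) * Th w) (flatten (map xlead C)) (flatten (map tlead C) ++ w).
  have {u} : uniq (flatten (map tlead C) ++ w) by move: u; rewrite cat_uniq => /and3P[].
  elim: C oC => [|c C IH] oC /=; first by rewrite big_nil Psi1 mul1r; exact: lead_Th.
  rewrite big_cons PsiM -mulrA -catA => u; apply: lead_col => //; first by apply: oC; rewrite mem_head.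
  by apply: IH => [c' c'C|]; [apply: oC; rewrite inE c'C orbT | move: u; rewrite cat_uniq => /and3P[]].
move: u; rewrite /tkey /xkey; move: (flatten (map xlead C)) (_ ++ w) (_ * _) => xs th F u lF.
elim: s u => [|a s IH] /= u; first by rewrite big_nil Psi1 mul1r.
rewrite big_cons PsiM -mulrA -!catA; apply: lead_hi; first by rewrite catA.
by apply: IH; move: u; rewrite -catA cat_uniq => /and3P[].
Qed.

End Leading.

Section Keys.
Variables (m1 n : nat).
Local Notation L := ('I_n + 'I_m1)%type.
Implicit Types (s : seq L) (C : seq (L * L)) (w : seq 'I_(m1 + m1)) (d : index_data m1 n).
Local Open Scope nat_scope.

Lemma count_flatten_map (I : Type) (J : eqType) (g : I -> seq J) (r : seq I) y :
  count_mem y (flatten (map g r)) = \sum_(x <- r) count_mem y (g x).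
Proof. by rewrite count_flatten sumnE !big_map. Qed.

Lemma sum_cols (f : L * L -> nat) C :
  \sum_(c <- C) f c = \sum_a \sum_b f (a, b) * ccnt a b C.
Proof.
by rewrite [LHS]sum_count [RHS]pair_bigA; apply: eq_bigr => -[].
Qed.

Section WithData.
Variables (d : index_data m1 n) (s : seq L) (C : seq (L * L)) (w : seq 'I_(m1 + m1)).
Hypothesis M : matches d s C w.

Lemma xkey_lshift i : count_mem (lshift n i) (xkey s C) = Xdeg d i.
Proof.
have [_ [oC _ _ [ekk _ _]]] := M.
rewrite count_cat !count_flatten_map sum_count big1 ?add0n => [|[j|q] _]; last 2 first.
- by rewrite /= eq_rlshift.
- by [].
rewrite sum_cols big_sumType /= [X in _ + X]big1 ?addn0 => [|q _]; last by rewrite big_sumType /= !big1.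
rewrite (bigD1 i) //= [X in _ + X]big1 ?addn0 => [|k /negbTE ki]; last first.
  by rewrite big_sumType /= !big1 // => q _; rewrite ?eq_lshift ?eq_rlshift ?ki.
rewrite big_sumType /= [X in _ + X]big1 ?addn0 => [|q _]; last by rewrite eq_rlshift.
rewrite /Xdeg [RHS]big_mkcond; apply: eq_bigr => j _; rewrite eqxx eq_rlshift mul1n; case: ifP => [/ekk -> //|ij].
by apply: (count0 oC); rewrite /oriented /= ij.
Qed.

Lemma xkey_rshift j : count_mem (rshift n j) (xkey s C) = ks d j + (Jdeg d j + Pdeg d j).
Proof.
have [_ [oC ek _ [ekk _ es]]] := M.
rewrite count_cat !count_flatten_map sum_count big_sumType /= [X in _ + X + _]big1 // addn0; congr addn.
  rewrite (bigD1 j) //= eqxx mul1n ek big1 ?addn0 // => k /negbTE kj.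
  by rewrite eq_rshift kj.
rewrite sum_cols big_sumType /= [X in _ + X]big1 ?addn0 => [|q _]; last by rewrite big_sumType /= !big1.
under eq_bigr do rewrite big_sumType.
rewrite big_split /=; congr addn.
  rewrite /Jdeg [RHS]big_mkcond; apply: eq_bigr => i _; rewrite (bigD1 j) //= eqxx eq_lrshift.
  rewrite big1 ?addn0 => [|k /negbTE kj]; last by rewrite ?eq_lrshift eq_rshift kj.
  rewrite mul1n; case: ifP => [/ekk -> //|ij].
  by apply: (count0 oC); rewrite /oriented /= ij.
rewrite (bigD1 j) //= [X in _ + X]big1 ?addn0 => [|k /negbTE kj]; last first.
  by rewrite big1 // => q _; rewrite eq_rshift kj.
by apply: eq_bigr => q _; rewrite eqxx mul1n es.
Qed.

(** An unpaired letter and the left end of an arc leave the same trace, the full pair of thetas;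
    they are told apart only by the arc decoding. *)
Lemma tkey_site q p : p = lshift m1 q \/ p = rshift m1 q ->
  count_mem p (tkey s C w) = count_mem (inr q) s + (left_deg d q + ls d p).
Proof.
have [_ LM] := M; have [oC _ el _] := LM => pq.
have hp k : (lshift m1 k == p) + (rshift m1 k == p) = (k == q).
  by case: pq => ->; rewrite ?eq_lshift ?eq_rshift ?eq_lrshift ?eq_rlshift; case: eqP.
rewrite !count_cat !count_flatten_map sum_count big_sumType /= big1 // add0n el; congr addn; last congr addn.
  by rewrite (bigD1 q) //= addn0 hp eqxx mul1n big1 ?addn0 // => k /negbTE kq; rewrite addn0 hp kq.
rewrite sum_cols big_sumType /= big1 ?add0n => [|i _]; last by rewrite big_sumType /= !big1.
rewrite (bigD1 q) //= [X in _ + X]big1 ?addn0 => [|k /negbTE kq]; last first.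
  by rewrite big1 // => b _; rewrite /= addn0 hp kq.
by rewrite -(lists_left q LM); apply: eq_bigr => b _; rewrite hp eqxx mul1n.
Qed.

Lemma uniq_tkey : uniq (tkey s C w).
Proof.
apply: count_mem_uniq => p.
have cw x : (x \in tkey s C w) = (0 < count_mem x (tkey s C w)) by rewrite -has_count has_pred1.
rewrite cw; apply/esym/bool_count; case: (split_ordP p) => q ->; have := matches_site q M.
  rewrite (tkey_site (or_introl erefl)) => <-.
  by rewrite -!addnA leq_add2l leq_add2l addnA [X in (_ <= X)%N]addnCA leq_addr.
rewrite (tkey_site (or_intror erefl)) => <-.
by rewrite -!addnA leq_add2l leq_add2l !addnA leq_addl.
Qed.

End WithData.

Lemma key_inj d s C w d' s' C' w' : matches d s C w -> matches d' s' C' w' -> in_I d -> in_I d' ->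
  keyS (tkey s C w) = keyS (tkey s' C' w') -> keym (xkey s C) = keym (xkey s' C') ->
  forall R, hvec R d = hvec R d'.
Proof.
move=> M M' Id Id' eS em R.
have cX i : count_mem i (xkey s C) = count_mem i (xkey s' C').
  by have := congr1 (fun m : 'X_{1..n + n} => m i) em; rewrite !mnmE.
have cT p : count_mem p (tkey s C w) = count_mem p (tkey s' C' w').
  rewrite !count_uniq_mem ?(uniq_tkey M) ?(uniq_tkey M') //.
  by have := congr1 (fun S : {set _} => p \in S) eS; rewrite !inE => ->.
have site q := matches_site q M; have site' q := matches_site q M'.
(* Exactly one thing occupies the site: one theta in the key is a lone theta, two are a letter or a
   left end, none means a right end or a mixed column. *)
have eqs q : [/\ ls d (lshift m1 q) = ls d' (lshift m1 q), ls d (rshift m1 q) = ls d' (rshift m1 q)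
    & s_deg d q + right_deg d q = s_deg d' q + right_deg d' q].
  have := cT (lshift m1 q); have := cT (rshift m1 q); move: (site q) (site' q).
  rewrite !(tkey_site M (or_introl erefl)) !(tkey_site M (or_intror erefl)).
  rewrite !(tkey_site M' (or_introl erefl)) !(tkey_site M' (or_intror erefl)).
  move: (count_mem _ s) (count_mem _ s') (left_deg d q) (left_deg d' q) => x x' y y'.
  move: (right_deg d q) (right_deg d' q) (s_deg d q) (s_deg d' q) => z z' u u'.
  by do 4![case: (ls _ _)]; rewrite ?addn0 ?addn1 /= => *; split=> //; lia.
apply: decode_hvec => //.
- by move=> p; case: (split_ordP p) => q ->; have [] := eqs q.
- by move=> i; rewrite -(xkey_lshift M) -(xkey_lshift M') cX.
- by move=> j; rewrite -!addnA -(xkey_rshift M) -(xkey_rshift M') cX.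
- by move=> q; have [] := eqs q.
Qed.

End Keys.

(** * Linear independence *)

Section Independence.
Variables (R : comNzRingType) (m1 n : nat).
Hypothesis natinv : forall k : nat, exists h : R, h * k.+1%:R = 1.
Local Notation A := (superpoly R (n + n) (m1 + m1)).
Local Notation L := ('I_n + 'I_m1)%type.
Implicit Types (s : seq L) (C : seq (L * L)) (w : seq 'I_(m1 + m1)) (d : index_data m1 n).

Lemma iter_eta_sum (I : finType) t (F : I -> A) :
  iter t (@eta R m1 n) (\sum_i F i) = \sum_i iter t (@eta R m1 n) (F i).
Proof.
have etaD G H : eta (G + H) = eta G + eta H :> A.
  rewrite /eta addrACA -!big_split; apply: (f_equal2 +%R); apply: eq_bigr => j _ /=.
    by rewrite linearD mulrDr.
  by rewrite mulrDr.
have eta0 : eta (0 : A) = 0 by rewrite /eta !big1 ?addr0 // => j _; rewrite ?linear0 mulr0.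
elim: t => //= t ->; exact: (big_morph _ etaD eta0).
Qed.

Lemma iter_eta0 t : iter t (@eta R m1 n) 0 = 0.
Proof. by have := iter_etaZ t 0 (0 : A); rewrite !scale0r. Qed.

Section Family.
Variables (I : finType) (a : I -> R) (u : I -> A) (t : I -> nat) (d : I -> index_data m1 n)
  (s : I -> seq L) (C : I -> seq (L * L)) (w : I -> seq 'I_(m1 + m1)).
Hypotheses (u_inj : injective u) (Id : forall i, in_I (d i))
  (M : forall i, matches (d i) (s i) (C i) (w i)) (st : forall i, size (s i) = (t i + t i)%N)
  (eu : forall i, u i = iter (t i) (@eta R m1 n) (hvec R (d i))) (sum0 : \sum_i a i *: u i = 0).

(** In total [eta] is applied T + t times to a product with 2t unpaired letters: for t < T this
    exceeds their number and gives 0, for t = T it reaches the product of all zb. *)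
Lemma iter_eta_top T i : (t i <= T)%N -> exists e, iter T (@eta R m1 n) (u i) =
  if t i == T then (-1) ^+ e * (T + T)`!%:R *: vv R (size (s i)) (s i) (C i) (w i) else 0.
Proof.
move=> tT; rewrite eu -iterD; have [e ->] := iter_eta_hvec R (T + t i) (M i); exists e.
case: eqP => [<-|ne]; first by rewrite st.
by rewrite vv_gt ?scaler0 // st ltn_add2r; lia.
Qed.

Lemma family_indep i : a i = 0.
Proof.
apply/eqP/negP => /negP ai.
pose i0 := [arg max_(j > i | a j != 0) t j].
have [T eT] : exists T, T = t i0 by exists (t i0).
have [ai0 tT] : a i0 != 0 /\ forall j, a j != 0 -> (t j <= T)%N.
  by rewrite eT /i0; case: arg_maxnP => // j aj jmax; split.
pose K j := om (keyS (tkey (s j) (C j) (w j))) (keym (xkey (s j) (C j))).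
(* Among the terms surviving [eta] iterated T times, one of maximal weight is chosen; its leading
   monomial can occur in another survivor only if the keys coincide, hence the vectors. *)
pose i1 := [arg max_(j > i0 | (a j != 0) && (t j == T)) K j].
have [ai1 [ti1 K1]] : a i1 != 0 /\ t i1 = T /\ forall j, a j != 0 -> t j = T -> (K j <= K i1)%N.
  rewrite /i1; case: arg_maxnP => [|j /andP[aj /eqP tj] jmax]; first by rewrite ai0 eT eqxx.
  by split=> //; split=> // k ak tk; apply: jmax; rewrite ak tk eqxx.
have ld j : lead (vv R (size (s j)) (s j) (C j) (w j)) (xkey (s j) (C j)) (tkey (s j) (C j) (w j)).
  by have [_ [oC _ _ _]] := M j; apply: lead_top (uniq_tkey (M j)) oC.
pose S1 := keyS (tkey (s i1) (C i1) (w i1)); pose mm1 := keym (xkey (s i1) (C i1)).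
have := congr1 (fun F : A => (iter T (@eta R m1 n) F S1)@_mm1) sum0.
rewrite iter_eta0 iter_eta_sum sum_ffunE raddf_sum (bigD1 i1) //= big1 ?addr0 => [|j ji1]; last first.
  have [->|aj] := eqVneq (a j) 0; first by rewrite scale0r iter_eta0 ffunE mcoeff0.
  rewrite iter_etaZ; have [e ->] := iter_eta_top (tT _ aj); case: eqP => [tj|_]; last first.
    by rewrite scaler0 ffunE mcoeff0.
  rewrite scalerA ffunE mcoeffZ; have [->|] := eqVneq ((vv R (size (s j)) (s j) (C j) (w j) S1)@_mm1) 0.
    by rewrite mulr0.
  case/(ld j).2 => [ek|]; last by rewrite ltnNge K1.
  case/eqP: ji1; apply: u_inj; rewrite !eu tj ti1; congr (iter _ _ _); apply/esym.
  exact: key_inj (M i1) (M j) (Id i1) (Id j) (congr1 fst ek) (congr1 snd ek) R.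
rewrite iter_etaZ; have [e ->] := iter_eta_top (tT _ ai1); rewrite ti1 eqxx scalerA ffunE mcoeffZ.
have z0 : ((0 : A) S1)@_mm1 = 0 by rewrite ffunE mcoeff0.
have [[e' ->] _] := ld i1; rewrite z0 => e0.
have [h] := natinv (T + T)`!.-1; rewrite prednK ?fact_gt0 // => eh.
have sK k : (-1) ^+ k * (-1) ^+ k = 1 :> R by rewrite -expr2 sqrr_sign.
(* The coefficient found is a unit times [a i1]; over a ring the inverse has to be exhibited. *)
have : a i1 = a i1 * ((-1) ^+ e * (T + T)`!%:R) * (-1) ^+ e' * ((-1) ^+ e' * (-1) ^+ e * h).
  transitivity (a i1 * ((-1) ^+ e * (-1) ^+ e) * ((-1) ^+ e' * (-1) ^+ e') * (h * (T + T)`!%:R)).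
    by rewrite !sK eh !mulr1.
  by ring.
by rewrite e0 mul0r => a0; rewrite a0 eqxx in ai1.
Qed.

End Family.

Lemma eta_B_indep P : lin_indep (@eta_B R m1 n P).
Proof.
move=> r c ur rB sum0 v vr.
pose u (i : 'I_(size r)) := nth 0 r i.
pose Q i (x : nat * index_data m1 n * seq L * seq (L * L) * seq 'I_(m1 + m1)) := let: (t, d, s, C, w) := x in
  [/\ in_I d, matches d s C w, size s = (t + t)%N & u i = iter t (@eta R m1 n) (hvec R d)].
have /fin_all_exists[D DP] : forall i, exists x, Q i x.
  move=> i; have [t [q [_ [_ /B_matches[d [s [C [w [Id M st _ ->]]]]] e]]]] := rB _ (mem_nth 0 (ltn_ord i)).
  by exists (t, d, s, C, w).
have u_inj : injective u by move=> i j /eqP; rewrite nth_uniq // => /eqP/val_inj.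
have := @family_indep _ (fun i => c (u i)) u (fun i => (D i).1.1.1.1) (fun i => (D i).1.1.1.2)
  (fun i => (D i).1.1.2) (fun i => (D i).1.2) (fun i => (D i).2) u_inj.
have vi : (index v r < size r)%N by rewrite index_mem.
move=> H; have := H _ _ _ _ _ (Ordinal vi); rewrite /u nth_index //; apply.
- by move=> i; have := DP i; case: (D i) => [[[[t d] s] C] w] [].
- by move=> i; have := DP i; case: (D i) => [[[[t d] s] C] w] [].
- by move=> i; have := DP i; case: (D i) => [[[[t d] s] C] w] [].
- by move=> i; have := DP i; case: (D i) => [[[[t d] s] C] w] [].
- by move: sum0; rewrite (big_nth 0) big_mkord.
Qed.

End Independence.

(** * The products of columns have charge 0 *)

Section Charges.
Variables (R : comNzRingType) (m1 n : nat).
Local Notation A := (superpoly R (n + n) (m1 + m1)).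
Local Notation L := ('I_n + 'I_m1)%type.
Local Notation Psi := (@Psi R m1 n).
Local Notation Th := (@Th R m1 n).
Implicit Types (F : A) (a b : L) (s l : seq L) (C : seq (L * L)) (w : seq 'I_(m1 + m1)) (k : int).

(** The charge of z_a. That of zb_a is larger by 2 for both kinds of letters, so the coefficients
    e_k are homogeneous. *)
Definition chL a : int := if a is inl _ then -1 else 0.
Definition chW l : int := \sum_(a <- l) chL a.

Lemma chW_cons a l : chW (a :: l) = chL a + chW l. Proof. exact: big_cons. Qed.
Lemma chW_nil : chW [::] = 0. Proof. exact: big_nil. Qed.
Lemma chW_cat l l' : chW (l ++ l') = chW l + chW l'. Proof. exact: big_cat. Qed.

Lemma Ch_lo k a F : Ch k F -> Ch (k + chL a) (Psi (zp R a) * F).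
Proof.
case: a => [i|q] kF; last by rewrite Psi_zpr mul1r addr0.
by rewrite Psi_zpl; apply: Ch_eq (Ch_X (lshift n i) kF) _; rewrite /chg split_lshift.
Qed.

Lemma Ch_hi k a F : Ch k F -> Ch (k + chL a + 2) (Psi (zb R a) * F).
Proof.
case: a => [i|q] kF.
  by rewrite Psi_zbl; apply: Ch_eq (Ch_X (rshift n i) kF) _; rewrite /chg split_rshift /chL; lia.
by rewrite Psi_zbr -mulrA; apply: Ch_eq (Ch_theta (lshift m1 q) (Ch_theta (rshift m1 q) kF)) _; rewrite /chL; lia.
Qed.

Lemma Ch_ee k t s F : Ch k F -> Ch (k + chW s + 2 * t%:Z) (Psi (ee R t s) * F).
Proof.
move=> kF; elim: s t => [|a s IH] t.
  rewrite ee_nil; case: t => [|t]; last by rewrite Psi0 mul0r; exact: Ch_zero.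
  by rewrite Psi1 mul1r; apply: Ch_eq kF _; rewrite chW_nil; lia.
rewrite Psi_ee_cons; apply: Ch_add.
  by apply: Ch_eq (Ch_lo a (IH t)) _; rewrite chW_cons; lia.
case: t => [|t]; first exact: Ch_zero.
by apply: Ch_eq (Ch_hi a (IH t)) _; rewrite chW_cons; lia.
Qed.

Lemma Ch_ecol k c F : Ch k F -> Ch (k + chL c.1 + chL c.2 + 2) (Psi (ecol R c) * F).
Proof.
move=> kF; rewrite /ecol PsiB !PsiM mulrBl -!mulrA -scaleN1r.
apply: Ch_add; last apply: Ch_scale.
  by apply: Ch_eq (Ch_lo c.1 (Ch_hi c.2 kF)) _; lia.
by apply: Ch_eq (Ch_lo c.2 (Ch_hi c.1 kF)) _; lia.
Qed.

Lemma Ch_Th w : Ch ((size w)%:Z - m1%:Z) (Th w).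
Proof.
elim: w => [|p w IH]; first by rewrite /Submission.Th big_nil sub0r; exact: Ch_one.
by rewrite /Submission.Th big_cons; apply: Ch_eq (Ch_theta p IH) _; rewrite /=; lia.
Qed.

Lemma Ch_vv t s C w : Ch (2 * t%:Z + chW (lett s C) + 2 * (size C)%:Z + (size w)%:Z - m1%:Z) (vv R t s C w).
Proof.
rewrite /vv PsiM -mulrA /lett chW_cat.
suff H : Ch (chW (flatten [seq [:: c.1; c.2] | c <- C]) + 2 * (size C)%:Z + (size w)%:Z - m1%:Z)
    (Psi (\prod_(c <- C) ecol R c) * Th w).
  by apply: Ch_eq (Ch_ee t s H) _; lia.
elim: C => [|c C IH].
  by rewrite big_nil Psi1 mul1r; apply: Ch_eq (Ch_Th w) _; rewrite /= chW_nil; lia.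
rewrite big_cons PsiM -mulrA; apply: Ch_eq (Ch_ecol c IH) _.
by rewrite /= !chW_cons; lia.
Qed.

(** The number of fermionic letters is m1 minus the number of lone thetas, so the total charge
    depends only on lengths. *)
Lemma valid_charge l w : valid l w -> chW l = m1%:Z - (size w)%:Z - (size l)%:Z.
Proof.
move=> V; have ew : (size w = \sum_q (count_mem (lshift m1 q) w + count_mem (rshift m1 q) w))%N.
  by rewrite size_count big_split_ord big_split.
have ef : (\sum_q count_mem (inr q : L) l + size w = m1)%N.
  rewrite ew -big_split -[RHS]card_ord -sum1_card; apply: eq_bigr => q _ /=.
  by rewrite addnA; exact: V.
have e : chW l + (size l)%:Z = (\sum_q count_mem (inr q : L) l)%N%:Z.
  elim: l {V ef} => [|a l IH]; first by rewrite chW_nil big1.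
  rewrite chW_cons /= big_split /= PoszD -IH; case: a => [i|q].
    by rewrite big1 //= -addn1 PoszD; lia.
  rewrite (bigD1 q) //= eqxx big1 => [|p /negbTE pq]; first by rewrite -addn1 PoszD; lia.
  by rewrite eq_inr eq_sym pq.
by lia.
Qed.

Lemma Ch_balanced t s C w : size s = (t + t)%N -> valid (lett s C) w -> Ch 0 (vv R t s C w).
Proof.
move=> st V; apply: Ch_eq (Ch_vv t s C w) _; rewrite (valid_charge V).
have -> : size (lett s C) = (size s + (size C + size C))%N.
  by rewrite size_cat; congr addn; elim: C {V} => //= c C ->; lia.
by rewrite st; lia.
Qed.

End Charges.

(** * Eigenspaces and conclusion *)

Section Final.
Variables (R : comNzRingType) (m1 n : nat).
Hypothesis natinv : forall k : nat, exists h : R, h * k.+1%:R = 1.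
Local Notation A := (superpoly R (n + n) (m1 + m1)).
Local Notation sigma := (@sigma R m1 n).
Implicit Types (F v : A) (P : nat -> Prop).

Lemma eta_B_eigen P v : eta_B P v -> exists2 q, P q & Ch 0 v /\ sigma v = (-1) ^+ q *: v.
Proof.
move=> [t [q [_ [Pq /B_matches[d [s [C [w [Id M st eq ->]]]]] ->]]]]; exists q => //.
have [k ->] := iter_eta_hvec R t M; split; first by apply: Ch_scale; exact: Ch_balanced st M.1.
by rewrite sigmaZ (sigma_vv R (esym st) M.1) -eq !scalerA; congr (_ *: _); exact: mulrC.
Qed.

Definition eigen (e : R) F : Prop := Ch 0 F /\ sigma F = e *: F.

Lemma eigen_osp e : osp_submodule (eigen e).
Proof.
split.
- by split; [exact: Ch_zero | rewrite scaler0 linear0].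
- by move=> f g [cf sf] [cg sg]; split; [exact: Ch_add | rewrite sigmaD sf sg scalerDr].
- move=> k f [cf sf]; split; first exact: Ch_scale.
  by rewrite sigmaZ sf !scalerA mulrC.
- move=> X f oX [cf sf]; split; first exact: Ch_act.
  rewrite sigma_act // sf; exact: (GRing.scalable_linear (act_linear X)).
Qed.

Lemma generated_eigen e F : eigen e F -> forall v, generated F v -> eigen e v.
Proof. by move=> eF v; apply=> // [|f [cf _]]; [exact: eigen_osp | apply/Am1_Ch]. Qed.

Lemma eigen_lspan e (S : A -> Prop) : (forall v, S v -> eigen e v) -> forall v, lspan S v -> eigen e v.
Proof. by move=> Se; have [e0 eD eZ _] := eigen_osp e; apply: lspan_min. Qed.

Lemma eigen_split e g h : e * e = 1 -> eigen e g -> eigen (- e) h -> eigen e (g + h) -> h = 0.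
Proof.
move=> ee [_ sg] [_ sh] [_]; rewrite sigmaD sg sh scalerDr => /addrI.
rewrite scaleNr => /(congr1 (fun x => e *: x)); rewrite scalerN scalerA ee scale1r => hh.
have [k k2] := natinv 1; rewrite -[h]scale1r -k2 -scalerA scaler_nat mulr2n.
by rewrite -{1}hh addNr scaler0.
Qed.

(** Generated submodule and span both lie in the eigenspace of e, and each has a complement inside
    that of -e. By [eigen_split], an eigenvector for e has no component there, so both equal the
    eigenspace. *)
Lemma basis_eigen e P P' F F' : e * e = 1 -> eigen e F -> eigen (- e) F' ->
  (forall f, Ch 0 f -> sum_sub (generated F) (generated F') f) ->
  (forall f, Ch 0 f -> sum_sub (lspan (@eta_B R m1 n P)) (lspan (@eta_B R m1 n P')) f) ->
  (forall v, @eta_B R m1 n P v -> eigen e v) -> (forall v, @eta_B R m1 n P' v -> eigen (- e) v) ->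
  is_basis (@eta_B R m1 n P) (generated F).
Proof.
move=> ee eF eF' genA spanA eP eP'; split; first exact: eta_B_indep.
move=> v; split=> Hv.
  have ev := generated_eigen eF Hv; have [v0 [v1 [h0 h1 e01]]] := spanA _ ev.1.
  have ev0 := eigen_lspan eP h0; have ev1 := eigen_lspan eP' h1.
  by rewrite e01 in ev *; rewrite (eigen_split ee ev0 ev1 ev) addr0.
have ev := eigen_lspan eP Hv; have [v0 [v1 [h0 h1 e01]]] := genA _ ev.1.
have ev0 := generated_eigen eF h0; have ev1 := generated_eigen eF' h1.
by rewrite e01 in ev *; rewrite (eigen_split ee ev0 ev1 ev) addr0.
Qed.

End Final.

Section Generators.
Variables (R : comNzRingType) (m1 n : nat) (n_gt1 : (1 < n)%N).
Hypothesis natinv : forall k : nat, exists h : R, h * k.+1%:R = 1.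
Local Notation A := (superpoly R (n + n) (m1 + m1)).
Local Notation L := ('I_n + 'I_m1)%type.
Let w0 := [seq lshift m1 j | j <- enum 'I_m1].

Lemma Th_even_gen : Th R n w0 = even_gen R m1 n.
Proof. by rewrite /Submission.Th big_map /even_gen [index_enum _]unlock -enumT. Qed.

Lemma valid_w0 C : (forall c, c \in C -> exists i j, c = (inl i, inl j)) -> valid (lett [::] C : seq L) w0.
Proof.
move=> CE q; rewrite !count_map.
rewrite [X in (_ + X)%N](eq_count (a2 := pred0)) => [|j]; last by rewrite /= eq_lrshift.
rewrite (eq_count (a2 := pred1 q)) => [|j]; last by rewrite /= eq_lshift.
rewrite count_pred0 -enumT [count_mem q _]count_uniq_mem ?enum_uniq // mem_enum addn0 /lett cat0s.
rewrite (_ : count_mem _ _ = 0%N) //; apply/count_memPn/negP => /flattenP[_ /mapP[c /CE[i [j ->]] ->]].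
by rewrite !inE.
Qed.

Lemma nleft_w0 : nleft w0 = m1.
Proof.
rewrite -[RHS]card_ord -sum1_card; apply: eq_bigr => j _.
by rewrite map_f // mem_enum.
Qed.

Lemma even_gen_eigen : eigen ((-1) ^+ m1) (even_gen R m1 n).
Proof.
have V : valid (lett [::] [::] : seq L) w0 by exact: valid_w0.
have e : even_gen R m1 n = vv R 0 [::] [::] w0.
  by rewrite /Submission.vv ee_nil big_nil mulr1 Psi1 mul1r Th_even_gen.
rewrite e; split; first exact: (@Ch_balanced R m1 n 0).
by rewrite (sigma_vv (k := 0) (l := 0) (s := [::]) R erefl V) nleft_w0.
Qed.

Lemma odd_gen_eigen : eigen (- (-1) ^+ m1) (odd_gen R m1 n_gt1).
Proof.
pose u := Ordinal (ord_penult_subproof n_gt1); pose w := Ordinal (ord_last_subproof n_gt1).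
have V : valid (lett [::] [:: (inl u, inl w)] : seq L) w0.
  by apply: valid_w0 => c; rewrite inE => /eqP ->; exists u, w.
have e : odd_gen R m1 n_gt1 = vv R 0 [::] [:: (inl u, inl w)] w0.
  rewrite /Submission.vv ee_nil big_seq1 mul1r Th_even_gen /ecol PsiB !PsiM.
  by rewrite [(inl u, inl w).1]/= [(inl u, inl w).2]/= !Psi_zpl !Psi_zbl.
rewrite e; split; first exact: (@Ch_balanced R m1 n 0).
by rewrite (sigma_vv (k := 0) (l := 0) (s := [::]) R erefl V) nleft_w0 exprS mulN1r.
Qed.

Lemma parity_sign q : (-1) ^+ q = (if (2 %| m1%:Z - q%:Z)%Z then 1 else -1) * (-1) ^+ m1 :> R.
Proof.
have -> : (2 %| m1%:Z - q%:Z)%Z = (odd m1 == odd q).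
  by rewrite dvdzE /= dvdn2; lia.
by rewrite -signr_odd -[in RHS]signr_odd; do 2!case: odd; rewrite /= ?expr0 ?expr1 ?mulN1r ?mul1r ?opprK.
Qed.

Lemma gens_split F : Ch 0 F -> sum_sub (generated (even_gen R m1 n)) (generated (odd_gen R m1 n_gt1)) F.
Proof.
have oS := sum_sub_osp (generated_osp (even_gen R m1 n)) (generated_osp (odd_gen R m1 n_gt1)).
have [V0 _ _ _] := generated_osp (even_gen R m1 n); have [W0 _ _ _] := generated_osp (odd_gen R m1 n_gt1).
apply: (gens_all natinv oS).
- by exists (even_gen R m1 n), 0; split=> //; rewrite addr0.
- by exists 0, (odd_gen R m1 n_gt1); split=> //; rewrite add0r.
Qed.

Lemma eta_B_split (F : A) : Ch 0 F -> sum_sub (lspan (@eta_B R m1 n (fun q => (2 %| m1%:Z - q%:Z)%Z)))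
   (lspan (@eta_B R m1 n (fun q => ~~ (2 %| m1%:Z - q%:Z)%Z))) F.
Proof.
move=> /(span_eta_B natinv); apply: lspan_min.
- by exists 0, 0; split; rewrite ?addr0 //; exact: lspan0.
- move=> _ _ [f [g [Vf Wg ->]]] [f' [g' [Vf' Wg' ->]]].
  by exists (f + f'), (g + g'); split; [exact: lspanD | exact: lspanD | rewrite addrACA].
- move=> c _ [f [g [Vf Wg ->]]]; exists (c *: f), (c *: g).
  by split; [exact: lspanZ | exact: lspanZ | rewrite scalerDr].
move=> v [t [q [w [_ Bw ev]]]]; have [pq|pq] := boolP (2 %| m1%:Z - q%:Z)%Z.
  exists v, 0; split; rewrite ?addr0 //; last exact: lspan0.
  by apply: lspan_mem; exists t, q, w.
exists 0, v; split; rewrite ?add0r //; first exact: lspan0.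
by apply: lspan_mem; exists t, q, w.
Qed.

Lemma sum_subC (V W : A -> Prop) F : sum_sub V W F -> sum_sub W V F.
Proof. by move=> [g [h [Vg Wh ->]]]; exists h, g; rewrite addrC. Qed.

Theorem bases_of_generated :
  is_basis (@eta_B R m1 n (fun q => (2 %| m1%:Z - q%:Z)%Z)) (generated (@even_gen R m1 n)) /\
  is_basis (@eta_B R m1 n (fun q => ~~ (2 %| m1%:Z - q%:Z)%Z)) (generated (@odd_gen R m1 n n_gt1)).
Proof.
have ee : (-1) ^+ m1 * (-1) ^+ m1 = 1 :> R by rewrite -expr2 sqrr_sign.
have He v : @eta_B R m1 n (fun q => (2 %| m1%:Z - q%:Z)%Z) v -> eigen ((-1) ^+ m1) v.
  by move=> /eta_B_eigen[q /= pq [cv sv]]; split=> //; rewrite sv (parity_sign q) pq mul1r.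
have Ho v : @eta_B R m1 n (fun q => ~~ (2 %| m1%:Z - q%:Z)%Z) v -> eigen (- (-1) ^+ m1) v.
  by move=> /eta_B_eigen[q /= /negbTE pq [cv sv]]; split=> //; rewrite sv (parity_sign q) pq mulN1r.
split.
  exact: (basis_eigen natinv ee even_gen_eigen odd_gen_eigen gens_split eta_B_split He Ho).
have ee' : - (-1) ^+ m1 * - (-1) ^+ m1 = 1 :> R by rewrite mulrNN.
have eE : eigen (- - (-1) ^+ m1) (even_gen R m1 n) by rewrite opprK; exact: even_gen_eigen.
apply: (basis_eigen natinv ee' odd_gen_eigen eE (fun f h => sum_subC (gens_split h))
  (* The second half is the first one with e replaced by -e and both decompositions reversed. *)
  (fun f h => sum_subC (eta_B_split h)) Ho) => v.
by rewrite opprK; exact: He.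
Qed.

End Generators.

Theorem theorem3p3 (R : realType) (m1 n : nat) (m1_gt0 : (0 < m1)%N)
    (n_gt1 : (1 < n)%N) :
  is_basis (@eta_B R[i] m1 n (fun q => (2 %| m1%:Z - q%:Z)%Z))
           (generated (@even_gen R[i] m1 n)) /\
  is_basis (@eta_B R[i] m1 n (fun q => ~~ (2 %| m1%:Z - q%:Z)%Z))
           (generated (@odd_gen R[i] m1 n n_gt1)).
Proof.
apply: bases_of_generated => k; exists (k.+1%:R)^-1.
by rewrite mulVf // pnatr_eq0.
Qed.
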